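(* Let $\mathbb K\in\{\mathbb R,\mathbb C\}$, let $B,\bar B$ be Banach spaces over $\mathbb K$, and let $L(\varepsilon)=\sum_{i=0}^\infty \varepsilon^i L_i$ be an analytic family of bounded linear operators $L_i\in L[B,\bar B]$, defined for $\varepsilon$ in an open neighbourhood of $0$ in $\mathbb K$. Assume that the recursion described in the context stabilizes at some $k\ge 0$ and that all subspaces in the direct sums $$B=N_1^c\oplus\cdots\oplus N_{k+1}^c\oplus N_{k+1},\qquad \bar B=R_1\oplus\cdots\oplus R_{k+1}\oplus R_{k+1}^c$$ are closed. Then there is an open neighbourhood $U\subset\mathbb K$ of $0$ on which the power series $\phi(\varepsilon)=\sum_{i=0}^\infty\varepsilon^i M_{k+1,k+1+i}$ and $\psi(\varepsilon)=I_{\bar B}+\sum_{i=1}^\infty\varepsilon^i\psi_i$ (both given in the context) define analytic families of bounded bijective operators on $B$ and $\bar B$ respectively, such that the following hold. (i) $\phi(\varepsilon)$ transforms $L(\varepsilon)$ into the analytic normal form $$S(\varepsilon):=L(\varepsilon)\cdot\phi(\varepsilon)=S_1+\varepsilon S_2+\cdots+\varepsilon^kS_{k+1}+\sum_{l=2}^\infty\varepsilon^{k+l-1}S_{k+l},$$ where for $l=1,\dots,k+1$ $$S_l(N_0^c+\cdots+N_{l-1}^c)\subset R_{l-1}^c,\qquad S_l N_l^c=R_l,\qquad S_lN_l=0,$$ and for $l\ge 2$ $$R[S_{k+l}]\subset R_{k+1}^c,\qquad S_{k+l}N_{k+1}=0.$$ In particular, $S_{l+1}N_{k+1}=0$ for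 all $l\ge 0$. (ii) The family $L(\varepsilon)$ is diagonalized according to $$\psi^{-1}(\varepsilon)\cdot L(\varepsilon)\cdot\phi(\varepsilon)=\Delta(\varepsilon),\qquad \Delta(\varepsilon)=S_1P_1+\varepsilon S_2P_2+\cdots+\varepsilon^kS_{k+1}P_{k+1},$$ i.e. $L(\varepsilon)$ and the operator polynomial $\Delta(\varepsilon)$ of degree $k\geq 0$ are analytically equivalent. (iii) For $\varepsilon\in U\setminus\{0\}$, $$N[L(\varepsilon)]=\phi(\varepsilon)\cdot N_{k+1},\qquad R[L(\varepsilon)]=\psi(\varepsilon)\cdot[R_1\oplus\cdots\oplus R_{k+1}].$$ In particular, the kernels $N[L(\varepsilon)]$ and ranges $R[L(\varepsilon)]$, $\varepsilon\ne0$, are analytically embedded in the families $N(\varepsilon)=\phi(\varepsilon)N_{k+1}$ and $R(\varepsilon)=\psi(\varepsilon)[R_1\oplus\cdots\oplus R_{k+1}]$, $\varepsilon\in U$. (iv) For $\varepsilon\neq0$, the family $$\Delta^{-1}(\varepsilon)=\varepsilon^{-k}S_{k+1}^{-1}\mathcal P_{k+1}+\cdots+S_1^{-1}\mathcal P_1$$ is a smooth generalized inverse of $\Delta(\varepsilon)$, with a pole of order $k$ at $\varepsilon=0$. Correspondingly, $L^{-1}(\varepsilon):=\phi(\varepsilon)\cdot\Delta^{-1}(\varepsilon)\cdot\psi^{-1}(\varepsilon)$ is a generalized inverse of $L(\varepsilon)$ which is analytic for $\varepsilon\in U\setminus\{0\}$, with a pole of order $k$ at $\varepsilon=0$. For $\varepsilon\in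 U\setminus\{0\}$ the analytic families $$L^{-1}(\varepsilon)L(\varepsilon)=\phi(\varepsilon)(P_1+\cdots+P_{k+1})\phi^{-1}(\varepsilon),\qquad L(\varepsilon)L^{-1}(\varepsilon)=\psi(\varepsilon)(\mathcal P_1+\cdots+\mathcal P_{k+1})\psi^{-1}(\varepsilon)$$ are projections onto $\phi(\varepsilon)[N_1^c\oplus\cdots\oplus N_{k+1}^c]\subset B$ and $R[L(\varepsilon)]=\psi(\varepsilon)[R_1\oplus\cdots\oplus R_{k+1}]\subset\bar B$ respectively. These families continue analytically to $\varepsilon=0$, with values $P_1+\cdots+P_{k+1}$ and $\mathcal P_1+\cdots+\mathcal P_{k+1}$ at $\varepsilon=0$.
   Context: Notation. $L[B,\bar B]$ denotes bounded linear operators, $N[T]$ and $R[T]$ the kernel and range of $T$. $I_B,I_{\bar B}$ are identities. A generalized inverse of an operator $T$ is an operator $T^{-1}$ with $TT^{-1}T=T$ and $T^{-1}TT^{-1}=T^{-1}$. A pole of order $k=0$ means analyticity at $0$. Recursion. Set $N_0:=B$, $N_0^c:=\{0\}$, $R_0:=\{0\}$, $R_0^c:=\bar B$, $\bar S_1:=S_1:=L_0$, $N_1:=N[S_1]$, $R_1:=R[S_1]$; let $N_1^c$ be a chosen complement of $N_1$ in $N_0$ and $R_1^c$ a chosen complement of $R_1$ in $R_0^c$. Set $M_1:=M^{(1)}:=I_B$. For $k\ge1$, given the upper triangular operator matrix $M^{(k)}$ ($k\times k$, entries linear maps $B\to B$) with last column $M_k$, define $$\bar S_{k+1}:=(L_1\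 \cdots\ L_k)\cdot M_k,\qquad S_{k+1}:=P_{R_k^c}\bar S_{k+1},$$ where $P_{R_k^c}$ is the projection of $\bar B=R_1\oplus\cdots\oplus R_k\oplus R_k^c$ onto $R_k^c$ along $R_1\oplus\cdots\oplus R_k$. Put $N_{k+1}:=N[S_{k+1}|_{N_k}]$, $R_{k+1}:=R[S_{k+1}|_{N_k}]$; let $N_{k+1}^c$ be a chosen complement of $N_{k+1}$ in $N_k$ and $R_{k+1}^c$ a chosen complement of $R_{k+1}$ in $R_k^c$. This gives $B=N_1^c\oplus\cdots\oplus N_{k+1}^c\oplus N_{k+1}$ and $\bar B=R_1\oplus\cdots\oplus R_{k+1}\oplus R_{k+1}^c$. Let $P_i$ and $\mathcal P_i$ be the projections onto $N_i^c$ and $R_i$ with respect to these direct sums. $S_i$ restricts to a bijection $N_i^c\to R_i$, and $S_i^{-1}:R_i\to N_i^c$ denotes its inverse. Define an operator column $E_{k+1}=(E_{1,k+1},\dots,E_{k+1,k+1})^T$ from bottom to top by $$E_{k+1,k+1}:=I_B,\qquad E_{i,k+1}:=-S_i^{-1}\mathcal P_i\sum_{\nu=i+1}^{k+1}\bar S_\nu E_{\nu,k+1},\quad i=k,\dots,1,$$ then the column $$M_{k+1}=(M_{1,k+1},\dots,M_{k+1,k+1})^T:=\begin{pmatrix}I_B&0\\0&M^{(k)}\end{pmatrix}E_{k+1},$$ and let $M^{(k+1)}$ be the $(k+1)\times(k+1)$ upper triangular matrix whose columns are $M_1,\dots,M_{k+1}$ (filled up with zeros below). One has $M_{i,i}=I_B$.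 Stabilization at $k\ge0$ means $R_{k+1}\ne\{0\}$ and $R_{k+l}=\{0\}$ for all $l\ge2$ (equivalently $N_k\supsetneq N_{k+1}=N_{k+l}$ for all $l\ge1$). Transformations. $\phi(\varepsilon)=\sum_{i=0}^\infty\varepsilon^iM_{k+1,k+1+i}$ (row $k+1$ of the infinite matrix with columns $M_1,M_2,\dots$; its constant term is $I_B$), and $\psi(\varepsilon)=I_{\bar B}+\sum_{i=1}^\infty\varepsilon^i\psi_i$ with $\psi_i:=S_{i+1}S_1^{-1}\mathcal P_1+\cdots+S_{k+i+1}S_{k+1}^{-1}\mathcal P_{k+1}$. *)

(* Defs.v *)
From HB Require Import structures.
From mathcomp Require Import all_boot all_order all_algebra.
From mathcomp Require Import all_classical all_reals all_analysis.
From mathcomp Require Import complex.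
Set Implicit Arguments.
Unset Strict Implicit.
Unset Printing Implicit Defensive.
Import Order.TTheory GRing.Theory Num.Theory.
Import numFieldNormedType.Exports.
Local Open Scope classical_set_scope.
Local Open Scope ring_scope.

Inductive scalar_kind := RealScalars | ComplexScalars.

Definition scalar_field (R : realType) (s : scalar_kind) : numFieldType :=
  match s with
  | RealScalars => R
  | ComplexScalars => R[i]
  end.

Section LinearAlgebra.
Context {K : numFieldType}.

Definition subspace {E : lmodType K} (V : set E) : Prop :=
  V 0 /\ forall (a : K) x y, V x -> V y -> V (a *: x + y).

Definition sumset {E : lmodType K} (V W : set E) : set E :=
  [set x + y | x in V & y in W].

Definition is_complement {E : lmodType K} (X V W : set E) : Prop :=
  [/\ subspace W, sumset V W = X & V `&` W = [set 0]].

(* The sum V m + ... + V (n - 1) of subspaces. *)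
Definition sum_spaces {E : lmodType K} (V : nat -> set E) (m n : nat) : set E :=
  \big[sumset/[set 0]]_(m <= j < n) V j.

(* When E is the direct sum of V and W, the projection onto V along W
   (picked by classical choice; no meaning otherwise). *)
Definition proj_along {E : normedModType K} (V W : set E) (x : E) : E :=
  get [set v | V v /\ W (x - v)].

(* The projection onto the summand V i with respect to the direct sum
   E = V 1 (+) ... (+) V n (+) W n. *)
Definition dsum_proj {E : normedModType K} (V W : nat -> set E) (n i : nat) :
    E -> E :=
  proj_along (V i)
    (sumset (\big[sumset/[set 0]]_(1 <= j < n.+1 | j != i) V j) (W n)).

End LinearAlgebra.

Section BoundedOperators.
Context {K : numFieldType}.

Definition bounded_linear {E F : normedModType K} (f : E -> F) : Prop :=
  linear f /\ exists C : K, forall x, `|f x| <= C * `|x|.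

(* Inverse of a bijective operator. *)
Definition op_inv {E F : normedModType K} (f : E -> F) : F -> E :=
  'pinv_(fun=> 0) setT f.

(* Convergence in operator norm: [|T n - T|] <= e is spelled out as a bound
   on the vectors, which also makes sense for complex-valued norms. *)
Definition op_cvg {E F : normedModType K} (T_ : nat -> E -> F) (T : E -> F) :
    Prop :=
  forall e : K, 0 < e ->
    \forall n \near \oo, forall x, `|T_ n x - T x| <= e * `|x|.

(* T = a 0 + z a 1 + z^2 a 2 + ... in operator norm. *)
Definition op_series {E F : normedModType K} (a : nat -> E -> F) (z : K)
    (T : E -> F) : Prop :=
  op_cvg (fun n x => \sum_(0 <= i < n) z ^+ i *: a i x) T.

(* On U, the family T is the sum of the power series (about 0) with bounded
   linear coefficients a. *)
Definition op_power_series {E F : normedModType K} (U : set K)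
    (a : nat -> E -> F) (T : K -> E -> F) : Prop :=
  (forall i, bounded_linear (a i)) /\
  (forall z, U z -> op_series a z (T z)).

Definition analytic_on {E F : normedModType K} (U : set K)
    (T : K -> E -> F) : Prop :=
  forall z, U z -> exists a : nat -> E -> F,
    (forall i, bounded_linear (a i)) /\
    \forall w \near z, op_series a (w - z) (T w).

Definition has_op_derivative {E F : normedModType K} (T : K -> E -> F)
    (z : K) (D : E -> F) : Prop :=
  forall e : K, 0 < e -> \forall h \near 0^', forall x,
    `|h^-1 *: (T (z + h) x - T z x) - D x| <= e * `|x|.

Definition smooth_on {E F : normedModType K} (U : set K)
    (T : K -> E -> F) : Prop :=
  exists D : nat -> K -> E -> F,
    [/\ forall z, U z -> D 0%N z =1 T z,
        forall n z, U z -> bounded_linear (D n z)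
      & forall n z, U z -> has_op_derivative (D n) z (D n.+1 z)].

(* T(z) = z^(-k) (a 0 + z a 1 + ...) near 0, z <> 0, where a 0 <> 0 if k > 0;
   for k = 0, the family T extends analytically to 0. *)
Definition pole_of_order {E F : normedModType K} (k : nat)
    (T : K -> E -> F) : Prop :=
  exists a : nat -> E -> F,
    [/\ forall i, bounded_linear (a i),
        (0 < k)%N -> exists x, a 0%N x <> 0
      & \forall z \near 0^', op_series a z (fun x => z ^+ k *: T z x)].

Definition analytic_bijections {E F : normedModType K} (U : set K)
    (T : K -> E -> F) : Prop :=
  analytic_on U T /\
  forall z, U z -> bounded_linear (T z) /\ bijective (T z).

Definition analytically_equivalent {E F : normedModType K} (U : set K)
    (T T' : K -> E -> F) : Prop :=
  exists (Phi : K -> E -> E) (Psi : K -> F -> F),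
    [/\ analytic_bijections U Phi, analytic_bijections U Psi
      & forall z, U z -> op_inv (Psi z) \o T z \o Phi z =1 T' z].

(* The subspaces V z (z in U, z <> 0) coincide with the members of the
   analytic family of subspaces T z [W], z in U. *)
Definition analytically_embedded {E : normedModType K} (U : set K)
    (V : K -> set E) (T : K -> E -> E) (W : set E) : Prop :=
  [/\ analytic_bijections U T, subspace W
    & forall z, U z -> z <> 0 -> V z = T z @` W].

Definition generalized_inverse {E F : normedModType K} (T : E -> F)
    (T' : F -> E) : Prop :=
  [/\ bounded_linear T', T \o T' \o T =1 T & T' \o T \o T' =1 T'].

Definition is_projection_onto {E : normedModType K} (p : E -> E)
    (V : set E) : Prop :=
  [/\ bounded_linear p, p \o p =1 p & range p = V].

End BoundedOperators.

Section Recursion.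
Context {K : numFieldType} {B Bbar : completeNormedModType K}.

(* The inverse of the bijection S i : Nc i -> R i. *)
Definition Sinv (Nc : nat -> set B) (S : nat -> B -> Bbar) (i : nat) :
    Bbar -> B :=
  'pinv_(fun=> 0) (Nc i) (S i).

(* Rg i and Rgc i are the subspaces R_i and R_i^c.  Subspaces are indexed from
   0; Sbar, S, M and E are indexed from 1 and their values at index 0 are
   irrelevant.  M i j is the entry in row i and column j of all the matrices
   M^(k) with j <= k. *)
Record recursion (L : nat -> B -> Bbar)
    (N Nc : nat -> set B) (Rg Rgc : nat -> set Bbar)
    (Sbar S : nat -> B -> Bbar) (M E : nat -> nat -> B -> B) : Prop := {
  rec_N0 : N 0%N = setT;
  rec_Nc0 : Nc 0%N = [set 0];
  rec_R0 : Rg 0%N = [set 0];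
  rec_Rc0 : Rgc 0%N = setT;
  rec_Sbar1 : Sbar 1%N =1 L 0%N;
  rec_S1 : S 1%N =1 L 0%N;
  rec_N : forall k, N k.+1 = [set x | N k x /\ S k.+1 x = 0];
  rec_R : forall k, Rg k.+1 = S k.+1 @` N k;
  rec_Nc : forall k, is_complement (N k) (N k.+1) (Nc k.+1);
  rec_Rc : forall k, is_complement (Rgc k) (Rg k.+1) (Rgc k.+1);
  rec_M1 : M 1%N 1%N =1 id;
  rec_Sbar : forall k, (1 <= k)%N -> forall x,
    Sbar k.+1 x = \sum_(1 <= i < k.+1) L i (M i k x);
  rec_S : forall k, (1 <= k)%N -> forall x,
    S k.+1 x = proj_along (Rgc k) (sum_spaces Rg 1 k.+1) (Sbar k.+1 x);
  rec_Ediag : forall k, (1 <= k)%N -> E k.+1 k.+1 =1 id;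
  rec_E : forall k i, (1 <= i <= k)%N -> forall x,
    E i k.+1 x =
      - Sinv Nc S i (dsum_proj Rg Rgc k.+1 i
          (\sum_(i.+1 <= nu < k.+2) Sbar nu (E nu k.+1 x)));
  (* M_{k+1} is the product of diag(I, M^(k)) with the column E_{k+1}. *)
  rec_Mtop : forall k, (1 <= k)%N -> M 1%N k.+1 =1 E 1%N k.+1;
  rec_M : forall k i, (1 <= i <= k)%N -> forall x,
    M i.+1 k.+1 x = \sum_(1 <= nu < k.+1) M i nu (E nu.+1 k.+1 x);
  rec_Mlow : forall i j, (1 <= j < i)%N -> forall x, M i j x = 0
}.

Definition stabilizes_at (Rg : nat -> set Bbar) (k : nat) : Prop :=
  Rg k.+1 <> [set 0] /\ forall l, (2 <= l)%N -> Rg (k + l)%N = [set 0].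

Section Families.
Variables (N Nc : nat -> set B) (Rg Rgc : nat -> set Bbar).
Variables (S : nat -> B -> Bbar) (k : nat).

(* P_i and calP_i, i = 1, ..., k + 1. *)
Definition projN (i : nat) : B -> B := dsum_proj Nc N k.+1 i.
Definition projR (i : nat) : Bbar -> Bbar := dsum_proj Rg Rgc k.+1 i.

Definition psi_coef (i : nat) (y : Bbar) : Bbar :=
  if i is 0%N then y
  else \sum_(1 <= j < k.+2) S (i + j)%N (Sinv Nc S j (projR j y)).

Definition Delta (z : K) (x : B) : Bbar :=
  \sum_(1 <= i < k.+2) z ^+ i.-1 *: S i (projN i x).

Definition DeltaInv (z : K) (y : Bbar) : B :=
  \sum_(1 <= i < k.+2) z ^- i.-1 *: Sinv Nc S i (projR i y).

End Families.
End Recursion.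

(* Main.v *)
Require Import Defs.
From HB Require Import structures.
From mathcomp Require Import all_boot all_order all_algebra.
From mathcomp Require Import all_classical all_reals all_analysis.
From mathcomp Require Import complex zify ring.
Set Implicit Arguments.
Unset Strict Implicit.
Unset Printing Implicit Defensive.
Import Order.TTheory GRing.Theory Num.Theory.
Import numFieldNormedType.Exports.
Local Open Scope classical_set_scope.
Local Open Scope ring_scope.
Local Notation subspace := Defs.subspace.

(** Why the theorem holds.

    Column [n] of [M], read from bottom to top, is an operator polynomial
    [m_n(z) = M_(n,n) + z M_(n-1,n) + ...].  The matrices [E] perform a Gaussian
    elimination, so that the coefficient of order [n] of [L m_(n+1)] is [S_(n+1)]
    ([sum_Sbar_E]); the recursion for [M] then propagates this to all lower
    orders ([sum_L_M]), because the correction terms take values in kernels of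
    the earlier [S_i].  Once the recursion has stabilized at [k], the rows of [M]
    from row [k + 1] on are shifted copies of each other ([M_toeplitz]), so that
    [m_n] agrees with the single series [phi] in all orders below [n - k], and the
    identity becomes [L phi = sum_i z^i S_(i+1)] ([sum_L_phi]).

    Each [S_(n+1)] vanishes on [N_(n+1)], and [psi_i] maps [S_j v] to [S_(i+j) v]
    for [v] in [N_j^c].  Comparing coefficients gives [L phi = psi Delta]
    ([psi_Delta_coef]).  As [phi] and [psi] start with the identity they are
    invertible near [0], and kernel, range and generalized inverse of [L(z)] are
    transported from those of [Delta(z)], which are evident.

    Two analytic points remain.  The projections onto the closed summands and the
    operators [S_i^{-1} calP_i] are bounded: this is the open mapping theorem, used
    in the form of Zabreiko's lemma ([zabreiko]).  The series [phi] has a positive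
    radius of convergence: after the stabilization the columns of [E] have,
    apart from the identity at the bottom, nonzero entries in the first [k + 1] rows
    only, and these are controlled by [Sbar_n] with uniform constants, so that a
    weighted sum of the norms in column [n] of [M] grows at most
    geometrically ([M_growth]).

    All families are handled through quantitative power series ([expansion]),
    which are stable under composition, inversion and recentering. *)

(** * Geometric limits and Zabreiko's lemma *)

(** Real and complex scalars are treated at once.  The order of a [numFieldType]
    is partial in general, so there is no operator norm as a supremum; all
    estimates below are pointwise in the vector. *)
Definition archimedean (K : numFieldType) : Prop :=
  forall x : K, 0 <= x -> exists n, x < n%:R.

Section GeometricLimits.
Context {K : numFieldType}.
Hypothesis archiK : archimedean K.
Local Notation h n := ((2^-1 : K) ^+ n).

Lemma half_ge0 n : 0 <= h n. Proof. by rewrite exprn_ge0 ?invr_ge0. Qed.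
#[local] Hint Resolve half_ge0 : core.
Lemma half_le1 n : h n <= 1.
Proof. by rewrite exprn_ile1 ?invr_ge0// invf_le1// ler1n. Qed.
Lemma halfD n : h n.+1 + h n.+1 = h n.
Proof. by rewrite exprS; field. Qed.

Lemma half_small (C e : K) : 0 <= C -> 0 < e -> exists n, C * h n <= e.
Proof.
move=> C0 e0; have [n ltn] := archiK (divr_ge0 C0 (ltW e0)); exists n.
rewrite exprVn ler_pdivrMr ?exprn_gt0// mulrC -ler_pdivrMr//.
apply: le_trans (ltW ltn) _; rewrite -natrX ler_nat.
exact/ltnW/ltn_expl.
Qed.

Lemma half_small_near (C e : K) : 0 <= C -> 0 < e ->
  exists n0, forall n, (n0 <= n)%N -> C * h n <= e.
Proof.
move=> C0 /(half_small C0)[n0 hn0]; exists n0 => n le_n; apply: le_trans hn0.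
rewrite ler_wpM2l// -(subnK le_n) exprD ler_piMl//; exact: half_le1.
Qed.

Lemma le_half_limit (a b C : K) : 0 <= C -> (forall n, a <= b + C * h n) -> a <= b.
Proof.
move=> C0 ab; apply/ler_addgt0Pr => e e0.
have [n Cn] := half_small C0 e0.
by rewrite (le_trans (ab n))// lerD2l.
Qed.

Lemma sum_half_le (n m : nat) : \sum_(n <= i < m) h i <= 2 * h n.
Proof.
have [le_nm|lt_mn] := leqP n m; last by rewrite big_geq 1?ltnW// mulr_ge0.
suff : \sum_(n <= i < m) h i + 2 * h m <= 2 * h n.
  by apply: le_trans; rewrite lerDl mulr_ge0.
rewrite -(subnK le_nm); elim: (m - n)%N => [|p ih].
  by rewrite add0n big_geq// add0r.
rewrite addSn big_nat_recr ?leq_addl//= (le_trans _ ih)// -addrA lerD2l.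
by rewrite -(halfD (p + n)) mulrDr mulr_natl mulr2n.
Qed.

Section Space.
Context {E : normedModType K}.
Implicit Types (u : nat -> E) (l : E).

(** Convergence at a geometric rate: all the limits below are of this kind,
    which reduces limit arguments to norm inequalities over [K], where the
    order need not be total. *)
Definition geo_cvg (C : K) u l : Prop := forall n, `|l - u n| <= C * h n.

Lemma geo_cvg_unique C C' u l l' : 0 <= C -> 0 <= C' ->
  geo_cvg C u l -> geo_cvg C' u l' -> l = l'.
Proof.
move=> C0 C0' ul ul'; apply/eqP; rewrite -subr_eq0 -normr_le0.
apply: (@le_half_limit _ _ (C + C')) => [|n]; first exact: addr_ge0.
rewrite add0r mulrDl; have -> : l - l' = (l - u n) - (l' - u n).
  by rewrite opprB addrA subrK.
by rewrite (le_trans (ler_normB _ _))// lerD.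
Qed.

Lemma geo_cvg_cvgn C u l : 0 <= C -> geo_cvg C u l -> u @ \oo --> l.
Proof.
move=> C0 ul; apply/cvgrPdist_le => e e0.
have [n0 hn0] := half_small_near C0 e0.
by exists n0 => // n /= len; rewrite (le_trans (ul n))// hn0.
Qed.

Lemma geo_cvg_closed C u l (V : set E) : 0 <= C -> closed V ->
  (forall n, V (u n)) -> geo_cvg C u l -> V l.
Proof.
move=> C0 Vcl Vu /(geo_cvg_cvgn C0) ul.
by apply: closed_cvg Vcl _ _ ul; apply: nearW.
Qed.

End Space.

Lemma geo_cauchy_cvg (E : completeNormedModType K) (C : K) (u : nat -> E) : 0 <= C ->
  (forall n, `|u n.+1 - u n| <= C * h n) -> exists l, geo_cvg (2 * C) u l.
Proof.
move=> C0 uC.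
have dist n m : (n <= m)%N -> `|u m - u n| <= 2 * C * h n.
  move=> le_nm; rewrite -telescope_sumr// (le_trans (ler_norm_sum _ _ _))//.
  apply: (@le_trans _ _ (\sum_(n <= i < m) C * h i)); first exact: ler_sum.
  by rewrite -mulr_sumr -mulrA mulrCA ler_wpM2l// sum_half_le.
have C20 : 0 <= 2 * C by rewrite mulr_ge0.
have cu : cvg (u @ \oo).
  apply: cauchy_cvg; apply: cauchy_exP => e e0.
  have [n0 hn0] := half_small C20 (divr_gt0 e0 (ltr0n K 2)).
  exists (u n0); rewrite -ball_normE; exists n0 => // m /= len.
  rewrite distrC (le_lt_trans (dist _ _ len))// (le_lt_trans hn0)//.
  by rewrite ltr_pdivrMr// ltr_pMr// ltr1n.
exists (lim (u @ \oo)) => n.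
apply/ler_addgt0Pr => e e0.
have /cvgrPdist_le/(_ e e0)[m _ um] := cu.
have -> : lim (u @ \oo) - u n =
  (lim (u @ \oo) - u (maxn n m)) + (u (maxn n m) - u n) by rewrite addrA subrK.
rewrite (le_trans (ler_normD _ _))// addrC lerD ?dist ?leq_maxl//.
by apply: um => /=; rewrite leq_maxr.
Qed.

Section Zabreiko.
Context {E : completeNormedModType K}.
Variable p : E -> K.
Hypothesis pD : forall x y, p (x + y) <= p x + p y.
Hypothesis pZ : forall a x, p (a *: x) = `|a| * p x.
Variable c : K.
Hypothesis c_ge0 : 0 <= c.
Hypothesis p_series : forall C (x : nat -> E) l C', 0 <= C -> 0 <= C' ->
  (forall j, p (x j) <= C * h j) ->
  geo_cvg C' (fun n => \sum_(0 <= j < n) x j) l -> p l <= c * C.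

Lemma seminorm_ge0 x : 0 <= p x.
Proof.
have p0 : p 0 = 0 by rewrite -(scale0r (0 : E)) pZ normr0 mul0r.
have pN : p (- x) = p x by rewrite -scaleN1r pZ normrN1 mul1r.
have := pD x (- x); rewrite subrr p0 pN -mulr2n -mulr_natl.
by rewrite pmulr_rge0.
Qed.

(** Baire's argument: otherwise there are nested closed balls, the [m]-th of which
    avoids the sublevel set of [m], and [p] exceeds every integer at their common
    point. *)
Lemma zabreiko_ball : exists m x0 (r : K), [/\ 0 < r &
  forall y (e : K), `|y - x0| < r -> 0 < e ->
    exists2 u, p u <= m%:R & `|y - u| <= e].
Proof.
apply: contrapT => nball.
pose good (m : nat) (b b' : E * K) := [/\ 0 < b'.2, b'.2 <= 2^-1 * b.2,
   `|b'.1 - b.1| <= 2^-1 * b.2 & forall u, `|u - b'.1| <= b'.2 -> ~ p u <= m%:R].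
have step (q : nat * (E * K)) : exists b', 0 < q.2.2 -> good q.1 q.2 b'.
  case: q => m [x0 r] /=.
  have [r0|] := pselect (0 < r); last by move=> ?; exists (x0, r).
  have r20 : 0 < 2^-1 * r by rewrite mulr_gt0.
  have [y [e [yr e0 hy]]] : exists y (e : K), [/\ `|y - x0| < 2^-1 * r, 0 < e &
      forall u, p u <= m%:R -> ~ `|y - u| <= e].
    apply: contrapT => ny; apply: nball; exists m, x0, (2^-1 * r); split=> // y e yr e0.
    apply: contrapT => nu; apply: ny; exists y, e; split=> // u pu yu.
    by apply: nu; exists u.
  have eR : e \is Num.real by rewrite gtr0_real.
  have rR : 2^-1 * r \is Num.real by rewrite gtr0_real.
  exists (y, Num.min e (2^-1 * r)) => _; split=> /=.
  - by rewrite /Num.min; case: ifP.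
  - by rewrite comparable_ge_min ?real_comparable ?lexx ?orbT.
  - exact: ltW.
  - move=> u yu pu; apply: (hy u pu); rewrite distrC (le_trans yu)//.
    by rewrite comparable_ge_min ?real_comparable ?lexx.
have [f fP] := choice step.
pose b := fix b n := if n is m.+1 then f (m, b m) else (0 : E, 1 : K).
have b0 n : 0 < (b n).2.
  by elim: n => [|n ih] /=; [exact: ltr01|case: (fP (n, b n) ih)].
have bP n : good n (b n) (b n.+1) by exact: (fP (n, b n) (b0 n)).
have bh m n : (b (m + n)%N).2 <= h n * (b m).2.
  elim: n => [|n ih]; first by rewrite addn0 expr0 mul1r.
  rewrite addnS; have [_ le1 _ _] := bP (m + n)%N.
  by rewrite (le_trans le1)// exprS -mulrA ler_wpM2l// invr_ge0.
have dist m n : `|(b (m + n)%N.+1).1 - (b (m + n)%N).1| <= 2^-1 * (b m).2 * h n.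
  have [_ _ le2 _] := bP (m + n)%N.
  by rewrite (le_trans le2)// -mulrA ler_wpM2l ?invr_ge0// mulrC.
have lim m : exists l, geo_cvg ((b m).2) (fun n => (b (m + n)%N).1) l.
  have /geo_cauchy_cvg : 0 <= 2^-1 * (b m).2 by rewrite mulr_ge0 ?invr_ge0// ltW.
  move=> /(_ E (fun n => (b (m + n)%N).1))[n|l]; first by rewrite addnS dist.
  by rewrite mulrA mulfV// mul1r => ?; exists l.
have [l hl] := lim 0%N.
have hlm m : `|l - (b m).1| <= (b m).2.
  have [l' hl'] := lim m; suff -> : l = l'.
    by have := hl' 0%N; rewrite addn0 expr0 mulr1.
  apply: (@geo_cvg_unique _ ((b 0%N).2) ((b m).2) (fun n => (b (m + n)%N).1)) => //;
    try exact: ltW.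
  move=> n; have := hl (m + n)%N => /le_trans; apply; rewrite ler_wpM2l ?(ltW (b0 _))//.
  by rewrite exprD ler_piMl// half_le1.
have [m pm] := archiK (seminorm_ge0 l).
by have [_ _ _ /(_ l (hlm m.+1))] := bP m; apply; exact: ltW.
Qed.

(** Zabreiko's lemma.  The open mapping and the closed graph theorem are instances;
    stated for seminorms, it applies to direct sums without any Banach space
    structure on the summands. *)
Theorem zabreiko : exists2 C, 0 <= C & forall x, p x <= C * `|x|.
Proof.
have [m [x0 [r [r0 ballr]]]] := zabreiko_ball.
have rn0 : r != 0 by rewrite gt_eqF.
have m2_ge0 : 0 <= 2 * m%:R :> K by rewrite mulr_ge0.
(* Differences of points of the ball show that the sublevel set of [2 m] is
   dense in a ball about the origin. *)
have centered y (e : K) : `|y| < r -> 0 < e ->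
    exists2 u, p u <= 2 * m%:R & `|y - u| <= e.
  move=> yr e0; have e20 : 0 < 2^-1 * e by rewrite mulr_gt0.
  have [u pu hu] : exists2 u, p u <= m%:R & `|x0 + y - u| <= 2^-1 * e.
    by apply: ballr => //; rewrite [x0 + y]addrC addrK.
  have [v pv hv] : exists2 v, p v <= m%:R & `|x0 - v| <= 2^-1 * e.
    by apply: ballr => //; rewrite subrr normr0.
  exists (u - v).
    rewrite (le_trans (pD _ _))// -scaleN1r pZ normrN1 mul1r.
    by rewrite mulr_natl mulr2n lerD.
  have -> : y - (u - v) = (x0 + y - u) - (x0 - v).
    by rewrite !opprB !addrA [RHS]addrC !addrA addNr add0r addrAC.
  rewrite (le_trans (ler_normB _ _))// (le_trans (lerD hu hv))//.
  by have -> : 2^-1 * e + 2^-1 * e = e by field.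
have scaled n y : exists u, `|y| <= 2^-1 * r * h n ->
    p u <= 2 * m%:R * h n /\ `|y - u| <= 2^-1 * r * h n.+1.
  have hn0 : 0 < h n by rewrite exprn_gt0.
  have hnn0 : h n != 0 by rewrite gt_eqF.
  have [yr|] := pselect (`|y| <= 2^-1 * r * h n); last by exists 0.
  have [||u pu yu] := @centered ((h n)^-1 *: y) (2^-1 * (2^-1 * r)).
  - rewrite normrZ ger0_norm ?invr_ge0// ltr_pdivrMl//.
    rewrite (le_lt_trans yr)// mulrC ltr_pM2l// gtr_pMl// invf_lt1 ?ltr1n//.
  - by rewrite mulr_gt0 ?mulr_gt0.
  exists (h n *: u) => _; split.
    by rewrite pZ ger0_norm// mulrC ler_wpM2r.
  have -> : y - h n *: u = h n *: ((h n)^-1 *: y - u).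
    by rewrite scalerBr scalerA mulfV// scale1r.
  rewrite normrZ ger0_norm//; have -> : 2^-1 * r * h n.+1 = h n * (2^-1 * (2^-1 * r)).
    by rewrite exprS; ring.
  by rewrite ler_wpM2l.
have [f fP] := choice (fun q : nat * E => scaled q.1 q.2).
have small y : `|y| <= 2^-1 * r -> p y <= c * (2 * m%:R).
  move=> yr.
  (* Successive approximation: [w n] is what is left of [y] after [n] terms. *)
  pose w := fix w n := if n is q.+1 then w q - f (q, w q) else y.
  have wr n : `|w n| <= 2^-1 * r * h n.
    elim: n => [|n ih] /=; first by rewrite expr0 mulr1.
    by have [] := fP (n, w n) ih.
  apply: (@p_series _ (fun n => f (n, w n)) y (2^-1 * r)) => //.
  - by rewrite mulr_ge0 ?invr_ge0// ltW.
  - by move=> n; have [] := fP (n, w n) (wr n).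
  - move=> n; suff -> : y - \sum_(0 <= j < n) f (j, w j) = w n by [].
    elim: n => [|n ih]; first by rewrite big_geq// subr0.
    by rewrite big_nat_recr//= opprD addrA ih.
exists (c * (2 * m%:R) * (2^-1 * r)^-1).
  by rewrite !mulr_ge0// invr_ge0 mulr_ge0 ?invr_ge0 ?ltW.
move=> x; have [->|x0'] := eqVneq x 0.
  by rewrite normr0 mulr0 -(scale0r (0 : E)) pZ normr0 mul0r.
have nx : 0 < `|x| by rewrite normr_gt0.
have r20 : 0 < 2^-1 * r by rewrite mulr_gt0.
have a0 : 0 < 2^-1 * r / `|x| by rewrite divr_gt0.
have := small ((2^-1 * r / `|x|) *: x).
rewrite normrZ pZ gtr0_norm// divfK ?gt_eqF// => /(_ (lexx _)).
rewrite -ler_pdivlMl// => /le_trans; apply.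
have -> : (2^-1 * r / `|x|)^-1 * (c * (2 * m%:R)) = c * (2 * m%:R) * (2^-1 * r)^-1 * `|x|.
  by rewrite invf_div; ring.
exact: lexx.
Qed.
End Zabreiko.
End GeometricLimits.

(** * Linear and bounded maps *)

Section LinearMaps.
Context {K : numFieldType} {E F : lmodType K}.
Variable f : E -> F.
Hypothesis lin_f : linear f.

Lemma linfD x y : f (x + y) = f x + f y.
Proof. by have := lin_f 1 x y; rewrite !scale1r. Qed.
Lemma linf0 : f 0 = 0.
Proof. by apply: (addrI (f 0)); rewrite -linfD !addr0. Qed.
Lemma linfZ a x : f (a *: x) = a *: f x.
Proof. by have := lin_f a x 0; rewrite linf0 !addr0. Qed.
Lemma linfN x : f (- x) = - f x.
Proof. by rewrite -scaleN1r linfZ scaleN1r. Qed.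
Lemma linfB x y : f (x - y) = f x - f y.
Proof. by rewrite linfD linfN. Qed.
Lemma linf_sum (I : Type) (r : seq I) (P : pred I) (v : I -> E) :
  f (\sum_(i <- r | P i) v i) = \sum_(i <- r | P i) f (v i).
Proof. exact: (big_morph _ linfD linf0). Qed.
End LinearMaps.

Section LinearCombine.
Context {K : numFieldType} {E F G : lmodType K}.

Lemma linear_id : linear (@id E). Proof. by []. Qed.
Lemma linear_cst0 : linear (fun _ : E => 0 : F).
Proof. by move=> a x y; rewrite scaler0 addr0. Qed.
Lemma linear_compf (f : F -> G) (g : E -> F) : linear f -> linear g ->
  linear (fun x => f (g x)).
Proof. by move=> lf lg a x y; rewrite lg lf. Qed.
Lemma linear_add (f g : E -> F) : linear f -> linear g ->
  linear (fun x => f x + g x).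
Proof. by move=> lf lg a x y; rewrite lf lg scalerDr addrACA. Qed.
Lemma linear_opp (f : E -> F) : linear f -> linear (fun x => - f x).
Proof. by move=> lf a x y; rewrite lf opprD scalerN. Qed.
Lemma linear_scale (c : K) (f : E -> F) : linear f -> linear (fun x => c *: f x).
Proof. by move=> lf a x y; rewrite lf scalerDr !scalerA mulrC. Qed.
Lemma linear_sumf (I : eqType) (r : seq I) (f : I -> E -> F) :
  (forall i, i \in r -> linear (f i)) -> linear (fun x => \sum_(i <- r) f i x).
Proof.
elim: r => [|i r ih] lf a x y; first by rewrite !big_nil scaler0 addr0.
rewrite !big_cons ih => [|j jr]; last by apply: lf; rewrite inE jr orbT.
by rewrite lf ?inE ?eqxx// scalerDr addrACA.
Qed.
Lemma eq_linear (f g : E -> F) : linear f -> f =1 g -> linear g.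
Proof. by move=> lf fg a x y; rewrite -!fg lf. Qed.
End LinearCombine.

Section BoundedMaps.
Context {K : numFieldType}.

Lemma bounded_linearP {E F : normedModType K} (f : E -> F) : bounded_linear f ->
  exists2 C, 0 <= C & forall x, `|f x| <= C * `|x|.
Proof.
move=> [_ [C fC]]; exists `|C| => // x; have := fC x.
have [->|x0] := eqVneq `|x| 0; first by rewrite !mulr0.
have nx : 0 < `|x| by rewrite lt_def x0 normr_ge0.
move=> fx; suff C0 : 0 <= C by rewrite ger0_norm.
by rewrite -(pmulr_lge0 _ nx) (le_trans _ fx).
Qed.

Lemma bounded_linear_lin {E F : normedModType K} (f : E -> F) :
  bounded_linear f -> linear f.
Proof. by case. Qed.

Lemma bounded_linear_ext {E F : normedModType K} (f g : E -> F) : bounded_linear f ->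
  f =1 g -> bounded_linear g.
Proof.
by move=> [lf [C fC]] fg; split; [exact: eq_linear lf fg|exists C => x; rewrite -fg].
Qed.

Lemma bounded_linear_id {E : normedModType K} : bounded_linear (@id E).
Proof. by split; [exact: linear_id|exists 1 => x; rewrite mul1r]. Qed.

Lemma bounded_linear0 {E F : normedModType K} : bounded_linear (fun _ : E => 0 : F).
Proof. by split; [exact: linear_cst0|exists 0 => x; rewrite normr0 mul0r]. Qed.

Lemma bounded_linear_comp {E F G : normedModType K} (f : F -> G) (g : E -> F) :
  bounded_linear f -> bounded_linear g -> bounded_linear (fun x => f (g x)).
Proof.
move=> bf bg; split.
  by apply: linear_compf; exact: bounded_linear_lin.
have [C C0 fC] := bounded_linearP bf; have [C' C'0 gC] := bounded_linearP bg.
by exists (C * C') => x; rewrite (le_trans (fC _))// -mulrA ler_wpM2l.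
Qed.

Lemma bounded_linear_add {E F : normedModType K} (f g : E -> F) :
  bounded_linear f -> bounded_linear g -> bounded_linear (fun x => f x + g x).
Proof.
move=> [lf [C fC]] [lg [C' gC]]; split; first exact: linear_add.
by exists (C + C') => x; rewrite (le_trans (ler_normD _ _))// mulrDl lerD.
Qed.

Lemma bounded_linear_scale {E F : normedModType K} (c : K) (f : E -> F) :
  bounded_linear f -> bounded_linear (fun x => c *: f x).
Proof.
move=> [lf [C fC]]; split; first exact: linear_scale.
by exists (`|c| * C) => x; rewrite normrZ -mulrA ler_wpM2l.
Qed.

Lemma bounded_linear_opp {E F : normedModType K} (f : E -> F) :
  bounded_linear f -> bounded_linear (fun x => - f x).
Proof.
move=> /(bounded_linear_scale (-1))/bounded_linear_ext; apply=> x.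
exact: scaleN1r.
Qed.

Lemma bounded_linear_sum {E F : normedModType K} (I : eqType) (r : seq I)
    (f : I -> E -> F) : (forall i, i \in r -> bounded_linear (f i)) ->
  bounded_linear (fun x => \sum_(i <- r) f i x).
Proof.
elim: r => [|i r ih] bf.
  by apply: (bounded_linear_ext bounded_linear0) => x; rewrite big_nil.
apply: (@bounded_linear_ext _ _ (fun x => f i x + \sum_(j <- r) f j x)).
  apply: bounded_linear_add; first by apply: bf; rewrite inE eqxx.
  by apply: ih => j jr; apply: bf; rewrite inE jr orbT.
by move=> x; rewrite big_cons.
Qed.

Lemma bounded_linear_common {E F : normedModType K} (I : eqType) (r : seq I)
    (f : I -> E -> F) : (forall i, i \in r -> bounded_linear (f i)) ->
  exists2 C, 0 <= C & forall i x, i \in r -> `|f i x| <= C * `|x|.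
Proof.
elim: r => [|i r ih] bf; first by exists 0.
have [|C C0 fC] := ih; first by move=> j jr; apply: bf; rewrite inE jr orbT.
have [C' C'0 fC'] := bounded_linearP (bf i (mem_head _ _)).
exists (C' + C); first exact: addr_ge0.
move=> j x; rewrite inE mulrDl => /orP[/eqP->|jr].
  by rewrite (le_trans (fC' x))// lerDl mulr_ge0.
by rewrite (le_trans (fC _ _ jr))// lerDr mulr_ge0.
Qed.

End BoundedMaps.

Lemma sum_le_const {K : numDomainType} n (F : nat -> K) c :
  (forall i, (i < n)%N -> F i <= c) -> \sum_(0 <= i < n) F i <= n%:R * c.
Proof.
move=> Fc; rewrite mulr_natl -[X in _ *+ X]subn0 -sumr_const_nat.
by apply: ler_sum_nat => i /andP[_ /Fc].
Qed.

Section OpenMapping.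
Context {K : numFieldType}.
Hypothesis archiK : archimedean K.

(** Zabreiko's lemma for the sum of the [|Q i x|]: the components of a geometrically
    convergent series converge inside the closed summands, and uniqueness of the
    decomposition identifies their limits. *)
Lemma closed_dsum_bounded {E : completeNormedModType K} n (Q : nat -> E -> E)
    (V : nat -> set E) :
  (forall i, linear (Q i)) ->
  (forall i, (i < n)%N -> closed (V i)) ->
  (forall i x, (i < n)%N -> V i (Q i x)) ->
  (forall x, \sum_(0 <= i < n) Q i x = x) ->
  (forall v x, (forall i, (i < n)%N -> V i (v i)) ->
     \sum_(0 <= i < n) v i = x -> forall i, (i < n)%N -> v i = Q i x) ->
  forall i, (i < n)%N -> bounded_linear (Q i).
Proof.
move=> linQ Vcl VQ sumQ uniqQ.
pose p x := \sum_(0 <= i < n) `|Q i x|.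
have Qp i x : (i < n)%N -> `|Q i x| <= p x.
  move=> lt_in; rewrite /p (big_rem i) ?mem_index_iota//=.
  by rewrite lerDl sumr_ge0.
have pC : exists2 C, 0 <= C & forall x, p x <= C * `|x|.
  apply: (zabreiko archiK _ _ (c := n%:R * 2)).
  - move=> x y; rewrite /p -big_split; apply: ler_sum => i _ /=.
    by rewrite linfD// ler_normD.
  - by move=> a x; rewrite /p mulr_sumr; apply: eq_bigr => i _; rewrite linfZ// normrZ.
  - by rewrite mulr_ge0.
  - move=> C x l C' C0 C'0 pC xl.
    have cv i : exists v, (i < n)%N -> geo_cvg (2 * C)
        (fun m => \sum_(0 <= j < m) Q i (x j)) v.
      have [lt_in|] := boolP (i < n)%N; last by exists 0.
      have [m|v hv] := @geo_cauchy_cvg _ archiK _ _ (fun m => \sum_(0 <= j < m) Q i (x j)) C0;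
        last by exists v.
      by rewrite big_nat_recr//= addrAC subrr add0r (le_trans (Qp _ _ lt_in)).
    have {cv}[v hv] := choice cv.
    have C20 : 0 <= 2 * C by rewrite mulr_ge0.
    have Vv i : (i < n)%N -> V i (v i).
      move=> lt_in; apply: (geo_cvg_closed archiK C20 (Vcl _ lt_in) _ (hv _ lt_in)) => m.
      by rewrite -linf_sum//; exact: VQ.
    have sv : \sum_(0 <= i < n) v i = l.
      apply: (@geo_cvg_unique _ archiK _ (n%:R * (2 * C)) C' (fun m => \sum_(0 <= j < m) x j)) => //.
        by rewrite mulr_ge0.
      move=> m; rewrite -[X in _ - X]sumQ; under [X in _ - X]eq_bigr do rewrite linf_sum//.
      rewrite -sumrB (le_trans (ler_norm_sum _ _ _))//.
      by rewrite -mulrA; apply: sum_le_const => i lt_in; exact: hv.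
    rewrite /p -mulrA; apply: sum_le_const => i lt_in.
    rewrite -(uniqQ v l Vv sv i lt_in); have := hv i lt_in 0%N.
    by rewrite big_geq// subr0 expr0 mulr1.
move=> i lt_in; split; first exact: linQ.
by have [C _ hC] := pC; exists C => x; rewrite (le_trans (Qp _ _ lt_in)).
Qed.

(** The closed graph argument for the inverse of [S] on a closed summand [V],
    extended to the whole space by the projection [q]. *)
Lemma closed_inverse_bounded {E F : completeNormedModType K} (V : set E)
    (S : E -> F) (q : F -> F) (T : F -> E) :
  bounded_linear S -> bounded_linear q -> linear T -> closed V ->
  (forall y, V (T y)) -> (forall y, S (T y) = q y) ->
  (forall v y, V v -> S v = q y -> v = T y) -> bounded_linear T.
Proof.
move=> bS bq linT Vcl VT ST uniqT; split=> //.
have [linS linq] := (bounded_linear_lin bS, bounded_linear_lin bq).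
have [CS CS0 hS] := bounded_linearP bS; have [Cq Cq0 hq] := bounded_linearP bq.
suff [C _ hC] : exists2 C, 0 <= C & forall y, `|T y| <= C * `|y| by exists C.
apply: (zabreiko archiK (p := fun y => `|T y|) _ _ (c := 2)) => //.
- by move=> x y; rewrite linfD// ler_normD.
- by move=> a x; rewrite linfZ// normrZ.
- move=> C x l C' C0 C'0 TC xl.
  have [m|v hv] := @geo_cauchy_cvg _ archiK _ _ (fun m => \sum_(0 <= j < m) T (x j)) C0.
    by rewrite big_nat_recr//= addrAC subrr add0r.
  have C20 : 0 <= 2 * C by rewrite mulr_ge0.
  have Vv : V v.
    by apply: (geo_cvg_closed archiK C20 Vcl _ hv) => m; rewrite -linf_sum.
  suff -> : T l = v by have := hv 0%N; rewrite big_geq// subr0 expr0 mulr1.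
  apply/esym/uniqT => //.
  apply: (@geo_cvg_unique _ archiK _ (CS * (2 * C)) (Cq * C')
    (fun m => \sum_(0 <= j < m) q (x j))); rewrite ?mulr_ge0//.
  + move=> m; under eq_bigr do rewrite -ST.
    rewrite -linf_sum// -linfB// (le_trans (hS _))// -mulrA ler_wpM2l//.
  + by move=> m; rewrite -linf_sum// -linfB// (le_trans (hq _))// -mulrA ler_wpM2l.
Qed.

End OpenMapping.

(** * Projections of an iterated direct sum *)

Section Subspaces.
Context {K : numFieldType} {E : lmodType K}.
Implicit Types V W X : set E.

Lemma subspaceD V x y : subspace V -> V x -> V y -> V (x + y).
Proof. by move=> [_ VD] Vx Vy; have := VD 1 x y Vx Vy; rewrite scale1r. Qed.
Lemma subspaceZ V a x : subspace V -> V x -> V (a *: x).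
Proof. by move=> [V0 VD] Vx; have := VD a x 0 Vx V0; rewrite addr0. Qed.
Lemma subspaceB V x y : subspace V -> V x -> V y -> V (x - y).
Proof.
by move=> sV Vx Vy; apply: subspaceD => //; rewrite -scaleN1r; exact: subspaceZ.
Qed.
Lemma subspace_setT : subspace [set: E]. Proof. by split. Qed.
Lemma subspace0 : subspace [set (0 : E)].
Proof. by split=> // a x y /= -> ->; rewrite scaler0 addr0. Qed.
Lemma subspace_image (F : lmodType K) (f : F -> E) (A : set F) :
  linear f -> subspace A -> subspace (f @` A).
Proof.
move=> lf [A0 AD]; split; first by exists 0 => //; exact: linf0.
by move=> a _ _ [x Ax <-] [y Ay <-]; exists (a *: x + y); [exact: AD|exact: lf].
Qed.
Lemma subspace_kernel (F : lmodType K) (f : E -> F) (A : set E) :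
  linear f -> subspace A -> subspace [set x | A x /\ f x = 0].
Proof.
move=> lf [A0 AD]; split; first by split=> //; exact: linf0.
move=> a x y [Ax fx] [Ay fy]; split; first exact: AD.
by rewrite lf fx fy scaler0 addr0.
Qed.

Lemma big_sumsetP (r : seq nat) (P : pred nat) (V : nat -> set E) x : uniq r ->
  (\big[sumset/[set 0]]_(j <- r | P j) V j) x <->
  exists v, (forall j, j \in r -> P j -> V j (v j)) /\
    x = \sum_(j <- r | P j) v j.
Proof.
elim: r x => [|i r ih] x /=.
  move=> _; rewrite big_nil; split=> [/= ->|[v [_]]]; last by rewrite big_nil.
  by exists (fun=> 0); rewrite big_nil.
move=> /andP[ir /ih{}ih]; rewrite big_cons; case: ifP => Pi; last first.
  split=> [/ih[v [Vv xv]]|[v [Vv xv]]].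
    exists v; split; last by rewrite big_cons Pi.
    by move=> j; rewrite inE => /orP[/eqP->|]; [rewrite Pi|exact: Vv].
  apply/ih; exists v; split; last by move: xv; rewrite big_cons Pi.
  by move=> j jr; apply: Vv; rewrite inE jr orbT.
split=> [[y Vy [z /ih[v [Vv zv]] <-]]|[v [Vv xv]]].
  exists (fun j => if j == i then y else v j); split.
    move=> j; rewrite inE => /orP[/eqP->|jr]; first by rewrite eqxx.
    by case: eqVneq => [ji|_]; [rewrite -ji jr in ir|exact: Vv].
  rewrite big_cons Pi eqxx zv; congr (_ + _).
  rewrite big_seq_cond [RHS]big_seq_cond; apply: eq_bigr => j /andP[jr _].
  by case: eqVneq => // ji; rewrite -ji jr in ir.
exists (v i); first by apply: Vv; rewrite ?mem_head.
exists (\sum_(j <- r | P j) v j); last by rewrite xv big_cons Pi.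
by apply/ih; exists v; split=> // j jr; apply: Vv; rewrite inE jr orbT.
Qed.

Lemma sum_spacesP (V : nat -> set E) m n x :
  (sum_spaces V m n) x <-> exists v, (forall j, (m <= j < n)%N -> V j (v j)) /\
    x = \sum_(m <= j < n) v j.
Proof.
rewrite /sum_spaces; split=> [/big_sumsetP-/(_ (iota_uniq _ _))|] [v [Vv xv]].
  by exists v; split=> // j jmn; apply: Vv; rewrite ?mem_index_iota.
apply/big_sumsetP; first exact: iota_uniq.
by exists v; split=> // j; rewrite mem_index_iota => jmn _; exact: Vv.
Qed.

Lemma subspace_sum_spaces (V : nat -> set E) m n :
  (forall j, (m <= j < n)%N -> subspace (V j)) -> subspace (sum_spaces V m n).
Proof.
move=> sV; split.
  apply/sum_spacesP; exists (fun=> 0); split; last by rewrite big1.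
  by move=> j /sV[].
move=> a x y /sum_spacesP[v [Vv ->]] /sum_spacesP[w [Vw ->]].
apply/sum_spacesP; exists (fun j => a *: v j + w j); split.
  by move=> j jmn; case: (sV _ jmn) => _; apply; [exact: Vv|exact: Vw].
by rewrite scaler_sumr -big_split.
Qed.

End Subspaces.

Section Chain.
Context {K : numFieldType} {E : normedModType K}.
Variables W V : nat -> set E.

(** [W] decreases from the whole space and each step splits off a summand
    [V n.+1]; both direct sums of the recursion arise in this way. *)
Record chain : Prop := {
  chain0 : W 0%N = setT;
  chain_split : forall n x, W n x ->
    exists v w, [/\ V n.+1 v, W n.+1 w & x = v + w];
  chain_subV : forall n, V n.+1 `<=` W n;
  chain_subW : forall n, W n.+1 `<=` W n;
  chain_direct : forall n x, V n.+1 x -> W n.+1 x -> x = 0 }.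

Definition chain_cut n x : E * E :=
  get [set vw : E * E | [/\ V n.+1 vw.1, W n.+1 vw.2 & x = vw.1 + vw.2]].

Fixpoint chain_rest n x : E :=
  if n is m.+1 then (chain_cut m (chain_rest m x)).2 else x.

Definition chain_part n x : E :=
  if n is m.+1 then (chain_cut m (chain_rest m x)).1 else 0.

Hypothesis chW : chain.

Lemma chain_cutP n x : W n x -> [/\ V n.+1 (chain_cut n x).1,
  W n.+1 (chain_cut n x).2 & x = (chain_cut n x).1 + (chain_cut n x).2].
Proof.
move=> /(chain_split chW)[v [w vw]].
by have := @getI _ [set vw : E * E | [/\ V n.+1 vw.1, W n.+1 vw.2 & x = vw.1 + vw.2]] (v, w) vw.
Qed.

Lemma chain_rest_in n x : W n (chain_rest n x).
Proof.
elim: n => [|n ih] /=; first by rewrite chain0.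
by have [] := chain_cutP ih.
Qed.

Lemma chain_part_in n x : (0 < n)%N -> V n (chain_part n x).
Proof. by case: n => //= n _; have [] := chain_cutP (chain_rest_in n x). Qed.

Lemma chain_partD n x : chain_rest n x = chain_part n.+1 x + chain_rest n.+1 x.
Proof. by have [_ _] := chain_cutP (chain_rest_in n x). Qed.

Lemma chain_sum n x :
  \sum_(1 <= i < n.+1) chain_part i x + chain_rest n x = x.
Proof.
elim: n => [|n ih]; first by rewrite big_geq// add0r.
by rewrite big_nat_recr//= -addrA -chain_partD.
Qed.

(** Only the first [n] summands are assumed to be subspaces: in the recursion, that
    the next one is a subspace depends on operators built from these. *)
Section Upto.
Variable n : nat.
Hypothesis subV : forall i, (1 <= i <= n)%N -> subspace (V i).
Hypothesis subW : forall i, (i <= n)%N -> subspace (W i).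

Lemma chain_unique (v : nat -> E) w x :
  (forall i, (1 <= i <= n)%N -> V i (v i)) -> W n w ->
  \sum_(1 <= i < n.+1) v i + w = x ->
  (forall i, (1 <= i <= n)%N -> v i = chain_part i x) /\ w = chain_rest n x.
Proof.
elim: n subV subW w => [|m ih] sV sW w Vv Ww.
  by rewrite big_geq// add0r => ->; split=> // i; case: i.
rewrite big_nat_recr//= -addrA => eqx.
have Vm : V m.+1 (v m.+1) by apply: Vv; rewrite ltnS leqnn.
have [||||part rest] := ih _ _ (v m.+1 + w) _ _ eqx.
- by move=> i /andP[i1 im]; apply: sV; rewrite i1 ltnW.
- by move=> i im; apply: sW; rewrite ltnW.
- by move=> i /andP[i1 im]; apply: Vv; rewrite i1 ltnW.
- apply: subspaceD; [exact/sW|exact: (chain_subV chW)|exact: (chain_subW chW)].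
have {}rest := etrans rest (chain_partD m x).
have eqd : v m.+1 - chain_part m.+1 x = chain_rest m.+1 x - w.
  by apply/eqP; rewrite subr_eq addrAC eq_sym subr_eq rest addrC.
have d0 : v m.+1 - chain_part m.+1 x = 0.
  apply: (chain_direct chW).
    apply: subspaceB Vm _; last exact: chain_part_in.
    by apply: sV; rewrite ltnS leqnn.
  by rewrite eqd; apply: subspaceB (sW _ (leqnn _)) _ Ww; exact: chain_rest_in.
split; last by apply/eqP; rewrite eq_sym -subr_eq0 -eqd d0.
move=> i /andP[i1]; rewrite leq_eqVlt => /orP[/eqP->|im].
  by apply/eqP; rewrite -subr_eq0 d0.
by apply: part; rewrite i1.
Qed.

Lemma chain_linear : (forall i, (1 <= i <= n)%N -> linear (chain_part i)) /\
  linear (chain_rest n).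
Proof.
suff lin a x y : (forall i, (1 <= i <= n)%N ->
    a *: chain_part i x + chain_part i y = chain_part i (a *: x + y)) /\
    a *: chain_rest n x + chain_rest n y = chain_rest n (a *: x + y).
  by split=> [i i1n|] a x y; have [hp hr] := lin a x y; rewrite ?hp ?hr.
apply: (@chain_unique (fun i => a *: chain_part i x + chain_part i y)).
- move=> i i1n; have /andP[i1 _] := i1n.
  by case: (subV i1n) => _; apply; exact: chain_part_in.
- by case: (subW (leqnn n)) => _; apply; exact: chain_rest_in.
- by rewrite big_split -scaler_sumr /= addrACA -scalerDr !chain_sum.
Qed.

Lemma proj_along_eq (A C : set E) x v : subspace A -> subspace C ->
  (forall y, A y -> C y -> y = 0) -> A v -> C (x - v) -> proj_along A C x = v.
Proof.
move=> sA sC AC Av Cv; rewrite /proj_along.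
have [Ag Cg] : [set v | A v /\ C (x - v)] (get [set v | A v /\ C (x - v)]).
  by apply: getI; exact: (conj Av Cv).
apply/eqP; rewrite -subr_eq0; apply/eqP/AC; first exact: subspaceB.
have -> : get [set v | A v /\ C (x - v)] - v =
  (x - v) - (x - get [set v | A v /\ C (x - v)]).
  by rewrite opprB [RHS]addrC addrA subrK.
exact: subspaceB.
Qed.

(** The projections of the [n]-fold direct sum do not depend on [n]: they are the
    parts cut off one after another. *)
Lemma dsum_proj_chain i x : (1 <= i <= n)%N ->
  dsum_proj V W n i x = chain_part i x.
Proof.
move=> i1n; have /andP[i1 lein] := i1n.
have ir : i \in index_iota 1 n.+1 by rewrite mem_index_iota.
have sumD1 (v : nat -> E) : \sum_(1 <= j < n.+1) v j =
    v i + \sum_(1 <= j < n.+1 | j != i) v j by rewrite (bigD1_seq i)//= iota_uniq.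
have memC y : (sumset (\big[sumset/[set 0]]_(1 <= j < n.+1 | j != i) V j) (W n)) y <->
    exists v w, [/\ forall j, (1 <= j <= n)%N -> j != i -> V j (v j), W n w &
      y = \sum_(1 <= j < n.+1 | j != i) v j + w].
  split=> [[z /big_sumsetP-/(_ (iota_uniq _ _))[v [Vv ->]] [w Ww <-]]|[v [w [Vv Ww ->]]]].
    by exists v, w; split=> // j j1n; apply: Vv; rewrite mem_index_iota.
  exists (\sum_(1 <= j < n.+1 | j != i) v j); last by exists w.
  apply/big_sumsetP; first exact: iota_uniq.
  by exists v; split=> // j; rewrite mem_index_iota ltnS; exact: Vv.
have sC : subspace (sumset (\big[sumset/[set 0]]_(1 <= j < n.+1 | j != i) V j) (W n)).
  split.
    apply/memC; exists (fun=> 0), 0; split; [by move=> j /subV[]|by case: (subW (leqnn n))|].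
    by rewrite big1// addr0.
  move=> a y z /memC[v [w [Vv Ww ->]]] /memC[v' [w' [Vv' Ww' ->]]]; apply/memC.
  exists (fun j => a *: v j + v' j), (a *: w + w'); split.
  - by move=> j j1n ji; case: (subV j1n) => _; apply; [exact: Vv|exact: Vv'].
  - by case: (subW (leqnn n)) => _; exact.
  - by rewrite big_split -scaler_sumr /= addrACA -scalerDr.
apply: proj_along_eq => //.
- exact: subV.
- move=> y Vy /memC[v [w [Vv Ww yE]]].
  have [part _] : (forall j, (1 <= j <= n)%N ->
      (if j == i then - y else v j) = chain_part j 0) /\ w = chain_rest n 0.
    apply: chain_unique => //.
      move=> j j1n; case: eqVneq => [->|]; last exact: Vv.
      by rewrite -sub0r; apply: subspaceB => //; [exact: subV|case: (subV i1n)].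
    rewrite sumD1 eqxx; under eq_bigr => j /negbTE -> do [].
    by rewrite -addrA -yE addNr.
  have := part i i1n; rewrite eqxx.
  have [/(_ i i1n) lp _] := chain_linear.
  by rewrite linf0// => /eqP; rewrite oppr_eq0 => /eqP.
- exact: chain_part_in.
- apply/memC; exists (fun j => chain_part j x), (chain_rest n x); split.
  + by move=> j /andP[j1 _] _; exact: chain_part_in.
  + exact: chain_rest_in.
  + have := chain_sum n x; rewrite sumD1 => xE.
    by apply/eqP; rewrite subr_eq -[X in X == _]xE -addrA addrC.
Qed.

Lemma proj_along_chain x :
  proj_along (W n) (sum_spaces V 1 n.+1) x = chain_rest n x.
Proof.
apply: proj_along_eq => //.
- exact: subW.
- by apply: subspace_sum_spaces => j /andP[j1 jn]; apply: subV; rewrite j1.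
- move=> y Wy /sum_spacesP[v [Vv yE]].
  have [_ rest] : (forall j, (1 <= j <= n)%N -> v j = chain_part j 0) /\
      - y = chain_rest n 0.
    apply: chain_unique; last by rewrite -yE subrr.
      by move=> j /andP[j1 jn]; apply: Vv; rewrite j1.
    by rewrite -sub0r; apply: subspaceB => //; case: (subW (leqnn n)).
  have [_ lr] := chain_linear.
  by apply/eqP; rewrite -oppr_eq0 rest linf0.
- exact: chain_rest_in.
- apply/sum_spacesP; exists (fun j => chain_part j x); split.
    by move=> j /andP[j1 _]; exact: chain_part_in.
  by apply/eqP; rewrite subr_eq chain_sum.
Qed.

End Upto.
End Chain.

(** * Algebra of the recursion *)

Section RecursionAlgebra.
Context {K : numFieldType} {B Bbar : completeNormedModType K}.
Variables (L : nat -> B -> Bbar) (N Nc : nat -> set B) (Rg Rgc : nat -> set Bbar).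
Variables (Sbar S : nat -> B -> Bbar) (M E : nat -> nat -> B -> B).
Hypothesis hrec : recursion L N Nc Rg Rgc Sbar S M E.
Hypothesis linL : forall i, linear (L i).

Local Notation q := (chain_part Rgc Rg).
Local Notation c := (chain_rest Rgc Rg).

Lemma complement_sub (F : lmodType K) (X V W : set F) : is_complement X V W ->
  [/\ forall x, V x -> X x, forall x, W x -> X x,
      forall x, X x -> exists v w, [/\ V v, W w & x = v + w],
      forall x, V x -> W x -> x = 0 & subspace W].
Proof.
move=> [sW VW dVW].
have V0 : V 0 by have : [set 0] (0 : F) by []; rewrite -dVW => -[].
split=> //.
- by move=> x Vx; rewrite -VW; exists x => //; exists 0; rewrite ?addr0//; case: sW.
- by move=> x Wx; rewrite -VW; exists 0 => //; exists x; rewrite ?add0r.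
- by move=> x; rewrite -VW => -[v Vv [w Ww <-]]; exists v, w.
- by move=> x Vx Wx; have : (V `&` W) x by []; rewrite dVW.
Qed.

Lemma chain_ranges : chain Rgc Rg.
Proof.
split; first exact: (rec_Rc0 hrec).
- by move=> n x; have [_ _ h _ _] := complement_sub (rec_Rc hrec n); exact: h.
- by move=> n x; have [h _ _ _ _] := complement_sub (rec_Rc hrec n); exact: h.
- by move=> n x; have [_ h _ _ _] := complement_sub (rec_Rc hrec n); exact: h.
- by move=> n x; have [_ _ _ h _] := complement_sub (rec_Rc hrec n); exact: h.
Qed.

Lemma chain_kernels : chain N Nc.
Proof.
split; first exact: (rec_N0 hrec).
- move=> n x; have [_ _ h _ _] := complement_sub (rec_Nc hrec n).
  by move=> /h[v [w [Nv Nw ->]]]; exists w, v; rewrite addrC.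
- by move=> n x; have [_ h _ _ _] := complement_sub (rec_Nc hrec n); exact: h.
- by move=> n x; have [h _ _ _ _] := complement_sub (rec_Nc hrec n); exact: h.
- by move=> n x Ncx Nx; have [_ _ _ h _] := complement_sub (rec_Nc hrec n); exact: h.
Qed.

Lemma subspace_Rgc n : subspace (Rgc n).
Proof.
case: n => [|n]; first by rewrite (rec_Rc0 hrec); exact: subspace_setT.
by have [] := complement_sub (rec_Rc hrec n).
Qed.

Lemma subspace_Nc n : subspace (Nc n).
Proof.
case: n => [|n]; first by rewrite (rec_Nc0 hrec); exact: subspace0.
by have [] := complement_sub (rec_Nc hrec n).
Qed.

Lemma kernels_anti m n : (m <= n)%N -> N n `<=` N m.
Proof.
move=> /subnK <-; elim: (n - m)%N => [|p ih] x //; rewrite addSn => Nx.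
exact/ih/(chain_subW chain_kernels).
Qed.

Lemma S_kernel l m x : (1 <= l <= m)%N -> N m x -> S l x = 0.
Proof.
by case: l => // l /andP[_ lm] /(kernels_anti lm); rewrite (rec_N hrec) => -[].
Qed.

Lemma S_in_range n x : N n x -> Rg n.+1 (S n.+1 x).
Proof. by move=> Nx; rewrite (rec_R hrec); exists x. Qed.

(** The operator [S_i^{-1} calP_i], for direct sums of any length. *)
Definition Tinv i y := Sinv Nc S i (q i y).

Section LinearS.
Variable i : nat.
Hypothesis i_gt0 : (0 < i)%N.
Hypothesis linS : linear (S i).

Lemma S_Nc_inj x y : Nc i x -> Nc i y -> S i x = S i y -> x = y.
Proof.
move=> Nx Ny Sxy; apply/eqP; rewrite -subr_eq0; apply/eqP.
have Nxy : Nc i (x - y) by apply: subspaceB => //; exact: subspace_Nc.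
case: i i_gt0 linS Nx Ny Sxy Nxy => // j _ lS Nx Ny Sxy Nxy.
apply: (chain_direct chain_kernels) Nxy _; rewrite (rec_N hrec); split.
  by apply: (chain_subV chain_kernels); apply: subspaceB => //; exact: subspace_Nc.
by rewrite linfB// Sxy subrr.
Qed.

Lemma S_Nc_surj y : Rg i y -> exists2 x, Nc i x & S i x = y.
Proof.
case: i i_gt0 linS => // j _ lS; rewrite (rec_R hrec) => -[x Nx <-].
have [v [w [Nv Nw ->]]] := chain_split chain_kernels Nx; exists v => //.
rewrite linfD//; move: Nw; rewrite (rec_N hrec) => -[_ ->].
by rewrite addr0.
Qed.

Lemma SinvP y : Rg i y -> Nc i (Sinv Nc S i y) /\ S i (Sinv Nc S i y) = y.
Proof.
have surj : set_surj (Nc i) (Rg i) (S i).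
  by move=> z /S_Nc_surj[x Nx <-]; exists x.
move=> Ry; split; last by rewrite (surjpK _ surj)// inE.
by apply: (surjpinv_image_sub surj); exists y.
Qed.

Lemma TinvP y : Nc i (Tinv i y) /\ S i (Tinv i y) = q i y.
Proof. by apply: SinvP; apply: chain_part_in => //; exact: chain_ranges. Qed.

Lemma Tinv_unique v y : Nc i v -> S i v = q i y -> v = Tinv i y.
Proof.
by move=> Nv Sv; have [NT ST] := TinvP y; apply: S_Nc_inj; rewrite ?ST.
Qed.

Lemma linear_Tinv : linear (q i) -> linear (Tinv i).
Proof.
move=> lq a x y; apply/esym/Tinv_unique.
  by case: (subspace_Nc i) => _; apply; [case: (TinvP x)|case: (TinvP y)].
by rewrite linS lq; have [[_ ->] [_ ->]] := (TinvP x, TinvP y).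
Qed.
End LinearS.

Lemma S_rest_upto n x : (forall i, (1 <= i <= n)%N -> subspace (Rg i)) ->
  S n.+1 x = c n (Sbar n.+1 x).
Proof.
case: n => [|n] sR; first by rewrite (rec_S1 hrec) (rec_Sbar1 hrec).
rewrite (rec_S hrec)// (proj_along_chain chain_ranges)// => i _.
exact: subspace_Rgc.
Qed.

(** One simultaneous induction, since each projection is linear because the ranges
    before it are subspaces, and each range is a subspace because [S] is linear. *)
Lemma recursion_linear n :
  [/\ forall i, (i <= n)%N -> subspace (N i),
      forall i, (1 <= i <= n)%N -> [/\ linear (Sbar i), linear (S i) & subspace (Rg i)],
      forall i j, (1 <= j <= n)%N -> (1 <= i)%N -> linear (M i j)
    & forall i j, (2 <= j <= n)%N -> (1 <= i <= j)%N -> linear (E i j)].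
Proof.
elim: n => [|n [sN lS lM lE]].
  split.
  - by move=> i; rewrite leqn0 => /eqP->; rewrite (rec_N0 hrec); exact: subspace_setT.
  - by move=> i /andP[i1]; rewrite leqNgt i1.
  - by move=> i j /andP[j1]; rewrite leqNgt j1.
  - by move=> i j /andP[j2 j0]; have := leq_trans j2 j0.
have sR i : (1 <= i <= n)%N -> subspace (Rg i) by move=> /lS[].
have chlin m : (m <= n)%N -> (forall i, (1 <= i <= m)%N -> linear (q i)) /\ linear (c m).
  move=> mn; apply: chain_linear; first exact: chain_ranges.
    by move=> i /andP[i1 im]; apply: sR; rewrite i1 (leq_trans im).
  by move=> i _; exact: subspace_Rgc.
have lSbar : linear (Sbar n.+1).
  case: (posnP n) => [->|n0].
    by apply: (eq_linear (linL 0%N)) => x; rewrite (rec_Sbar1 hrec).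
  apply: (@eq_linear _ _ _ (fun x => \sum_(1 <= i < n.+1) L i (M i n x))); last first.
    by move=> x; rewrite (rec_Sbar hrec).
  apply: linear_sumf => i; rewrite mem_index_iota => /andP[i1 _].
  by apply: linear_compf => //; apply: lM; rewrite ?n0 ?leqnn.
have lSn : linear (S n.+1).
  apply: (@eq_linear _ _ _ (fun x => c n (Sbar n.+1 x))); last first.
    by move=> x; rewrite S_rest_upto.
  by apply: linear_compf => //; case: (chlin n (leqnn n)).
have sNn : subspace (N n.+1).
  by rewrite (rec_N hrec); apply: subspace_kernel => //; exact: sN.
have sRn : subspace (Rg n.+1).
  by rewrite (rec_R hrec); apply: subspace_image => //; exact: sN.
have lS' i : (1 <= i <= n.+1)%N -> [/\ linear (Sbar i), linear (S i) & subspace (Rg i)].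
  move=> /andP[i1]; rewrite leq_eqVlt => /orP[/eqP->//|ilen].
  by apply: lS; rewrite i1.
have sR' i : (1 <= i <= n.+1)%N -> subspace (Rg i) by move=> /lS'[].
have lEn i : (1 <= n)%N -> (1 <= i <= n.+1)%N -> linear (E i n.+1).
  move=> n1; have [d] := ubnP (n.+1 - i)%N; elim: d i => // d ih i id /andP[i1].
  rewrite leq_eqVlt => /orP[/eqP->|ilen].
    by apply: (eq_linear linear_id) => x; rewrite (rec_Ediag hrec).
  rewrite ltnS in ilen; have i1n : (1 <= i <= n)%N by rewrite i1.
  apply: (@eq_linear _ _ _ (fun x => - Tinv i (\sum_(i.+1 <= nu < n.+2) Sbar nu (E nu n.+1 x)))); last first.
    move=> x; rewrite (rec_E hrec)// (dsum_proj_chain chain_ranges) //.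
      by move=> j _; exact: subspace_Rgc.
    by rewrite i1 ltnW.
  apply: linear_opp; apply: linear_compf.
    apply: linear_Tinv => //; first by have [] := lS _ i1n.
    by have [+ _] := chlin n (leqnn n); exact.
  apply: linear_sumf => nu; rewrite mem_index_iota => /andP[inu nun].
  apply: linear_compf.
    by have [] := lS' nu; rewrite ?(leq_trans i1 (ltnW inu)).
  apply: ih; last by rewrite (leq_trans i1 (ltnW inu)).
  by move: id inu nun; clear; lia.
split => //.
- move=> i; rewrite leq_eqVlt => /orP[/eqP->//|]; exact: sN.
- move=> i j /andP[j1]; rewrite leq_eqVlt => /orP[/eqP->|jn] i1; last first.
    by apply: lM => //; rewrite j1.
  case: (posnP n) => [n0|n1].
    rewrite n0; case: i i1 => // -[_|i _].
      by apply: (eq_linear linear_id) => x; rewrite (rec_M1 hrec).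
    by apply: (eq_linear linear_cst0) => x; rewrite (rec_Mlow hrec).
  case: i i1 => // -[_|i _].
    by by apply: (eq_linear (lEn 1%N n1 _)) => // x; rewrite (rec_Mtop hrec).
  have [ile|ngt] := leqP i.+1 n; last first.
    by apply: (eq_linear linear_cst0) => x; rewrite (rec_Mlow hrec)//.
  apply: (@eq_linear _ _ _ (fun x => \sum_(1 <= nu < n.+1) M i.+1 nu (E nu.+1 n.+1 x))); last first.
    by move=> x; rewrite (rec_M hrec).
  apply: linear_sumf => nu; rewrite mem_index_iota => /andP[nu1 nun].
  by apply: linear_compf; [apply: lM => //; rewrite nu1|apply: lEn].
- move=> i j /andP[j2]; rewrite leq_eqVlt => /orP[/eqP jn|jn] i1j; last first.
    by apply: lE => //; rewrite j2.
  by rewrite jn in j2 i1j *; apply: lEn.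
Qed.

Lemma subspace_N n : subspace (N n).
Proof. by have [+ _ _ _] := recursion_linear n; exact. Qed.
Lemma subspace_Rg n : subspace (Rg n).
Proof.
case: n => [|n]; first by rewrite (rec_R0 hrec); exact: subspace0.
by have [_ /(_ n.+1)[]] := recursion_linear n.+1; rewrite ?leqnn.
Qed.
Lemma linear_Sbar n : (0 < n)%N -> linear (Sbar n).
Proof. by move=> n0; have [_ /(_ n)[]] := recursion_linear n; rewrite ?n0 ?leqnn. Qed.
Lemma linear_S n : (0 < n)%N -> linear (S n).
Proof. by move=> n0; have [_ /(_ n)[]] := recursion_linear n; rewrite ?n0 ?leqnn. Qed.
Lemma linear_part i : linear (q i).
Proof.
case: i => [|i]; first exact: linear_cst0.
have [||+ _] := @chain_linear _ _ _ _ chain_ranges i.+1.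
- by move=> j _; exact: subspace_Rg.
- by move=> j _; exact: subspace_Rgc.
- by apply; rewrite leqnn.
Qed.
Lemma linear_rest n : linear (c n).
Proof.
have [||_ //] := @chain_linear _ _ _ _ chain_ranges n.
- by move=> j _; exact: subspace_Rg.
- by move=> j _; exact: subspace_Rgc.
Qed.
Lemma linear_T i : (0 < i)%N -> linear (Tinv i).
Proof. by move=> i0; apply: linear_Tinv; [|exact: linear_S|exact: linear_part]. Qed.
Lemma linear_M i j : (0 < i)%N -> (0 < j)%N -> linear (M i j).
Proof.
by move=> i0 j0; have [_ _ h _] := recursion_linear j; apply: h; rewrite ?j0 ?leqnn.
Qed.

Lemma S_rest n x : S n.+1 x = c n (Sbar n.+1 x).
Proof. by apply: S_rest_upto => i _; exact: subspace_Rg. Qed.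

Lemma S_codomain n x : Rgc n (S n.+1 x).
Proof. by rewrite S_rest; exact: chain_rest_in chain_ranges _ _. Qed.

Lemma projR_part n i y : (1 <= i <= n)%N -> dsum_proj Rg Rgc n i y = q i y.
Proof.
move=> i1n; rewrite (dsum_proj_chain chain_ranges) // => j _.
  exact: subspace_Rg.
exact: subspace_Rgc.
Qed.

Lemma E_Tinv n i x : (1 <= i <= n)%N ->
  E i n.+1 x = - Tinv i (\sum_(i.+1 <= nu < n.+2) Sbar nu (E nu n.+1 x)).
Proof.
by move=> i1n; rewrite (rec_E hrec)// projR_part//; move: i1n; lia.
Qed.

Lemma E_in_Nc n i x : (1 <= i <= n)%N -> Nc i (E i n.+1 x).
Proof.
move=> i1n; have i0 : (0 < i)%N by case/andP: i1n.
rewrite E_Tinv// -sub0r; apply: subspaceB; [exact: subspace_Nc|by case: (subspace_Nc i)|].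
by have [] := TinvP i0 (linear_S i0) (\sum_(i.+1 <= nu < n.+2) Sbar nu (E nu n.+1 x)).
Qed.

(** A vector whose remainder after [i] steps already lies in the next summand
    has no components further down the chain. *)
Lemma rest_in_range i y : Rg i.+1 (c i y) ->
  q i.+1 y = c i y /\ forall m, (i < m)%N -> c m y = 0 /\ q m.+1 y = 0.
Proof.
move=> Ry; have cD m := chain_partD chain_ranges m y.
have part_in m := @chain_part_in _ _ _ _ chain_ranges m.+1 y isT.
have rest_in m := chain_rest_in chain_ranges m y.
have c0 : c i.+1 y = 0.
  apply: (chain_direct chain_ranges) (rest_in _).
  have -> : c i.+1 y = c i y - q i.+1 y by rewrite (cD i) [RHS]addrC addKr.
  by apply: subspaceB => //; exact: subspace_Rg.
split; first by rewrite (cD i) c0 addr0.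
have next m : c m y = 0 -> c m.+1 y = 0 /\ q m.+1 y = 0.
  move=> cm; have qc : q m.+1 y = - c m.+1 y by apply/eqP; rewrite -addr_eq0 -cD cm.
  have q0 : q m.+1 y = 0.
    apply: (chain_direct chain_ranges) (part_in m) _; rewrite qc -sub0r.
    by apply: subspaceB (rest_in _); [exact: subspace_Rgc|case: (subspace_Rgc m.+1)].
  by split=> //; apply/eqP; rewrite -oppr_eq0 -qc q0.
move=> m im; suff cm : c m y = 0 by split=> //; case: (next m cm).
move/subnK: im => <-; elim: (m - i.+1)%N => [|p ih] //.
by rewrite addSn; case: (next _ ih).
Qed.

(** Gaussian elimination: column [E n.+1] removes from [Sbar n.+1] its
    components in the ranges found so far, starting from the last one. *)
Lemma sum_Sbar_E n x : (1 <= n)%N ->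
  \sum_(1 <= nu < n.+2) Sbar nu (E nu n.+1 x) = S n.+1 x.
Proof.
move=> n1; pose A i := \sum_(i.+1 <= nu < n.+2) Sbar nu (E nu n.+1 x).
have AS i : (i < n.+1)%N -> A i = Sbar i.+1 (E i.+1 n.+1 x) + A i.+1.
  by move=> ilt; rewrite /A big_ltn.
(* Eliminating the rows from [n] down to [n - d + 1] clears the components in the
   corresponding ranges and does not change the remainder. *)
suff inv d : (d <= n)%N -> c n (A (n - d)%N) = c n (Sbar n.+1 x) /\
    forall j, (n - d < j <= n)%N -> q j (A (n - d)%N) = 0.
  have [cA qA] := inv n (leqnn n); rewrite subnn in cA qA.
  rewrite S_rest -cA -[LHS](chain_sum chain_ranges n) big_nat big1 ?add0r//.
elim: d => [|d ih] dn.
  rewrite subn0; split; last by move=> j; lia.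
  by rewrite /A big_nat1 (rec_Ediag hrec).
have {ih}[cA qA] := ih (ltnW dn).
have [i ni ni'] : exists2 i, (n - d = i.+1)%N & (n - d.+1 = i)%N.
  by exists (n - d.+1)%N; lia.
rewrite ni' in qA *; rewrite ni in cA qA *.
have i1n : (1 <= i.+1 <= n)%N by lia.
set w := E i.+1 n.+1 x; have wE : w = - Tinv i.+1 (A i.+1) by rewrite /w E_Tinv.
have Sw : S i.+1 w = - q i.+1 (A i.+1).
  rewrite wE linfN; last exact: linear_S.
  by have [_ ->] := TinvP (isT : (0 < i.+1)%N) (linear_S (isT : (0 < i.+1)%N)) (A i.+1).
have [qw0 qw] : q i.+1 (Sbar i.+1 w) = c i (Sbar i.+1 w) /\
    forall m, (i < m)%N -> c m (Sbar i.+1 w) = 0 /\ q m.+1 (Sbar i.+1 w) = 0.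
  apply: rest_in_range; rewrite -S_rest Sw -sub0r.
  apply: subspaceB; [exact: subspace_Rg|by case: (subspace_Rg i.+1)|].
  exact: chain_part_in chain_ranges _ _ _.
rewrite AS; last by lia.
split.
  rewrite linfD; last exact: linear_rest.
  by rewrite cA (qw n _).1 ?add0r//; lia.
move=> j /andP[ij jn]; rewrite linfD; last exact: linear_part.
move: ij; rewrite leq_eqVlt => /orP[/eqP<-|ij].
  by rewrite -/w qw0 -S_rest Sw addNr.
rewrite qA ?ij// addr0; case: j ij jn => // j ij jn.
by rewrite (qw j _).2.
Qed.

(** Equating coefficients in [L * phi]: for [d >= 1] the sum is the coefficient
    of order [n - d] of [L] applied to column [n] of [M], read from bottom to
    top.  The recursion for [M] shifts this identity from [d] to [d.+1], and the
    contributions of [E_{nu+1,n+1}], [nu < n], vanish because these operators map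
    into [N nu]. *)
Lemma sum_L_M d n x : (1 <= d <= n)%N ->
  \sum_(d <= a < n.+1) L (a - d)%N (M a n x) = S (n - d).+1 x.
Proof.
elim: d n x => // d ih [|n] x // /andP[_ dn]; rewrite ltnS in dn.
have [n0|n1] := posnP n.
  have d0 : d = 0%N by move: dn; rewrite n0 leqn0 => /eqP.
  by rewrite n0 d0 big_nat1 (rec_M1 hrec) (rec_S1 hrec).
have ME a : (1 <= a <= n)%N -> L (a - d)%N (M a.+1 n.+1 x) =
    \sum_(1 <= nu < n.+1) L (a - d)%N (M a nu (E nu.+1 n.+1 x)).
  by move=> a1n; rewrite (rec_M hrec)// linf_sum.
case: d ih dn ME => [|d] ih dn ME.
  rewrite big_ltn// !subSS !subn0 (rec_Mtop hrec)//.
  rewrite big_add1 /= (eq_big_nat _ _ (F2 := fun a =>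
    \sum_(1 <= nu < n.+1) L a (M a nu (E nu.+1 n.+1 x)))); last first.
    by move=> a a1n; have := ME a a1n; rewrite subn0 subSS subn0.
  rewrite exchange_big_nat /=.
  rewrite -sum_Sbar_E// [RHS]big_ltn// [in RHS]big_add1 /= (rec_Sbar1 hrec).
  congr (_ + _); apply: eq_big_nat => nu /andP[nu1 nun].
  rewrite (rec_Sbar hrec)// (big_cat_nat _ (n := nu.+1))//=.
  rewrite [X in _ + X]big_nat [X in _ + X]big1 ?addr0// => a /andP[nua an].
  by rewrite (rec_Mlow hrec) ?nu1// linf0.
rewrite big_add1 /= (eq_big_nat _ _ (F2 := fun a =>
  \sum_(1 <= nu < n.+1) L (a - d.+1)%N (M a nu (E nu.+1 n.+1 x)))); last first.
  by move=> a /andP[da an]; rewrite -ME ?subSS//; move: da an; lia.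
rewrite exchange_big_nat /= big_nat_recr//= big1_seq ?add0r.
  by rewrite (rec_Ediag hrec)// ih ?dn.
move=> nu; rewrite mem_index_iota => /andP[_ /andP[nu1 nun]].
have Mlow a : (nu < a)%N -> L (a - d.+1)%N (M a nu (E nu.+1 n.+1 x)) = 0.
  by move=> nua; rewrite (rec_Mlow hrec) ?nu1// linf0.
have [dnu|nud] := leqP d.+1 nu; last first.
  by rewrite big_nat big1// => a /andP[da _]; rewrite Mlow// (leq_trans nud).
rewrite (big_cat_nat _ (n := nu.+1))//=; try by move: dnu nun; lia.
rewrite [X in _ + X]big_nat [X in _ + X]big1 ?addr0; last first.
  by move=> a /andP[nua _]; exact: Mlow.
rewrite ih ?dnu// (@S_kernel _ nu)//; first by move: dnu; lia.
apply: (chain_subV chain_kernels); apply: E_in_Nc; move: nu1 nun; lia.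
Qed.

End RecursionAlgebra.

(** * Stabilization, boundedness and growth *)

Section Stabilized.
Context {K : numFieldType} {B Bbar : completeNormedModType K}.
Hypothesis archiK : archimedean K.
Variables (L : nat -> B -> Bbar) (N Nc : nat -> set B) (Rg Rgc : nat -> set Bbar).
Variables (Sbar S : nat -> B -> Bbar) (M E : nat -> nat -> B -> B).
Hypothesis hrec : recursion L N Nc Rg Rgc Sbar S M E.
Hypothesis bL : forall i, bounded_linear (L i).
Variable k : nat.
Hypothesis hstab : stabilizes_at Rg k.

Local Notation p := (chain_part N Nc).
Local Notation q := (chain_part Rgc Rg).
Local Notation c := (chain_rest Rgc Rg).
Local Notation T := (Tinv Nc Rg Rgc S).
Let linL i : linear (L i) := bounded_linear_lin (bL i).
Let chR := chain_ranges hrec.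
Let chN := chain_kernels hrec.

Lemma Rg_stab l : (k.+2 <= l)%N -> Rg l = [set 0].
Proof. by move=> kl; rewrite -(subnKC kl) addSnnS addSnnS; apply: hstab.2. Qed.

Lemma q_stab l y : (k.+2 <= l)%N -> q l y = 0.
Proof.
move=> kl; have : Rg l (q l y) by apply: chain_part_in chR _ _ _; move: kl; lia.
by rewrite Rg_stab.
Qed.

Lemma N_stab l : (k.+1 <= l)%N -> N l = N k.+1.
Proof.
move=> kl; apply/seteqP; split; first exact: (kernels_anti hrec kl).
rewrite -(subnK kl); elim: (l - k.+1)%N => [|d ih] // x /ih Nx.
rewrite addSn (rec_N hrec); split=> //.
have := S_in_range hrec Nx; rewrite Rg_stab//; lia.
Qed.

Lemma Rgc_stab l : (k.+1 <= l)%N -> Rgc l `<=` Rgc k.+1.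
Proof.
move=> kl; rewrite -(subnK kl); elim: (l - k.+1)%N => [|d ih] // x Rx.
by apply: ih; exact: (chain_subW chR).
Qed.

Lemma Nc_stab l x : (k.+2 <= l)%N -> Nc l x -> x = 0.
Proof.
case: l => // l kl Nx; apply: (chain_direct chN Nx _).
have -> : N l.+1 = N l by rewrite (@N_stab l.+1) ?(@N_stab l)//; lia.
exact: (chain_subV chN Nx).
Qed.

Lemma T_stab l y : (k.+2 <= l)%N -> T l y = 0.
Proof.
move=> kl; have l0 : (0 < l)%N by lia.
have [h _] := TinvP hrec l0 (linear_S hrec linL l0) y.
exact: Nc_stab kl h.
Qed.

Lemma E_stab i n x : (k.+2 <= i <= n)%N -> E i n.+1 x = 0.
Proof.
move=> /andP[ki ilen]; rewrite (E_Tinv hrec linL); last by lia.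
by rewrite T_stab// oppr0.
Qed.

Lemma M_diag i x : (0 < i)%N -> M i i x = x.
Proof.
case: i => // i _; elim: i x => [|i ih] x; first exact: (rec_M1 hrec).
rewrite (rec_M hrec) ?leqnn// big_nat_recr//= big_nat big1 ?add0r.
  by rewrite (rec_Ediag hrec)// ih.
by move=> nu /andP[nu1 nui]; rewrite (rec_Mlow hrec)//; lia.
Qed.

(** Since [E n.+1] vanishes in the rows from [k + 2] to [n], one step of the
    recursion shifts [M] down the diagonal, up to a correction in the first [k + 1]
    rows. *)
Lemma M_next i n x : (0 < i)%N -> (k.+1 <= n)%N ->
  M i.+1 n.+1 x =
  M i n x + \sum_(1 <= nu < k.+1) (if (i <= k)%N then M i nu (E nu.+1 n.+1 x) else 0).
Proof.
move=> i0 kn.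
have [ilen|ni] := leqP i n; last first.
  rewrite !(rec_Mlow hrec) ?add0r//; try by lia.
  rewrite big1// => nu _; case: ifP => //; lia.
rewrite (rec_M hrec) ?i0 ?ilen// big_nat_recr//=; last by lia.
rewrite (rec_Ediag hrec); last by lia.
rewrite addrC; congr (_ + _).
rewrite (big_cat_nat _ (n := k.+1))//= [X in _ + X]big_nat [X in _ + X]big1 ?addr0.
  apply: eq_big_nat => nu /andP[nu1 nuk]; case: ifP => // ik.
  by rewrite (rec_Mlow hrec)//; lia.
move=> nu /andP[knu nun]; rewrite E_stab; last by lia.
by apply: linf0; apply: (linear_M hrec linL) => //; lia.
Qed.

(** In the rows after [k + 1] the correction is absent; this is what turns the
    columns of [M] into one power series. *)
Lemma M_toeplitz a n x : (k.+1 <= a <= n)%N -> M a n x = M k.+1 (k.+1 + (n - a))%N x.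
Proof.
move=> /andP[ka an].
suff shift d m : M (d + k.+1)%N (d + (k.+1 + m))%N x = M k.+1 (k.+1 + m)%N x.
  by rewrite -(shift (a - k.+1)%N); congr (M _ _ _); lia.
elim: d => [|d ih]; first by rewrite !add0n.
rewrite !addSn M_next ?ih; try by lia.
rewrite big1 ?addr0// => nu _; case: ifP => //; lia.
Qed.

(** The case [d = k + 1] of [sum_L_M], read along the shifted rows. *)
Lemma sum_L_phi i x :
  \sum_(0 <= j < i.+1) L j (M k.+1 (k.+1 + (i - j))%N x) = S i.+1 x.
Proof.
have := @sum_L_M _ _ _ _ _ _ _ _ _ _ _ _ hrec linL k.+1 (k.+1 + i) x.
rewrite leq_addr => /(_ isT).
have -> : (k.+1 + i - k.+1 = i)%N by lia.
move=> <-; rewrite [RHS](big_addn 0 _ k.+1).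
have -> : ((k.+1 + i).+1 - k.+1 = i.+1)%N by lia.
apply: eq_big_nat => j /andP[_ ji]; rewrite addnK; congr (L j _).
rewrite [RHS]M_toeplitz; last by lia.
by congr (M _ _ _); lia.
Qed.

Section Bounded.
Hypothesis clNc : forall i, (1 <= i <= k.+1)%N -> closed (Nc i).
Hypothesis clN : closed (N k.+1).
Hypothesis clR : forall i, (1 <= i <= k.+1)%N -> closed (Rg i).
Hypothesis clRc : closed (Rgc k.+1).

(** The remainder [W k.+1] takes part as the summand of index 0. *)
Lemma chain_part_bounded (F : completeNormedModType K) (W V : nat -> set F) :
  chain W V -> (forall i, subspace (V i)) -> (forall i, subspace (W i)) ->
  (forall i, (1 <= i <= k.+1)%N -> closed (V i)) -> closed (W k.+1) ->
  forall i, (1 <= i <= k.+1)%N -> bounded_linear (chain_part W V i).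
Proof.
move=> ch sV sW clV clW i i1k.
have [|| linp linr] := @chain_linear _ _ _ _ ch k.+1; [by move=> *; exact: sV|by move=> *; exact: sW|].
pose Q j := if j is 0%N then chain_rest W V k.+1 else
  if (j <= k.+1)%N then chain_part W V j else fun=> 0.
pose V' j := if j is 0%N then W k.+1 else V j.
have QE j : (1 <= j <= k.+1)%N -> Q j = chain_part W V j.
  by case: j => // j /andP[_]; rewrite /Q => ->.
have sumE v : \sum_(0 <= j < k.+2) v j = \sum_(1 <= j < k.+2) v j + v 0%N :> F.
  by rewrite big_ltn// addrC.
rewrite -QE//; apply: (@closed_dsum_bounded _ archiK _ k.+2 Q V'); last by lia.
- case=> [|j]; first exact: linr.
  by rewrite /Q; case: ifP => jk; [apply: linp; rewrite jk|exact: linear_cst0].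
- by case=> [|j] jk //; apply: clV.
- case=> [|j] x jk; first exact: (chain_rest_in ch).
  by rewrite QE; [exact: (chain_part_in ch)|lia].
- move=> x; rewrite sumE -[RHS](chain_sum ch k.+1); congr (_ + _).
  by apply: eq_big_nat => j j1k; rewrite QE.
- move=> v x Vv sumv.
  have [|||||hp hr] := @chain_unique _ _ _ _ ch k.+1 _ _ v (v 0%N) x.
  + by move=> *; exact: sV.
  + by move=> *; exact: sW.
  + by move=> j /andP[j1 jk]; have := Vv j jk; case: j j1 jk.
  + exact: (Vv 0%N).
  + by rewrite -sumE.
  case=> [|j] jk; first exact: hr.
  by rewrite QE ?hp//; lia.
Qed.

Lemma bounded_q i : bounded_linear (q i).
Proof.
have [i0|i0] := posnP i; first by rewrite i0; exact: bounded_linear0.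
have [ik|ki] := leqP i k.+1; last first.
  by apply: (bounded_linear_ext bounded_linear0) => y; rewrite q_stab.
apply: (@chain_part_bounded _ Rgc Rg) => //; last by rewrite i0.
- exact: (subspace_Rg hrec linL).
- exact: (subspace_Rgc hrec).
Qed.

Lemma bounded_p i : (1 <= i <= k.+1)%N -> bounded_linear (p i).
Proof.
apply: (@chain_part_bounded _ N Nc) => //.
- exact: (subspace_Nc hrec).
- exact: (subspace_N hrec linL).
Qed.

Lemma bounded_c n : bounded_linear (c n).
Proof.
apply: (@bounded_linear_ext _ _ _ (fun y => y + - \sum_(1 <= i < n.+1) q i y)).
  apply: bounded_linear_add; first exact: bounded_linear_id.
  by apply: bounded_linear_opp; apply: bounded_linear_sum => i _; exact: bounded_q.
by move=> y; apply/eqP; rewrite subr_eq addrC (chain_sum chR).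
Qed.

Lemma bounded_T_of i : (0 < i)%N -> bounded_linear (S i) -> bounded_linear (T i).
Proof.
move=> i0 bS; have lS := bounded_linear_lin bS.
have [ik|ki] := leqP i k.+1; last first.
  by apply: (bounded_linear_ext bounded_linear0) => y; rewrite T_stab.
have i1k : (1 <= i <= k.+1)%N by rewrite i0.
apply: (closed_inverse_bounded archiK bS (bounded_q i) _ (clNc i1k)).
- exact: (linear_T hrec linL).
- by move=> y; have [] := TinvP hrec i0 lS y.
- by move=> y; have [] := TinvP hrec i0 lS y.
- by move=> v y; exact: (Tinv_unique hrec i0 lS).
Qed.

Lemma recursion_bounded n :
  [/\ forall i, (1 <= i <= n)%N -> bounded_linear (Sbar i) /\ bounded_linear (S i)
    & forall i j, (1 <= j <= n)%N -> (1 <= i)%N -> bounded_linear (M i j)].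
Proof.
elim: n => [|n [bS bM]].
  by split=> [i|i j] /andP[h]; rewrite leqNgt h.
have bSbar : bounded_linear (Sbar n.+1).
  case: (posnP n) => [->|n0].
    by apply: (bounded_linear_ext (bL 0%N)) => x; rewrite (rec_Sbar1 hrec).
  apply: (@bounded_linear_ext _ _ _ (fun x => \sum_(1 <= i < n.+1) L i (M i n x))).
    apply: bounded_linear_sum => i; rewrite mem_index_iota => /andP[i1 _].
    by apply: bounded_linear_comp => //; apply: bM; rewrite ?n0 ?leqnn.
  by move=> x; rewrite (rec_Sbar hrec).
have bSn : bounded_linear (S n.+1).
  apply: (@bounded_linear_ext _ _ _ (fun x => c n (Sbar n.+1 x))).
    by apply: bounded_linear_comp => //; exact: bounded_c.
  by move=> x; rewrite (S_rest hrec linL).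
have bS' i : (1 <= i <= n.+1)%N -> bounded_linear (Sbar i) /\ bounded_linear (S i).
  move=> /andP[i1]; rewrite leq_eqVlt => /orP[/eqP->//|ilen].
  by apply: bS; rewrite i1.
split=> // i j /andP[j1]; rewrite leq_eqVlt => /orP[/eqP->|jn] i1; last first.
  by apply: bM => //; rewrite j1.
case: (posnP n) => [n0|n1].
  rewrite n0; case: i i1 => // -[_|i _].
    by apply: (bounded_linear_ext bounded_linear_id) => x; rewrite (rec_M1 hrec).
  by apply: (bounded_linear_ext bounded_linear0) => x; rewrite (rec_Mlow hrec).
have bE l : (1 <= l <= n.+1)%N -> bounded_linear (E l n.+1).
  have [d] := ubnP (n.+1 - l)%N; elim: d l => // d ih l ld /andP[l1].
  rewrite leq_eqVlt => /orP[/eqP->|ln].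
    by apply: (bounded_linear_ext bounded_linear_id) => x; rewrite (rec_Ediag hrec).
  apply: (@bounded_linear_ext _ _ _
      (fun x => - T l (\sum_(l.+1 <= nu < n.+2) Sbar nu (E nu n.+1 x)))).
    apply: bounded_linear_opp; apply: bounded_linear_comp.
      by apply: bounded_T_of => //; have [] := bS' l; [lia|].
    apply: bounded_linear_sum => nu; rewrite mem_index_iota => /andP[lnu nun].
    apply: bounded_linear_comp; first by have [] := bS' nu; [lia|].
    by apply: ih; lia.
  by move=> x; rewrite (E_Tinv hrec linL)//; lia.
case: i i1 => // -[_|i _].
  by apply: (bounded_linear_ext (bE 1%N _)) => // x; rewrite (rec_Mtop hrec).
have [ile|ngt] := leqP i.+1 n; last first.
  by apply: (bounded_linear_ext bounded_linear0) => x; rewrite (rec_Mlow hrec).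
apply: (@bounded_linear_ext _ _ _ (fun x => \sum_(1 <= nu < n.+1) M i.+1 nu (E nu.+1 n.+1 x))).
  apply: bounded_linear_sum => nu; rewrite mem_index_iota => /andP[nu1 nun].
  by apply: bounded_linear_comp; [apply: bM => //; rewrite nu1|apply: bE].
by move=> x; rewrite (rec_M hrec).
Qed.

Lemma bounded_Sbar i : (0 < i)%N -> bounded_linear (Sbar i).
Proof. by move=> i0; have [/(_ i)[]] := recursion_bounded i; rewrite ?i0 ?leqnn. Qed.
Lemma bounded_S i : (0 < i)%N -> bounded_linear (S i).
Proof. by move=> i0; have [/(_ i)[]] := recursion_bounded i; rewrite ?i0 ?leqnn. Qed.
Lemma bounded_M i j : (0 < i)%N -> (0 < j)%N -> bounded_linear (M i j).
Proof. by move=> i0 j0; have [_ h] := recursion_bounded j; apply: h; rewrite ?j0 ?leqnn. Qed.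
Lemma bounded_T i : (0 < i)%N -> bounded_linear (T i).
Proof. by move=> i0; apply: bounded_T_of => //; exact: bounded_S. Qed.

(** The elimination involves the first [k + 1] rows only, so that the constant does
    not depend on the column. *)
Lemma E_growth : exists2 C, 0 <= C & forall i n x, (1 <= i <= k.+1)%N ->
  (k.+1 <= n)%N -> `|E i n.+1 x| <= C * `|Sbar n.+1 x|.
Proof.
have [CT CT0 hT] := @bounded_linear_common _ _ _ _ (index_iota 1 k.+2) T
  (fun i => ltac:(rewrite mem_index_iota => /andP[i0 _]; exact: bounded_T)).
have [CS CS0 hS] := @bounded_linear_common _ _ _ _ (index_iota 1 k.+2) Sbar
  (fun i => ltac:(rewrite mem_index_iota => /andP[i0 _]; exact: bounded_Sbar)).
suff downto d : exists2 C, 0 <= C & forall i n x, (k.+1 - d < i <= k.+1)%N ->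
    (k.+1 <= n)%N -> `|E i n.+1 x| <= C * `|Sbar n.+1 x|.
  have [C C0 hC] := downto k.+1.
  by exists C => // i n x ik kn; apply: hC => //; rewrite subnn.
elim: d => [|d [C C0 hC]].
  by exists 0 => // i n x; rewrite subn0; lia.
exists (C + CT * (k.+2%:R * (CS * C) + 1)).
  by rewrite !addr_ge0 ?mulr_ge0 ?addr_ge0 ?mulr_ge0.
move=> i n x /andP[di ik] kn.
have [dlt|led] := ltnP (k.+1 - d) i.
  rewrite (le_trans (hC i n x _ kn)) ?dlt//.
  by rewrite ler_wpM2r// lerDl !mulr_ge0 ?addr_ge0 ?mulr_ge0.
have i1 : (1 <= i)%N by lia.
rewrite (E_Tinv hrec linL); last by lia.
rewrite normrN (le_trans (hT _ _ _)) ?mem_index_iota ?i1// mulrDl.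
rewrite ler_wpDl ?mulr_ge0// -mulrA ler_wpM2l//.
rewrite (big_cat_nat _ (n := k.+2))//=; try by lia.
rewrite [X in _ + X]big_nat_recr//= [X in _ + (X + _)]big_nat.
rewrite [X in _ + (X + _)]big1 ?add0r; last first.
  move=> nu /andP[knu nun]; rewrite E_stab ?linf0//; last by lia.
  by apply: (linear_Sbar hrec linL); lia.
rewrite (rec_Ediag hrec); last by lia.
rewrite (le_trans (ler_normD _ _))// mulrDl mul1r lerD2r.
rewrite (le_trans (ler_norm_sum _ _ _))//.
apply: (@le_trans _ _ (\sum_(i.+1 <= nu < k.+2) CS * C * `|Sbar n.+1 x|)).
  apply: ler_sum_nat => nu /andP[inu nuk].
  rewrite (le_trans (hS _ _ _)) ?mem_index_iota -?mulrA ?ler_wpM2l ?hC//; lia.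
rewrite sumr_const_nat -[leLHS]mulr_natl -!mulrA ler_wpM2r ?mulr_ge0// ler_nat; lia.
Qed.

(** The weighted sum [X n x] of the norms in column [n] dominates [Sbar n.+1 x],
    which in turn dominates the correction made in column [n + 1]; hence
    [X n.+1 x <= r * X n x]. *)
Lemma M_growth : (exists C r : K, [/\ 0 <= C, 0 < r &
    forall i x, `|L i x| <= C * r ^+ i * `|x|]) ->
  exists C r : K, [/\ 0 <= C, 0 < r &
    forall j x, `|M k.+1 (k.+1 + j)%N x| <= C * r ^+ j * `|x|].
Proof.
move=> [CL [rho [CL0 rho0 hL]]].
have [CE CE0 hE] := E_growth.
have [CM CM0 hM] : exists2 CM, 0 <= CM & forall i nu x,
    (1 <= i <= k.+1)%N -> (1 <= nu <= k.+1)%N -> `|M i nu x| <= CM * `|x|.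
  have [CM CM0 hM] := @bounded_linear_common _ _ _ _
    [seq (i, j) | i <- index_iota 1 k.+2, j <- index_iota 1 k.+2] (fun ij => M ij.1 ij.2)
    (fun ij => ltac:(case: ij => i j /allpairsP[[a b] /= [+ + [-> ->]]];
       rewrite !mem_index_iota => /andP[a0 _] /andP[b0 _]; exact: bounded_M)).
  exists CM => // i nu x ik nuk; apply: (hM (i, nu)).
  by apply/allpairsP; exists (i, nu); rewrite !mem_index_iota.
(* [w >= rho] makes the weights absorb the coefficients of [L], and [w >= 1] bounds
   the single entry of interest by the weighted sum. *)
pose w := rho + 1.
have w1 : 1 <= w by rewrite lerDr ltW.
have w0 : 0 <= w by rewrite (le_trans _ w1).
have rw : rho <= w by rewrite lerDl.
pose X n x := \sum_(1 <= i < n.+1) w ^+ i * `|M i n x|.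
have X0 n x : 0 <= X n x by apply: sumr_ge0 => i _; rewrite mulr_ge0 ?exprn_ge0.
have SX n x : (0 < n)%N -> `|Sbar n.+1 x| <= CL * X n x.
  move=> n0; rewrite (rec_Sbar hrec)// (le_trans (ler_norm_sum _ _ _))// mulr_sumr.
  apply: ler_sum => i _; rewrite (le_trans (hL _ _))// -mulrA ler_wpM2l//.
  by rewrite ler_wpM2r// lerXn2r// nnegrE ltW.
pose D := \sum_(1 <= i < k.+1) w ^+ i.+1 * (k%:R * (CM * CE)).
have D0 : 0 <= D by apply: sumr_ge0 => i _; rewrite !mulr_ge0 ?exprn_ge0.
pose r := w + (w * CE + D) * CL.
have r0 : 0 < r.
  by rewrite ltr_pwDl ?(lt_le_trans ltr01 w1)// mulr_ge0// addr_ge0// mulr_ge0.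
have Xnext n x : (k.+1 <= n)%N -> X n.+1 x <= r * X n x.
  move=> kn; have -> : r * X n x = w * X n x + (w * CE + D) * CL * X n x.
    by rewrite /r mulrDl.
  rewrite [X n.+1 x]/X big_ltn// big_add1 /=.
  set G := `|Sbar n.+1 x|.
  have n0 : (0 < n)%N := leq_trans (ltn0Sn k) kn.
  have GX : G <= CL * X n x by exact: SX.
  have M1 : `|M 1 n.+1 x| <= CE * G.
    by rewrite (rec_Mtop hrec)//; apply: hE.
  apply: (@le_trans _ _ (w * (CE * G) + (w * X n x + D * G))); last first.
    rewrite addrCA lerD2l mulrA -mulrDl -mulrA ler_wpM2l//.
    by rewrite addr_ge0// mulr_ge0.
  rewrite expr1 lerD ?ler_wpM2l//.
  have -> : D * G = \sum_(1 <= i < n.+1)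
      (if (i <= k)%N then w ^+ i.+1 * (k%:R * (CM * CE)) * G else 0).
    rewrite [RHS](big_cat_nat _ (n := k.+1))//=; last exact: leqW.
    rewrite [X in _ + X]big_nat [X in _ + X]big1 ?addr0; last first.
      by move=> i /andP[ki _]; rewrite leqNgt ki.
    by rewrite /D mulr_suml; apply: eq_big_nat => i /andP[_ ik]; rewrite -ltnS ik.
  rewrite /X mulr_sumr -big_split /=; apply: ler_sum_nat => i /andP[i1 ilen].
  rewrite M_next//; case: ifP => ik; last first.
    by rewrite big1// !addr0 mulrA exprS.
  rewrite exprS -!mulrA -mulrDr ler_wpM2l// -mulrDr ler_wpM2l ?exprn_ge0//.
  rewrite (le_trans (ler_normD _ _))// lerD2l (le_trans (ler_norm_sum _ _ _))//.
  rewrite big_add1 /=; apply: sum_le_const => nu nuk.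
  rewrite (le_trans (hM _ _ _ _ _)) ?i1 ?(leqW ik) ?ltnS ?(ltnW nuk)//.
  by rewrite ler_wpM2l// hE.
have Xgeo j x : X (k.+1 + j)%N x <= r ^+ j * X k.+1 x.
  elim: j => [|j ih]; first by rewrite addn0 mul1r.
  rewrite addnS (le_trans (Xnext _ _ _)) ?leq_addr//.
  by rewrite exprS -mulrA ler_wpM2l// ltW.
have [C C0 hC] : exists2 C, 0 <= C & forall x, X k.+1 x <= C * `|x|.
  exists (\sum_(1 <= i < k.+2) w ^+ i * CM).
    by apply: sumr_ge0 => i _; rewrite mulr_ge0 ?exprn_ge0.
  move=> x; rewrite /X mulr_suml; apply: ler_sum_nat => i ik.
  by rewrite -mulrA ler_wpM2l ?exprn_ge0//; apply: hM => //; rewrite leqnn.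
exists C, r; split=> // j x.
apply: (@le_trans _ _ (X (k.+1 + j)%N x)); last first.
  by rewrite (le_trans (Xgeo _ _))// [C * _]mulrC -mulrA ler_wpM2l ?exprn_ge0// ltW.
rewrite /X (big_rem k.+1) ?mem_index_iota ?ltnS ?leq_addr//=.
rewrite ler_wpDr//.
  by apply: sumr_ge0 => i _; rewrite mulr_ge0 ?exprn_ge0.
by rewrite ler_peMl// exprn_ege1.
Qed.

End Bounded.
End Stabilized.

(** * Operator power series *)

Section Expansions.
Context {K : numFieldType}.
Hypothesis archiK : archimedean K.
Local Notation h n := ((2^-1 : K) ^+ n).
#[local] Hint Resolve half_ge0 : core.

Lemma expr_le_half (t : K) n : 0 <= t -> t <= 2^-1 -> t ^+ n <= h n.
Proof. by move=> t0 t2; rewrite lerXn2r// nnegrE invr_ge0. Qed.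

Lemma expr_le_quarter (t : K) n : 0 <= t -> t <= 4^-1 -> t ^+ n <= h n * h n.
Proof.
move=> t0 t4; rewrite -exprMn lerXn2r// ?nnegrE ?mulr_ge0 ?invr_ge0//.
by rewrite -invfM -natrM.
Qed.

Lemma quarter_le_half : 4^-1 <= 2^-1 :> K.
Proof. by rewrite lef_pV2 ?posrE// ler_nat. Qed.

Lemma h_split i n : (i <= n)%N -> h i * h (n - i) = h n.
Proof. by move=> i_n; rewrite -exprD subnKC. Qed.

Lemma binomial_le_pow2 n i : ('C(n, i) <= 2 ^ n)%N.
Proof.
elim: n i => [|n ih] [|i] //; first by rewrite bin0 expn_gt0.
by rewrite binS expnS mul2n -addnn leq_add.
Qed.

Definition psum {E F : lmodType K} (a : nat -> E -> F) (z : K) n x : F :=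
  \sum_(0 <= i < n) z ^+ i *: a i x.

Lemma linear_psum (E F : lmodType K) (a : nat -> E -> F) z n : (forall i, linear (a i)) -> linear (psum a z n).
Proof. by move=> la; apply: linear_sumf => i _; exact: linear_scale. Qed.

Lemma psum_recr (E F : lmodType K) (a : nat -> E -> F) z n x : psum a z n.+1 x = psum a z n x + z ^+ n *: a n x.
Proof. by rewrite /psum big_nat_recr. Qed.

Definition geo_coef {E F : normedModType K} (a : nat -> E -> F) (C r : K) : Prop :=
  [/\ 0 <= C, 0 < r, forall i, linear (a i) & forall i x, `|a i x| <= C * r ^+ i * `|x|].

(** Quantitative analyticity at [z0].  The disc is smaller than the one on which the
    bounds on the coefficients give convergence, which leaves room for composition
    and recentering at the same geometric rate of convergence. *)
Definition expansion {E F : normedModType K} (z0 : K) (a : nat -> E -> F) (C r : K)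
    (T : K -> E -> F) : Prop :=
  geo_coef a C r /\ forall w, `|w - z0| * r <= 4^-1 ->
    forall n x, `|T w x - psum a (w - z0) n x| <= 2 * C * `|x| * h n.

Section Basic.
Context {E F : normedModType K}.
Implicit Types (a : nat -> E -> F) (C r z w : K) (T : K -> E -> F).

Lemma geo_coef_mono a C r C' r' : C <= C' -> r <= r' -> geo_coef a C r ->
  geo_coef a C' r'.
Proof.
move=> CC rr [C0 r0 la ha]; split=> //; [exact: le_trans CC|exact: lt_le_trans rr|].
move=> i x; rewrite (le_trans (ha i x))// ler_wpM2r// ler_pM ?exprn_ge0 ?(ltW r0)//.
by rewrite lerXn2r// nnegrE ?(ltW r0)// (le_trans (ltW r0) rr).
Qed.

Lemma expansion_mono z0 a C r C' r' T : C <= C' -> r <= r' ->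
  expansion z0 a C r T -> expansion z0 a C' r' T.
Proof.
move=> CC rr [ga Ta]; split; first exact: geo_coef_mono ga.
move=> w wr n x; have [C0 r0 _ _] := ga.
rewrite (le_trans (Ta w _ n x)) ?(le_trans _ wr) ?ler_wpM2l//.
by rewrite !ler_wpM2r// ler_wpM2l.
Qed.

Lemma geo_coef_term a C r z i x : geo_coef a C r ->
  `|z ^+ i *: a i x| <= (`|z| * r) ^+ i * (C * `|x|).
Proof.
move=> [C0 r0 la ha]; rewrite normrZ normrX exprMn -mulrA ler_wpM2l ?exprn_ge0//.
by rewrite (le_trans (ha i x))// mulrAC [leRHS]mulrC.
Qed.

Lemma psum_dist a C r z n m x : geo_coef a C r -> `|z| * r <= 2^-1 -> (n <= m)%N ->
  `|psum a z m x - psum a z n x| <= 2 * C * `|x| * h n.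
Proof.
move=> ga zr nm; have [C0 r0 _ _] := ga.
rewrite /psum (big_cat_nat _ (n := n))//= addrAC subrr add0r.
rewrite (le_trans (ler_norm_sum _ _ _))//.
apply: (@le_trans _ _ (\sum_(n <= i < m) h i * (C * `|x|))).
  apply: ler_sum => i _; rewrite (le_trans (geo_coef_term _ _ _ ga))//.
  by rewrite ler_wpM2r ?mulr_ge0// expr_le_half// mulr_ge0// ltW.
have -> : 2 * C * `|x| * h n = 2 * h n * (C * `|x|) by ring.
by rewrite -mulr_suml ler_wpM2r ?mulr_ge0// sum_half_le.
Qed.

Lemma expansion_geo_cvg z0 a C r T w x : expansion z0 a C r T ->
  `|w - z0| * r <= 4^-1 -> geo_cvg (2 * C * `|x|) (fun n => psum a (w - z0) n x) (T w x).
Proof. by move=> [_ Ta] wr n; exact: Ta. Qed.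

Lemma expansion_op_series z0 a C r T w : expansion z0 a C r T ->
  `|w - z0| * r <= 4^-1 -> op_series a (w - z0) (T w).
Proof.
move=> aT wr e e0; have [[C0 r0 _ _] _] := aT.
have [n0 hn0] := half_small_near archiK (mulr_ge0 (ler0n K 2) C0) e0.
exists n0 => // n /= nn x; rewrite distrC (le_trans (expansion_geo_cvg x aT wr n))//.
by rewrite mulrAC ler_wpM2r// hn0.
Qed.

Lemma expansion_norm z0 a C r T w x : expansion z0 a C r T ->
  `|w - z0| * r <= 4^-1 -> `|T w x| <= 2 * C * `|x|.
Proof.
move=> aT wr; have := expansion_geo_cvg x aT wr 0%N.
by rewrite /psum big_geq// subr0 expr0 mulr1.
Qed.

Lemma expansion_bounded z0 a C r T w : expansion z0 a C r T ->
  `|w - z0| * r <= 4^-1 -> bounded_linear (T w).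
Proof.
move=> aT wr; have [[C0 r0 la _] _] := aT.
split; last by exists (2 * C) => x; exact: expansion_norm aT wr.
move=> s x y; have lp := fun n => linear_psum (w - z0) n la.
have cv u := expansion_geo_cvg u aT wr.
apply: (geo_cvg_unique archiK _ _ (cv (s *: x + y))
  (C' := `|s| * (2 * C * `|x|) + 2 * C * `|y|)); rewrite ?addr_ge0 ?mulr_ge0//.
move=> n; rewrite lp opprD addrACA -scalerBr (le_trans (ler_normD _ _))//.
by rewrite normrZ mulrDl lerD// -?mulrA ?ler_wpM2l// !mulrA; exact: cv.
Qed.

Lemma expansion_eq z0 a C r T a' C' r' T' w x :
  expansion z0 a C r T -> expansion z0 a' C' r' T' -> (forall i, a i =1 a' i) ->
  `|w - z0| * r <= 4^-1 -> `|w - z0| * r' <= 4^-1 -> T w x = T' w x.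
Proof.
move=> aT aT' aa wr wr'; have [[[C0 _ _ _] _] [[C0' _ _ _] _]] := (aT, aT').
apply: (geo_cvg_unique archiK _ _ (expansion_geo_cvg x aT wr)
  (C' := 2 * C' * `|x|)); rewrite ?mulr_ge0//.
move=> n; rewrite /psum; under eq_bigr do rewrite aa.
exact: expansion_geo_cvg aT' wr' n.
Qed.

Lemma expansion_finite a C r m : geo_coef a C r ->
  (forall i x, (m <= i)%N -> a i x = 0) ->
  expansion 0 a C r (fun w x => psum a w m x).
Proof.
move=> ga a0; split=> // w; rewrite subr0 => wr n x.
have [C0 r0 _ _] := ga.
have [nm|mn] := leqP n m.
  by apply: (psum_dist _ ga) => //; exact: le_trans wr quarter_le_half.
rewrite /psum [X in _ - X](big_cat_nat _ (n := m))//=; last exact: ltnW.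
rewrite [X in _ - (_ + X)]big_nat [X in _ - (_ + X)]big1 ?addr0 ?subrr ?normr0 ?mulr_ge0//.
by move=> i /andP[mi _]; rewrite a0// scaler0.
Qed.

Lemma expansion_const (A : E -> F) : bounded_linear A ->
  exists C, forall z0 r, 0 < r ->
  expansion z0 (fun i => if i is 0%N then A else fun=> 0) C r (fun=> A).
Proof.
move=> bA; have [C C0 hA] := bounded_linearP bA; exists C => z0 r r0; split.
  split=> //; first by case=> [|i]; [exact: bounded_linear_lin|exact: linear_cst0].
  case=> [|i] x; first by rewrite mulr1 hA.
  by rewrite normr0 !mulr_ge0 ?exprn_ge0 ?(ltW r0).
move=> w _ [|n] x; rewrite /psum.
  rewrite big_geq// subr0 expr0 mulr1 (le_trans (hA x))//.
  by rewrite ler_wpM2r// ler_peMl// ler1n.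
rewrite big_ltn// big1_seq.
  by rewrite addr0 expr0 scale1r subrr normr0 !mulr_ge0.
by case=> [|i]; rewrite mem_index_iota// scaler0.
Qed.

End Basic.

Lemma expansion_exists {E : normedModType K} {F : completeNormedModType K}
  (a : nat -> E -> F) C r z0 : geo_coef a C r -> exists T, expansion z0 a C r T.
Proof.
move=> ga; have [C0 r0 _ _] := ga.
have cv (wx : K * E) : exists l, `|wx.1 - z0| * r <= 4^-1 ->
    geo_cvg (2 * C * `|wx.2|) (fun n => psum a (wx.1 - z0) n wx.2) l.
  case: wx => w x /=.
  have [wr|] := pselect (`|w - z0| * r <= 4^-1); last by exists 0.
  have [||l hl] := @geo_cauchy_cvg _ archiK F (C * `|x|) (fun n => psum a (w - z0) n x).
  - by rewrite mulr_ge0.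
  - move=> n; rewrite psum_recr addrAC subrr add0r.
    rewrite (le_trans (geo_coef_term _ _ _ ga))// mulrC ler_wpM2l ?mulr_ge0//.
    rewrite expr_le_half ?mulr_ge0// ?(ltW r0)//; exact: le_trans wr quarter_le_half.
  by exists l => _; rewrite -mulrA.
have [T hT] := choice cv.
by exists (fun w x => T (w, x)); split=> // w wr n x; exact: (hT (w, x)).
Qed.

Definition cauchy_prod {E F G : lmodType K} (a : nat -> F -> G) (b : nat -> E -> F)
  n x : G := \sum_(0 <= i < n.+1) a i (b (n - i)%N x).

Lemma psum_cauchy_prod {E F G : lmodType K} (a : nat -> F -> G) (b : nat -> E -> F) z n x :
  (forall i, linear (a i)) -> psum (cauchy_prod a b) z n x =
  \sum_(0 <= i < n) z ^+ i *: a i (psum b z (n - i)%N x).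
Proof.
move=> la; elim: n => [|n ih]; first by rewrite /psum !big_geq.
rewrite psum_recr ih [RHS]big_nat_recr//= subSnn.
have -> : psum b z 1 x = b 0%N x by rewrite /psum big_nat1 expr0 scale1r.
rewrite /cauchy_prod big_nat_recr//= subnn scalerDr addrA; congr (_ + _).
rewrite scaler_sumr -big_split; apply: eq_big_nat => i /andP[_ i_n] /=.
rewrite subSn; last exact: ltnW.
rewrite psum_recr (linfD (la i)) (linfZ (la i)) scalerDr scalerA -exprD subnKC//.
exact: ltnW.
Qed.

Lemma geo_coef_cauchy_prod {E F G : normedModType K} (a : nat -> F -> G)
  (b : nat -> E -> F) C C' r : geo_coef a C r -> geo_coef b C' r ->
  geo_coef (cauchy_prod a b) (C * C') (2 * r).
Proof.
move=> [C0 r0 la ha] [C0' _ lb hb]; split.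
- exact: mulr_ge0.
- exact: mulr_gt0.
- by move=> i; apply: linear_sumf => j _; exact: linear_compf.
- move=> n x; rewrite /cauchy_prod (le_trans (ler_norm_sum _ _ _))//.
  apply: (@le_trans _ _ (n.+1%:R * (C * C' * r ^+ n * `|x|))).
    apply: sum_le_const => i i_n; rewrite ltnS in i_n.
    rewrite (le_trans (ha _ _))//.
    have -> : C * C' * r ^+ n * `|x| = C * r ^+ i * (C' * r ^+ (n - i) * `|x|).
      by rewrite -{1}(subnKC i_n) exprD; ring.
    by rewrite ler_wpM2l ?hb // mulr_ge0 ?exprn_ge0 ?(ltW r0).
  rewrite exprMn !mulrA ler_wpM2r// ler_wpM2r ?exprn_ge0 ?(ltW r0)// -mulrA mulrC.
  by rewrite ler_wpM2l ?mulr_ge0// -natrX ler_nat ltn_expl.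
Qed.

(** The error splits into that of [T] at [T' w x] and those of [T'], weighted by the
    terms of [T]; on the quarter disc these weights are summable after a factor
    [2 ^- i] has been used to restore the rate.  The radius changes because
    coefficient [n] of the product is a sum of [n + 1 <= 2 ^ n] terms. *)
Lemma expansion_comp_same {E F G : normedModType K} z0 (a : nat -> F -> G)
  (b : nat -> E -> F) C C' r T T' : expansion z0 a C r T -> expansion z0 b C' r T' ->
  expansion z0 (cauchy_prod a b) (4 * (C * C')) (2 * r) (fun w x => T w (T' w x)).
Proof.
move=> aT bT'; have [ga _] := aT; have [gb _] := bT'.
have [[C0 r0 la _] [C0' _ _ _]] := (ga, gb).
split.
  apply: geo_coef_mono (geo_coef_cauchy_prod ga gb) => //.
  by rewrite ler_peMl ?mulr_ge0// ler1n.
move=> w wr2 n x.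
have wr : `|w - z0| * r <= 4^-1.
  apply: le_trans wr2; rewrite mulrCA ler_peMl ?mulr_ge0 ?(ltW r0)//.
  by rewrite ler1n.
set z := w - z0 in wr *; set y := T' w x.
have y_le : `|y| <= 2 * C' * `|x| by apply: expansion_norm bT' wr.
rewrite psum_cauchy_prod//.
have -> : T w y - \sum_(0 <= i < n) z ^+ i *: a i (psum b z (n - i) x) =
    (T w y - psum a z n y) + \sum_(0 <= i < n) z ^+ i *: a i (y - psum b z (n - i) x).
  have -> : \sum_(0 <= i < n) z ^+ i *: a i (y - psum b z (n - i) x) =
      psum a z n y - \sum_(0 <= i < n) z ^+ i *: a i (psum b z (n - i) x).
    by rewrite -sumrB; apply: eq_bigr => i _; rewrite (linfB (la i)) scalerBr.
  by rewrite addrA subrK.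
have -> : 2 * (4 * (C * C')) * `|x| * h n =
    2 * C * (2 * C' * `|x|) * h n + 2 * (C * (2 * C' * `|x|) * h n) by ring.
rewrite (le_trans (ler_normD _ _))// lerD//.
  rewrite (le_trans (expansion_geo_cvg y aT wr n))// ler_wpM2r// ler_wpM2l//.
  by rewrite mulr_ge0.
rewrite (le_trans (ler_norm_sum _ _ _))//.
apply: (@le_trans _ _ (\sum_(0 <= i < n) h i * (C * (2 * C' * `|x|) * h n))); last first.
  rewrite -mulr_suml ler_wpM2r ?mulr_ge0//.
  by rewrite (le_trans (sum_half_le _ _))// expr0 mulr1.
apply: ler_sum_nat => i /andP[_ i_n].
rewrite (le_trans (geo_coef_term _ _ _ ga))//.
have zr0 : 0 <= `|z| * r by rewrite mulr_ge0// ltW.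
rewrite (le_trans (ler_wpM2r _ (expr_le_quarter _ zr0 wr))) ?mulr_ge0//.
have -> : h i * (C * (2 * C' * `|x|) * h n) =
    h i * h i * (C * (2 * C' * `|x| * h (n - i))).
  by rewrite -(h_split (ltnW i_n)); ring.
do 2! rewrite ler_wpM2l ?mulr_ge0//.
exact: expansion_geo_cvg bT' wr _.
Qed.

Lemma expansion_comp {E F G : normedModType K} z0 (a : nat -> F -> G)
  (b : nat -> E -> F) C C' r r' T T' : expansion z0 a C r T -> expansion z0 b C' r' T' ->
  expansion z0 (cauchy_prod a b) (4 * (C * C')) (2 * (r + r')) (fun w x => T w (T' w x)).
Proof.
move=> aT bT'; have [[_ r0 _ _] _] := aT; have [[_ r0' _ _] _] := bT'.
apply: expansion_comp_same.
  by apply: expansion_mono aT; rewrite ?lerDl// ltW.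
by apply: expansion_mono bT'; rewrite ?lerDr// ltW.
Qed.

(** Taylor coefficients at a point [z] near the center: the [i]-th is the sum of
    the series with coefficients ['C(m + i, i) a_(m + i)], and
    ['C(m + i, i) <= 2 ^ (m + i)] costs a factor two in the radius. *)
Lemma expansion_recenter {E : normedModType K} {F : completeNormedModType K}
    (a : nat -> E -> F) C r T z : expansion 0 a C r T -> `|z| * r <= 8^-1 ->
  exists b, expansion z b (3 * C) (2 * r) T.
Proof.
move=> aT zr; have [[C0 r0 la ha] _] := aT.
have r20 : 0 < 2 * r by rewrite mulr_gt0.
pose s i m x := 'C(m + i, i)%:R *: a (m + i)%N x.
have gs i : geo_coef (s i) (C * (2 * r) ^+ i) (2 * r).
  split=> //; first by rewrite mulr_ge0 ?exprn_ge0// ltW.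
    by move=> m; exact: linear_scale.
  move=> m x; rewrite /s normrZ normr_nat.
  have -> : C * (2 * r) ^+ i * (2 * r) ^+ m * `|x| =
      2 ^+ (m + i) * (C * r ^+ (m + i) * `|x|) by rewrite !exprMn !exprD; ring.
  by rewrite ler_pM// -natrX ler_nat binomial_le_pow2.
have [V hV] : exists V : nat -> K -> E -> F, forall i,
    expansion 0 (s i) (C * (2 * r) ^+ i) (2 * r) (V i).
  have ex i := expansion_exists 0 (gs i).
  by have [V hV] := choice ex; exists V.
have z2r : `|z - 0| * (2 * r) <= 4^-1.
  rewrite subr0 mulrCA (le_trans (ler_wpM2l _ zr))//.
  by have -> : 2 * 8^-1 = 4^-1 :> K by field.
pose b i := V i z.
have C30 : C <= 3 * C by rewrite ler_peMl// ler1n.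
exists b; split.
  split=> //; first exact: le_trans C30.
    by move=> i; apply: bounded_linear_lin; exact: expansion_bounded (hV i) z2r.
  move=> i x; rewrite (le_trans (expansion_norm x (hV i) z2r))//.
  rewrite ler_wpM2r// mulrA ler_wpM2r ?exprn_ge0 ?(ltW r20)//.
  by rewrite ler_wpM2r// ler_nat.
move=> w wr n x.
have w0r : `|w - 0| * r <= 4^-1.
  have -> : w - 0 = (w - z) + z by rewrite subr0 subrK.
  rewrite (le_trans (ler_wpM2r (ltW r0) (ler_normD _ _)))// mulrDl.
  have -> : 4^-1 = 8^-1 + 8^-1 :> K by field.
  rewrite lerD// -(@ler_pM2l _ 2)// mulrCA (le_trans wr)//.
  by have -> : 2 * 8^-1 = 4^-1 :> K by field.
set d := w - z in wr *.
have wE : w - 0 = z + d by rewrite subr0 addrC subrK.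
have psE : psum a (w - 0) n x = \sum_(0 <= i < n) d ^+ i *: psum (s i) z (n - i) x.
  rewrite wE; elim: n => [|m ih]; first by rewrite /psum !big_geq.
  rewrite psum_recr ih [RHS]big_nat_recr//= subSnn.
  have -> : psum (s m) z 1 x = a m x.
    by rewrite /psum big_nat1 expr0 scale1r /s binn scale1r.
  rewrite exprDn scaler_suml big_ord_recr/= subnn expr0 mul1r binn mulr1n.
  rewrite -(big_mkord xpredT (fun i => (z ^+ (m - i) * d ^+ i *+ 'C(m, i)) *: a m x)).
  rewrite addrA -big_split; congr (_ + _); apply: eq_big_nat => i /andP[_ im] /=.
  rewrite (subSn (ltnW im)) psum_recr scalerDr; congr (_ + _).
  by rewrite /s subnK ?(ltnW im)// !scalerA -mulr_natr; congr (_ *: _); ring.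
have -> : T w x - psum b d n x = (T w x - psum a (w - 0) n x) +
    \sum_(0 <= i < n) d ^+ i *: (psum (s i) (z - 0) (n - i) x - b i x).
  have -> : \sum_(0 <= i < n) d ^+ i *: (psum (s i) (z - 0) (n - i) x - b i x) =
      psum a (w - 0) n x - psum b d n x.
    by rewrite psE -sumrB; apply: eq_bigr => i _; rewrite scalerBr subr0.
  by rewrite addrA subrK.
have -> : 2 * (3 * C) * `|x| * h n = 2 * C * `|x| * h n + 2 * (2 * C * `|x| * h n) by ring.
rewrite (le_trans (ler_normD _ _))// lerD//; first exact: expansion_geo_cvg aT w0r n.
rewrite (le_trans (ler_norm_sum _ _ _))//.
apply: (@le_trans _ _ (\sum_(0 <= i < n) h i * (2 * C * `|x| * h n))); last first.
  rewrite -mulr_suml ler_wpM2r ?mulr_ge0//.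
  by rewrite (le_trans (sum_half_le _ _))// expr0 mulr1.
apply: ler_sum_nat => i /andP[_ i_n].
rewrite normrZ normrX [`|_ - b i x|]distrC.
rewrite (le_trans (ler_wpM2l _ (expansion_geo_cvg x (hV i) z2r (n - i)%N))) ?exprn_ge0//.
have -> : `|d| ^+ i * (2 * (C * (2 * r) ^+ i) * `|x| * h (n - i)) =
   (`|d| * (2 * r)) ^+ i * (2 * C * `|x| * h (n - i)) by rewrite !exprMn; ring.
rewrite (le_trans (ler_wpM2r _ (expr_le_quarter _ _ wr))) ?mulr_ge0 ?(ltW r0)//.
rewrite -(h_split (ltnW i_n)).
have -> : h i * h i * (2 * C * `|x| * h (n - i)) = h i * (2 * C * `|x| * (h i * h (n - i))) by ring.
exact: lexx.
Qed.

(** The family [w^-1] is a geometric series about any [z != 0]. *)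
Lemma expansion_inv {E : normedModType K} z : z != 0 ->
  exists (a : nat -> E -> E) C r, expansion z a C r (fun w x => w^-1 *: x).
Proof.
move=> z0; have nz : 0 < `|z| by rewrite normr_gt0.
pose t w := - (w - z) / z.
exists (fun i x => ((-1) ^+ i * z ^- i.+1) *: x), `|z|^-1, `|z|^-1; split.
  split; rewrite ?invr_ge0 ?invr_gt0//.
    by move=> i; apply: linear_scale; exact: linear_id.
  move=> i x; rewrite normrZ normrM normrX normrN1 expr1n mul1r normfV normrX.
  by rewrite exprVn -invfM exprS.
move=> w wz n x; set d := w - z in wz *.
have wE : w = z * (1 - t w) by rewrite /t; field.
have tE : t w = - d / z by [].
have t4 : `|t w| <= 4^-1 by rewrite tE normrM normrN normfV.
have zw : `|z| <= 2 * `|w|.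
  have -> : z = w - d by rewrite /d opprB addrC subrK.
  have d2 : `|d| <= 2^-1 * `|z|.
    by rewrite -ler_pdivrMr// (le_trans wz)// quarter_le_half.
  have := ler_normB w d; have -> : w - d = z by rewrite /d opprB addrC subrK.
  move=> zwd; have : `|z| <= `|w| + 2^-1 * `|z| by rewrite (le_trans zwd)// lerD2l.
  rewrite -lerBlDr; have -> : `|z| - 2^-1 * `|z| = 2^-1 * `|z| by field.
  by rewrite ler_pdivrMl.
have nw : 0 < `|w| by rewrite -(@pmulr_rgt0 _ 2)// (lt_le_trans nz).
have w0 : w != 0 by rewrite -normr_gt0.
have -> : psum (fun i x => ((-1) ^+ i * z ^- i.+1) *: x) d n x =
    (w^-1 * (1 - t w ^+ n)) *: x.
  rewrite /psum; under eq_bigr do rewrite scalerA.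
  rewrite -scaler_suml; congr (_ *: _).
  elim: n => [|n ih]; first by rewrite big_geq// expr0 subrr mulr0.
  rewrite big_nat_recr//= ih [t w ^+ n.+1]exprS tE.
  have -> : d ^+ n * ((-1) ^+ n * z ^- n.+1) = (- d / z) ^+ n / z.
    rewrite exprMn [(- d) ^+ n]exprNn exprVn exprS invfM.
    by move: ((-1) ^+ n) (d ^+ n) (z ^- n) => u v s; ring.
  have zE : w = z + d by rewrite /d addrC subrK.
  move: ((- d / z) ^+ n) => u; rewrite zE in w0 *; field.
  by rewrite z0.
rewrite -scalerBl normrZ.
have -> : w^-1 - w^-1 * (1 - t w ^+ n) = w^-1 * t w ^+ n by ring.
rewrite normrM normrX normfV.
have -> : 2 * `|z|^-1 * `|x| * h n = 2 * `|z|^-1 * h n * `|x| by ring.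
rewrite ler_wpM2r// ler_pM ?invr_ge0 ?exprn_ge0//.
  by rewrite ler_pdivlMr// ler_pdivrMl// mulrC.
by rewrite expr_le_half// (le_trans t4) ?quarter_le_half.
Qed.

(** ** Inversion of a series with constant term the identity *)

Section RightInverse.
Context {E : completeNormedModType K}.
Variable a : nat -> E -> E.

(* Row [n] of the table lists the first [n.+1] coefficients. *)
Fixpoint inv_table n : nat -> E -> E :=
  if n is m.+1 then fun j x => if (j <= m)%N then inv_table m j x
    else - \sum_(0 <= i < m.+1) a i.+1 (inv_table m (m - i)%N x)
  else fun _ x => x.

Definition inv_coef n : E -> E := inv_table n n.

Lemma inv_tableE n j x : (j <= n)%N -> inv_table n j x = inv_coef j x.
Proof.
elim: n => [|n ih]; first by rewrite leqn0 => /eqP->.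
by rewrite leq_eqVlt => /orP[/eqP->//|]; rewrite ltnS => jn /=; rewrite jn ih.
Qed.

Lemma inv_coefS n x :
  inv_coef n.+1 x = - \sum_(0 <= i < n.+1) a i.+1 (inv_coef (n - i)%N x).
Proof.
rewrite {1}/inv_coef /= ltnn; congr (- _).
by apply: eq_bigr => i _; rewrite inv_tableE// leq_subr.
Qed.

Hypothesis a0 : a 0%N =1 id.

Lemma cauchy_prod_inv n x :
  cauchy_prod a inv_coef n x = if n is 0%N then x else 0.
Proof.
rewrite /cauchy_prod; case: n => [|n]; first by rewrite big_nat1 a0.
by rewrite big_nat_recl// a0 subn0 inv_coefS addNr.
Qed.

Variables C r : K.
Hypothesis ga : geo_coef a C r.

(** Discrete Gronwall: the convolution [Y n x] of the norms of the coefficients with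
    the powers of [r] grows by at most the factor [r * (1 + C)]. *)
Lemma geo_coef_inv : geo_coef inv_coef 1 (r * (1 + C)).
Proof.
have [C0 r0 la ha] := ga.
have rC : 0 < r * (1 + C) by rewrite mulr_gt0// ltr_pwDl.
split=> //.
  move=> n; have [m] := ubnP n; elim: m n => // m ih [|n] nm; first exact: linear_id.
  apply: (eq_linear _ (fun x => esym (inv_coefS n x))).
  apply: linear_opp; apply: linear_sumf => i _; apply: linear_compf => //.
  by apply: ih; lia.
pose Y n x := \sum_(0 <= i < n.+1) r ^+ i * `|inv_coef (n - i)%N x|.
have Y_ge n x : `|inv_coef n x| <= Y n x.
  rewrite /Y big_nat_recl// subn0 expr0 mul1r lerDl.
  by apply: sumr_ge0 => i _; rewrite mulr_ge0 ?exprn_ge0 ?(ltW r0).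
have Y_next n x : Y n.+1 x <= r * (1 + C) * Y n x.
  rewrite {1}/Y big_nat_recl// subn0 expr0 mul1r.
  have -> : \sum_(0 <= i < n.+1) r ^+ i.+1 * `|inv_coef (n.+1 - i.+1) x| = r * Y n x.
    by rewrite /Y mulr_sumr; apply: eq_bigr => i _; rewrite exprS subSS mulrA.
  rewrite mulrDr mulr1 mulrDl addrC lerD2l inv_coefS normrN.
  rewrite (le_trans (ler_norm_sum _ _ _))// /Y mulr_sumr; apply: ler_sum => i _.
  by rewrite (le_trans (ha _ _))// exprS !mulrA [C * r]mulrC.
move=> n x; rewrite mul1r (le_trans (Y_ge n x))//.
elim: n => [|n ih]; first by rewrite /Y big_nat1 !expr0 !mul1r.
by rewrite (le_trans (Y_next n x))// exprS -[leRHS]mulrA ler_wpM2l// ltW.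
Qed.
End RightInverse.

Lemma expansion_right_inverse {E : completeNormedModType K} (a : nat -> E -> E) C r T :
  expansion 0 a C r T -> a 0%N =1 id ->
  exists b C' r' T', [/\ expansion 0 b C' r' T', b 0%N =1 id, r <= r' &
    forall w x, `|w| * r' <= 8^-1 -> T w (T' w x) = x].
Proof.
move=> aT a0; have [ga _] := aT; have [C0 r0 _ _] := ga.
have [T' bT'] := expansion_exists 0 (geo_coef_inv ga).
have rr : r <= r * (1 + C) by rewrite ler_peMr ?lerDl// ltW.
exists (inv_coef a), 1, (r * (1 + C)), T'; split=> // w x wr.
have eT := expansion_comp_same (expansion_mono (lexx C) rr aT) bT'.
have [CI eI] := expansion_const (@bounded_linear_id K E).
have w4 : `|w - 0| * (2 * (r * (1 + C))) <= 4^-1.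
  rewrite subr0 mulrCA (le_trans (ler_wpM2l _ wr))//.
  by have -> : 2 * 8^-1 = 4^-1 :> K by field.
have r20 : 0 < 2 * (r * (1 + C)) by have [[]] := eT.
apply: (expansion_eq x eT (eI 0 _ r20) _ w4 w4) => i y.
by rewrite cauchy_prod_inv//; case: i.
Qed.

(** A right inverse which itself has a right inverse is two-sided. *)
Lemma expansion_inverse {E : completeNormedModType K} (a : nat -> E -> E) C r T :
  expansion 0 a C r T -> a 0%N =1 id ->
  exists b C' r' T', [/\ expansion 0 b C' r' T', b 0%N =1 id &
    forall w, `|w| * r' <= 8^-1 -> cancel (T w) (T' w) /\ cancel (T' w) (T w)].
Proof.
move=> aT a0; have [b [C1 [r1 [T1 [bT1 b0 rr1 TT1]]]]] := expansion_right_inverse aT a0.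
have [c [C2 [r2 [T2 [cT2 c0 rr2 TT2]]]]] := expansion_right_inverse bT1 b0.
have r12 : 0 <= r2 by have [[_ /ltW]] := cT2.
exists b, C1, r2, T1; split=> //.
  by apply: expansion_mono bT1.
move=> w wr; have wr1 : `|w| * r1 <= 8^-1 by rewrite (le_trans _ wr)// ler_wpM2l.
split=> x; last exact: TT1.
(* The right inverse of [T1 w] is [T w] itself. *)
by rewrite -[X in T w X](TT2 w x wr) TT1// TT2.
Qed.
End Expansions.

(** * From expansions to analyticity *)

Section Analyticity.
Context {K : numFieldType}.
Hypothesis archiK : archimedean K.
Local Notation h n := ((2^-1 : K) ^+ n).

Lemma quarter_ge_eighth : 8^-1 <= 4^-1 :> K.
Proof. by rewrite lef_pV2 ?posrE// ler_nat. Qed.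

Lemma near_scaled_dist (z r : K) : 0 < r -> \forall w \near z, `|w - z| * r <= 8^-1.
Proof.
move=> r0; have e0 : 0 < 8^-1 / r by rewrite divr_gt0.
apply/nbhs_ballP; exists (8^-1 / r) => // w.
by rewrite -ball_normE /= distrC => /ltW; rewrite ler_pdivlMr.
Qed.

Lemma near_neq0 (z : K) : z != 0 -> \forall w \near z, w != 0.
Proof.
move=> z0; have nz : 0 < `|z|^-1 by rewrite invr_gt0 normr_gt0.
apply: filterS (near_scaled_dist z nz) => w; apply: contraTneq => ->.
rewrite sub0r normrN mulfV ?normr_eq0//.
by apply/negP => /le_lt_trans/(_ (_ : 8^-1 < 1)); rewrite ltxx invf_lt1// ltr1n => /(_ isT).
Qed.

Lemma op_series_ext {E F : normedModType K} (a : nat -> E -> F) z T T' :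
  T =1 T' -> op_series a z T -> op_series a z T'.
Proof.
move=> TT aT e e0; have := aT e e0.
by apply: filterS => n H x; rewrite -TT.
Qed.

Lemma geo_coef_bounded {E F : normedModType K} (a : nat -> E -> F) C r i :
  geo_coef a C r -> bounded_linear (a i).
Proof. by move=> [_ _ la ha]; split=> //; exists (C * r ^+ i) => x; exact: ha. Qed.

Lemma expansion_analytic_at {E F : normedModType K} z (a : nat -> E -> F) C r T T' :
  expansion z a C r T -> (\forall w \near z, T w =1 T' w) ->
  exists b : nat -> E -> F, (forall i, bounded_linear (b i)) /\
    \forall w \near z, op_series b (w - z) (T' w).
Proof.
move=> aT TT; have [ga _] := aT; have [_ r0 _ _] := ga.
exists a; split; first by move=> i; exact: geo_coef_bounded ga.
apply: filterS2 (near_scaled_dist z r0) TT => w wr TTw; apply: (op_series_ext TTw).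
by apply: expansion_op_series aT _ => //; exact: le_trans quarter_ge_eighth.
Qed.

Lemma expansion_analytic_on {E : normedModType K} {F : completeNormedModType K}
  (a : nat -> E -> F) C r T T' (V : set K) : expansion 0 a C r T ->
  (forall z, V z -> `|z| * r <= 8^-1) ->
  (forall z, V z -> \forall w \near z, T w =1 T' w) -> analytic_on V T'.
Proof.
move=> aT Vr TT z Vz; have [b bT] := expansion_recenter archiK aT (Vr z Vz).
exact: expansion_analytic_at bT (TT z Vz).
Qed.

Lemma expansion_op_power_series {E F : normedModType K} (a : nat -> E -> F) C r T
  (V : set K) : expansion 0 a C r T -> (forall z, V z -> `|z| * r <= 8^-1) ->
  op_power_series V a T.
Proof.
move=> aT Vr; have [ga _] := aT; split; first by move=> i; exact: geo_coef_bounded ga.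
move=> z Vz; have := expansion_op_series archiK (w := z) aT; rewrite subr0; apply.
by rewrite (le_trans (Vr z Vz))// quarter_ge_eighth.
Qed.

Lemma expansion_ext {E F : normedModType K} z (a : nat -> E -> F) C r T T' :
  (forall w x, T w x = T' w x) -> expansion z a C r T -> expansion z a C r T'.
Proof. by move=> TT [ga aT]; split=> // w wr n x; rewrite -TT; exact: aT. Qed.

Lemma expansion_ext_coef {E F : normedModType K} z (a b : nat -> E -> F) C r T :
  (forall i x, a i x = b i x) -> expansion z a C r T -> expansion z b C r T.
Proof.
move=> ab [[C0 r0 la ha] aT]; split.
  split=> // [i|i x]; last by rewrite -ab.
  by apply: (eq_linear (la i)) => x; exact: ab.
move=> w wr n x; rewrite /psum; under eq_bigr do rewrite -ab.
exact: aT.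
Qed.

Lemma expansion_negpower {E F : normedModType K} z (a : nat -> E -> F) C r T m :
  z != 0 -> expansion z a C r T ->
  exists b C' r', expansion z b C' r' (fun w x => w ^- m *: T w x).
Proof.
move=> z0 aT; elim: m => [|m [b [C' [r' bT]]]].
  by exists a, C, r; apply: expansion_ext aT => w x; rewrite expr0 invr1 scale1r.
have [c [C2 [r2 cI]]] := @expansion_inv K F z z0.
have := expansion_comp cI bT; set cb := cauchy_prod _ _ => e.
exists cb, (4 * (C2 * C')), (2 * (r2 + r')).
by apply: expansion_ext e => w x; rewrite scalerA exprS invfM mulrC.
Qed.

(** Convergence at a single nonzero point of the domain bounds the coefficients. *)
Lemma op_power_series_expansion {E F : normedModType K} (D : set K)
  (L : nat -> E -> F) Lf : open D -> D 0 -> op_power_series D L Lf ->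
  exists C r, expansion 0 L C r Lf.
Proof.
move=> oD D0 [bL sL].
have /nbhs_ballP[e /= e0 eD] : nbhs (0 : K) D by apply: open_nbhs_nbhs.
have inD w : `|w| < e -> D w.
  by move=> we; apply: eD; rewrite -ball_normE /= sub0r normrN.
pose z1 := 2^-1 * e.
have z10 : 0 < z1 by rewrite mulr_gt0.
have z1e : z1 < e by rewrite gtr_pMl// invf_lt1// ltr1n.
have Dz1 : D z1 by apply: inD; rewrite gtr0_norm.
have [n0 _ hn0] := sL z1 Dz1 1 ltr01.
have [C1 C10 hC1] := @bounded_linear_common _ _ _ _ (iota 0 n0)
  (fun i x => z1 ^+ i *: L i x) (fun i _ => bounded_linear_scale _ (bL i)).
pose C := 2 + C1.
have C0 : 0 <= C by rewrite addr_ge0.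
have term n x : `|z1 ^+ n *: L n x| <= C * `|x|.
  have [nn|nn] := ltnP n n0.
    rewrite (le_trans (hC1 n x _)) ?mem_iota//.
    by rewrite ler_wpM2r// lerDr.
  have := hn0 n.+1 (leq_trans nn (leqnSn n)) x; have := hn0 n nn x.
  rewrite big_nat_recr//= !mul1r; set s := \sum_(0 <= i < n) _ => s1 s2.
  have -> : z1 ^+ n *: L n x = (s + z1 ^+ n *: L n x - Lf z1 x) - (s - Lf z1 x).
    by rewrite opprB addrA subrK addrAC subrr add0r.
  rewrite (le_trans (ler_normB _ _))// (le_trans (lerD s2 s1))//.
  by rewrite -mulr2n -mulr_natl ler_wpM2r// lerDl.
have gL : geo_coef L C z1^-1.
  split=> //; [by rewrite invr_gt0|by move=> i; exact: bounded_linear_lin|].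
  move=> i x; rewrite exprVn mulrAC ler_pdivlMr ?exprn_gt0//.
  have := term i x; rewrite normrZ normrX (gtr0_norm z10) mulrC.
  by [].
exists C, z1^-1; split=> // w wr n x.
have wz : `|w| <= 4^-1 * z1.
  by move: wr; rewrite subr0 ler_pdivrMr.
have Dw : D w.
  apply: inD; rewrite (le_lt_trans wz)// (lt_trans _ z1e)//.
  by rewrite gtr_pMl// invf_lt1// ltr1n.
apply/ler_addgt0Pr => e1 e10.
have e20 : 0 < e1 / (`|x| + 1) by rewrite divr_gt0// ltr_wpDl.
have [m0 _ hm0] := sL w Dw _ e20.
have := hm0 (maxn n m0) (leq_maxr _ _) x.
rewrite -/(psum L w _ x) distrC => hm.
have -> : Lf w x - psum L (w - 0) n x = (Lf w x - psum L w (maxn n m0) x) +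
    (psum L (w - 0) (maxn n m0) x - psum L (w - 0) n x).
  by rewrite subr0 addrA subrK.
rewrite (le_trans (ler_normD _ _))// addrC lerD//.
  apply: psum_dist gL _ _; last exact: leq_maxl.
  by rewrite (le_trans wr)// quarter_le_half.
rewrite (le_trans hm)// mulrAC ler_pdivrMr ?ltr_wpDl// ler_wpM2l ?ltW//.
by rewrite ltrDl.
Qed.


Lemma has_op_derivative_sum {E F : normedModType K} (I : eqType) (r : seq I)
  (T : I -> K -> E -> F) z (D : I -> E -> F) :
  (forall i, i \in r -> has_op_derivative (T i) z (D i)) ->
  has_op_derivative (fun w x => \sum_(i <- r) T i w x) z
    (fun x => \sum_(i <- r) D i x).
Proof.
elim: r => [|i r ih] H e e0.
  by apply: nearW => w x; rewrite !big_nil !subr0 scaler0 normr0 mulr_ge0// ltW.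
have e20 : 0 < 2^-1 * e by rewrite mulr_gt0.
have {}ih := ih (fun j jr => H j (@mem_behead _ (i :: r) j jr)).
apply: filterS2 (H i (mem_head _ _) _ e20) (ih _ e20) => w h1 h2 x; rewrite !big_cons.
set u := T i (z + w) x in h1 *; set v := T i z x in h1 *.
move: (h1 x) (h2 x); rewrite -/u -/v => {}h1 {}h2.
rewrite opprD addrACA scalerDr opprD addrACA (le_trans (ler_normD _ _))//.
by rewrite (le_trans (lerD h1 h2))// -mulrDl; have -> : 2^-1 * e + 2^-1 * e = e by field.
Qed.

Lemma has_op_derivative_scale {E F : normedModType K} (f : K -> K) (A : E -> F) (z d : K) :
  bounded_linear A -> (fun w => w^-1 * (f (z + w) - f z)) @ 0^' --> d ->
  has_op_derivative (fun w x => f w *: A x) z (fun x => d *: A x).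
Proof.
move=> bA fd e e0; have [C C0 hA] := bounded_linearP bA.
have e20 : 0 < e / (C + 1) by rewrite divr_gt0// ltr_wpDl.
move/cvgrPdist_le/(_ _ e20): fd; apply: filterS => w hw x.
rewrite -scalerBl scalerA -scalerBl normrZ distrC.
rewrite (le_trans (ler_pM _ _ hw (hA x)))// mulrA ler_wpM2r//.
rewrite mulrAC ler_pdivrMr ?ltr_wpDl// ler_wpM2l ?ltW//.
by rewrite ltrDl.
Qed.

(** Product rule, starting from the difference quotient of the inverse. *)
Lemma derivative_negpower (z : K) m : z != 0 ->
  (fun w => w^-1 * ((z + w) ^- m - z ^- m)) @ 0^' --> - m%:R * z ^- m.+1.
Proof.
move=> z0.
have zw : (fun w => z + w) @ (0 : K)^' --> z.
  rewrite -[X in _ --> X]addr0; apply: cvgD; first exact: cvg_cst.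
  exact: nbhs_dnbhs.
have nz : \forall w \near (0 : K)^', z + w != 0.
  have := near_neq0 z0; exact: zw.
have izw : (fun w => (z + w)^-1) @ (0 : K)^' --> z^-1 by apply: cvgV.
elim: m => [|m ih].
  rewrite mulr0n oppr0 mul0r.
  under eq_fun do rewrite !expr0 subrr mulr0.
  exact: cvg_cst.
have -> : - m.+1%:R * z ^- m.+2 =
    z^-1 * (- m%:R * z ^- m.+1) + z ^- m * (- (z^-1 * z^-1)).
  by rewrite -natr1 !exprS !invfM; move: (z ^- m) => u; ring.
apply: (@cvg_trans _ ((fun w => (z + w)^-1 * (w^-1 * ((z + w) ^- m - z ^- m)) +
    z ^- m * (- ((z + w)^-1 * z^-1))) @ 0^')); last first.
  apply: cvgD; first exact: cvgM.
  apply: cvgM; first exact: cvg_cst.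
  apply: cvgN; apply: cvgM => //; exact: cvg_cst.
apply: near_eq_cvg; near=> w.
have w0 : w != 0 by near: w; exact: nbhs_dnbhs_neq.
have zw0 : z + w != 0 by near: w.
rewrite !exprS !invfM.
move: ((z + w) ^- m) (z ^- m) => u v; field.
by rewrite w0 z0 zw0.
Unshelve. all: by end_near. Qed.

End Analyticity.

(** * The diagonal family *)

Section ChainValues.
Context {K : numFieldType} {F : normedModType K} {W V : nat -> set F}.
Hypothesis ch : chain W V.
Hypothesis sV : forall i, subspace (V i).
Hypothesis sW : forall i, subspace (W i).

Lemma sum_pick (m l : nat) (G : nat -> F) : (1 <= l < m)%N ->
  \sum_(1 <= i < m) (if l == i then G i else 0) = G l.
Proof.
move=> lm; rewrite (bigD1_seq l) ?mem_index_iota ?iota_uniq//= eqxx.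
by rewrite big1 ?addr0// => i il; rewrite eq_sym (negbTE il).
Qed.

Lemma chain_unique_all n (v : nat -> F) w x :
  (forall i, (1 <= i <= n)%N -> V i (v i)) -> W n w ->
  \sum_(1 <= i < n.+1) v i + w = x ->
  forall i, (1 <= i <= n)%N -> v i = chain_part W V i x.
Proof.
move=> Vv Ww xE; have [|||||part _] := @chain_unique _ _ _ _ ch n _ _ v w x => //.
Qed.

Lemma chain_part_V l j y : (1 <= l)%N -> (1 <= j)%N -> V j y ->
  chain_part W V l y = if l == j then y else 0.
Proof.
move=> l1 j1 Vy; pose n := maxn l j.
rewrite -(@chain_unique_all n (fun i => if j == i then y else 0) 0).
- by rewrite eq_sym.
- by move=> i _; case: eqVneq => [<-//|_]; case: (sV i).
- by case: (sW n).
- by rewrite (@sum_pick _ _ (fun=> y)) ?addr0//; rewrite j1 ltnS leq_maxr.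
- by rewrite l1 leq_maxl.
Qed.

Lemma chain_part_W n l x : (1 <= l <= n)%N -> W n x -> chain_part W V l x = 0.
Proof.
move=> ln Wx; rewrite -(@chain_unique_all n (fun=> 0) x)//; last by rewrite big1 ?add0r.
by move=> i _; case: (sV i).
Qed.

Lemma chain_part_sum n x : sum_spaces V 1 n.+1 x ->
  \sum_(1 <= i < n.+1) chain_part W V i x = x.
Proof.
move=> /sum_spacesP[v [Vv xE]]; rewrite [RHS]xE; apply: eq_big_nat => i i1n.
rewrite -(@chain_unique_all n v 0)//; last by rewrite addr0.
by case: (sW n).
Qed.

Lemma chain_part_sum_in n x :
  sum_spaces V 1 n.+1 (\sum_(1 <= i < n.+1) chain_part W V i x).
Proof.
apply/sum_spacesP; exists (fun i => chain_part W V i x); split=> // i /andP[i1 _].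
exact: chain_part_in.
Qed.

End ChainValues.

Section Diagonal.
Context {K : numFieldType} {B Bbar : completeNormedModType K}.
Hypothesis archiK : archimedean K.
Variables (L : nat -> B -> Bbar) (N Nc : nat -> set B) (Rg Rgc : nat -> set Bbar).
Variables (Sbar S : nat -> B -> Bbar) (M E : nat -> nat -> B -> B).
Hypothesis hrec : recursion L N Nc Rg Rgc Sbar S M E.
Hypothesis linL : forall i, linear (L i).
Variable k : nat.
Hypothesis hstab : stabilizes_at Rg k.

Local Notation p := (chain_part N Nc).
Local Notation q := (chain_part Rgc Rg).
Local Notation T := (Tinv Nc Rg Rgc S).
Local Notation Del := (Delta N Nc S k).
Local Notation DelInv := (DeltaInv Nc Rg Rgc S k).
Let chR := chain_ranges hrec.
Let chN := chain_kernels hrec.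
Let sR := subspace_Rg hrec linL.
Let sRc := subspace_Rgc hrec.
Let sN := subspace_N hrec linL.
Let sNc := subspace_Nc hrec.
Let linS i (i0 : (0 < i)%N) : linear (S i) := linear_S hrec linL i0.
Let linT i (i0 : (0 < i)%N) : linear (T i) := linear_T hrec linL i0.

Lemma linear_p i : linear (p i).
Proof.
case: i => [|i]; first exact: linear_cst0.
have [//|//|+ _] := @chain_linear _ _ _ _ chN i.+1.
by apply; rewrite leqnn.
Qed.
Let linp := linear_p.
Let linq := linear_part hrec linL.

Lemma projN_part i x : (1 <= i < k.+2)%N -> projN N Nc k i x = p i x.
Proof. by move=> ik; rewrite /projN (dsum_proj_chain chN). Qed.

Lemma Sinv_projR i y : (1 <= i < k.+2)%N -> Sinv Nc S i (projR Rg Rgc k i y) = T i y.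
Proof. by move=> ik; rewrite /projR (projR_part hrec linL). Qed.

Lemma DeltaE z x : Del z x = \sum_(1 <= i < k.+2) z ^+ i.-1 *: S i (p i x).
Proof. by apply: eq_big_nat => i ik; rewrite projN_part. Qed.

Lemma DeltaInvE z y : DelInv z y = \sum_(1 <= i < k.+2) z ^- i.-1 *: T i y.
Proof. by apply: eq_big_nat => i ik; rewrite Sinv_projR. Qed.

Lemma Nc_T i y : (1 <= i)%N -> Nc i (T i y).
Proof. by move=> i1; have [] := TinvP hrec i1 (linS i1) y. Qed.

Lemma S_T i y : (1 <= i)%N -> S i (T i y) = q i y.
Proof. by move=> i1; have [] := TinvP hrec i1 (linS i1) y. Qed.

Lemma Nc_p i x : (1 <= i)%N -> Nc i (p i x).
Proof. exact: (chain_part_in chN). Qed.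

Lemma Rg_S i v : (1 <= i)%N -> Nc i v -> Rg i (S i v).
Proof.
case: i => // i _ Nv; apply: (S_in_range hrec); exact: (chain_subV chN).
Qed.

Lemma q_S l i v : (1 <= l)%N -> (1 <= i)%N -> Nc i v ->
  q l (S i v) = if l == i then S i v else 0.
Proof. by move=> l1 i1 Nv; apply: (chain_part_V chR) => //; exact: Rg_S. Qed.

Lemma p_T l i y : (1 <= l)%N -> (1 <= i)%N -> p l (T i y) = if l == i then T i y else 0.
Proof. by move=> l1 i1; apply: (chain_part_V chN) => //; exact: Nc_T. Qed.

Lemma T_S l i v : (1 <= l)%N -> (1 <= i)%N -> Nc i v ->
  T l (S i v) = if l == i then v else 0.
Proof.
move=> l1 i1 Nv; apply/esym/(Tinv_unique hrec l1 (linS l1)); rewrite ?q_S//.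
  by case: eqVneq => [->//|_]; case: (sNc l).
by case: eqVneq => [->//|_]; rewrite (linf0 (linS l1)).
Qed.

Lemma p_DeltaInv l z y : (1 <= l < k.+2)%N -> p l (DelInv z y) = z ^- l.-1 *: T l y.
Proof.
move=> lk; have l1 : (1 <= l)%N by case/andP: lk.
rewrite DeltaInvE (linf_sum (linp l)) -(sum_pick (fun i => z ^- i.-1 *: T i y) lk).
apply: eq_big_nat => i /andP[i1 _]; rewrite (linfZ (linp l)) p_T//.
by case: ifP => _ //; rewrite scaler0.
Qed.

Lemma T_Delta l z x : (1 <= l < k.+2)%N -> T l (Del z x) = z ^+ l.-1 *: p l x.
Proof.
move=> lk; have l1 : (1 <= l)%N by case/andP: lk.
rewrite DeltaE (linf_sum (linT l1)) -(sum_pick (fun i => z ^+ i.-1 *: p i x) lk).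
apply: eq_big_nat => i /andP[i1 _]; rewrite (linfZ (linT l1)) T_S//; last exact: Nc_p.
by case: ifP => _ //; rewrite scaler0.
Qed.

Lemma q_Delta l z x : (1 <= l < k.+2)%N -> q l (Del z x) = z ^+ l.-1 *: S l (p l x).
Proof.
move=> lk; have l1 : (1 <= l)%N by case/andP: lk.
rewrite DeltaE (linf_sum (linq l)) -(sum_pick (fun i => z ^+ i.-1 *: S i (p i x)) lk).
apply: eq_big_nat => i /andP[i1 _]; rewrite (linfZ (linq l)) q_S//; last exact: Nc_p.
by case: ifP => _ //; rewrite scaler0.
Qed.

Definition sum_p x := \sum_(1 <= i < k.+2) p i x.
Definition sum_q y := \sum_(1 <= i < k.+2) q i y.

Lemma sum_projN x : \sum_(1 <= i < k.+2) projN N Nc k i x = sum_p x.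
Proof. by apply: eq_big_nat => i ik; rewrite projN_part. Qed.

Lemma sum_projR y : \sum_(1 <= i < k.+2) projR Rg Rgc k i y = sum_q y.
Proof. by apply: eq_big_nat => i ik; rewrite /projR (projR_part hrec linL). Qed.

Lemma Delta_DeltaInv z y : z != 0 -> Del z (DelInv z y) = sum_q y.
Proof.
move=> z0; rewrite DeltaE; apply: eq_big_nat => i ik.
have i1 : (1 <= i)%N by case/andP: ik.
rewrite p_DeltaInv// (linfZ (linS i1)) S_T// scalerA mulfV ?scale1r//.
by rewrite expf_neq0.
Qed.

Lemma DeltaInv_Delta z x : z != 0 -> DelInv z (Del z x) = sum_p x.
Proof.
move=> z0; rewrite DeltaInvE; apply: eq_big_nat => i ik.
by rewrite T_Delta// scalerA mulVf ?scale1r// expf_neq0.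
Qed.

Lemma sum_q_Delta z x : sum_q (Del z x) = Del z x.
Proof. by rewrite /sum_q DeltaE -DeltaE; rewrite [RHS]DeltaE; apply: eq_big_nat => i ik; rewrite q_Delta. Qed.

Lemma sum_p_DeltaInv z y : sum_p (DelInv z y) = DelInv z y.
Proof. by rewrite [RHS]DeltaInvE; apply: eq_big_nat => i ik; rewrite p_DeltaInv. Qed.


Lemma linear_DeltaInv z : linear (DelInv z).
Proof.
apply: (eq_linear _ (fun x => esym (DeltaInvE z x))).
apply: linear_sumf => i; rewrite mem_index_iota => /andP[i1 _].
by apply: linear_scale; exact: linT.
Qed.

Lemma sum_p_id x : sum_spaces Nc 1 k.+2 x -> sum_p x = x.
Proof. exact: (chain_part_sum chN). Qed.
Lemma sum_p_in x : sum_spaces Nc 1 k.+2 (sum_p x).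
Proof. exact: (chain_part_sum_in chN). Qed.
Lemma sum_q_id y : sum_spaces Rg 1 k.+2 y -> sum_q y = y.
Proof. exact: (chain_part_sum chR). Qed.
Lemma sum_q_in y : sum_spaces Rg 1 k.+2 (sum_q y).
Proof. exact: (chain_part_sum_in chR). Qed.

Lemma Delta_eq0 z x : z != 0 -> Del z x = 0 <-> N k.+1 x.
Proof.
move=> z0; split=> [Dx|Nx].
  have sx : sum_p x = 0 by rewrite -(DeltaInv_Delta x z0) Dx (linf0 (linear_DeltaInv z)).
  rewrite -(chain_sum chN k.+1 x) -/(sum_p x) sx add0r; exact: chain_rest_in chN _ _.
rewrite DeltaE big_nat big1// => i /andP[i1 ik].
by rewrite (chain_part_W chN _ _ _ Nx) ?i1// linf0 ?scaler0//; exact: linS.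
Qed.

Lemma range_Delta z : z != 0 -> range (Del z) = sum_spaces Rg 1 k.+2.
Proof.
move=> z0; apply/seteqP; split=> [y [x _ <-]|y Ry].
  by rewrite -sum_q_Delta; exact: sum_q_in.
by exists (DelInv z y) => //; rewrite Delta_DeltaInv// sum_q_id.
Qed.

(** The coefficients of [psi * Delta] are those of [L * phi]: [psi_i] maps
    [S_j (p j x)] to [S_(i+j) (p j x)], and since [S_(n+1)] vanishes on [N_(n+1)] the
    parts [p 1 x], ..., [p n.+1 x] are all that it sees of [x]. *)
Lemma psi_Delta_coef n x :
  cauchy_prod (psi_coef Nc Rg Rgc S k) (fun j x => S j.+1 (p j.+1 x)) n x = S n.+1 x.
Proof.
have psiS i j v : Nc j.+1 v ->
    psi_coef Nc Rg Rgc S k i (S j.+1 v) = S (i + j.+1)%N v.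
  case: i => [//|i] Nv; rewrite /psi_coef.
  have [jk|kj] := ltnP j k.+1; last first.
    have -> : v = 0 by apply: (Nc_stab hrec hstab) Nv; rewrite ltnS.
    have S0 m : S m.+1 0 = 0 by rewrite (linf0 (linS (ltn0Sn m))).
    rewrite S0 addSn S0 big_nat big1// => l /andP[l1 lk].
    by rewrite Sinv_projR ?l1// (linf0 (linT l1)) addSn S0.
  rewrite -(@sum_pick _ _ k.+2 j.+1 (fun l => S (i.+1 + l)%N v)); last by rewrite ltnS.
  apply: eq_big_nat => l /andP[l1 lk]; rewrite Sinv_projR ?l1// T_S// eq_sym.
  by case: ifP => // _; rewrite addSn (linf0 (linS (ltn0Sn _))).
rewrite /cauchy_prod big_nat_rev /= (eq_big_nat _ _ (F2 := fun i => S n.+1 (p i.+1 x))).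
  rewrite -(linf_sum (linS (ltn0Sn n))).
  rewrite -{2}(chain_sum chN n.+1 x) (linfD (linS (ltn0Sn n))) big_add1 /=.
  rewrite (@S_kernel _ _ _ _ _ _ _ _ _ _ _ _ hrec n.+1 n.+1 (chain_rest N Nc n.+1 x)) ?addr0// ?leqnn//.
  exact: chain_rest_in chN _ _.
move=> i /andP[_ i_n]; rewrite ltnS in i_n.
rewrite add0n subSS; have -> : (n - (n - i) = i)%N by rewrite subKn.
by rewrite psiS ?addnS ?subnK//; exact: Nc_p.
Qed.

Lemma exists_Nc_neq0 : exists2 v, Nc k.+1 v & S k.+1 v <> 0.
Proof.
apply: contrapT => nv; apply: hstab.1; apply/seteqP; split=> [y Ry|y ->]; last first.
  by case: (sR k.+1).
have [v Nv vy] := S_Nc_surj hrec (ltn0Sn k) (linS (ltn0Sn k)) Ry.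
by apply: contrapT => y0; apply: nv; exists v; rewrite ?vy.
Qed.

Lemma S_image_Nc l : (1 <= l)%N -> S l @` Nc l = Rg l.
Proof.
move=> l1; apply/seteqP; split=> [_ [v Nv <-]|y /(S_Nc_surj hrec l1 (linS l1))[v Nv <-]].
  exact: Rg_S.
by exists v.
Qed.

Lemma S_image_N l m : (1 <= l)%N -> (l <= m)%N || (k.+1 <= m)%N -> S l @` N m = [set 0].
Proof.
move=> l1 lm; apply/seteqP; split=> [_ [v Nv <-]|_ ->].
  have [le_lm|lt_ml] := leqP l m; first by apply: (S_kernel hrec _ Nv); rewrite l1.
  have km : (k.+1 <= m)%N by move: lm; rewrite leqNgt lt_ml.
  apply: (S_kernel hrec (m := l)); first by rewrite l1 leqnn.
  by rewrite (N_stab hrec hstab) -?(N_stab hrec hstab km)// (leq_trans km)// ltnW.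
by exists 0; [case: (sN m)|exact: linf0 (linS l1)].
Qed.

End Diagonal.

(** * The transforming families *)

Section Families.
Context {K : numFieldType} {B Bbar : completeNormedModType K}.
Hypothesis archiK : archimedean K.
Variables (D : set K) (L : nat -> B -> Bbar) (Lf : K -> B -> Bbar).
Hypothesis oD : open D.
Hypothesis D0 : D 0.
Hypothesis hL : op_power_series D L Lf.
Variables (N Nc : nat -> set B) (Rg Rgc : nat -> set Bbar).
Variables (Sbar S : nat -> B -> Bbar) (M E : nat -> nat -> B -> B).
Hypothesis hrec : recursion L N Nc Rg Rgc Sbar S M E.
Variable k : nat.
Hypothesis hstab : stabilizes_at Rg k.
Hypothesis clNc : forall i, (1 <= i <= k.+1)%N -> closed (Nc i).
Hypothesis clN : closed (N k.+1).
Hypothesis clR : forall i, (1 <= i <= k.+1)%N -> closed (Rg i).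
Hypothesis clRc : closed (Rgc k.+1).

Local Notation p := (chain_part N Nc).
Local Notation q := (chain_part Rgc Rg).
Local Notation T := (Tinv Nc Rg Rgc S).
Local Notation Del := (Delta N Nc S k).
Local Notation DelInv := (DeltaInv Nc Rg Rgc S k).
Local Notation sum_p := (sum_p N Nc k).
Local Notation sum_q := (sum_q Rg Rgc k).
Local Notation Phi := (fun i => M k.+1 (k.+1 + i)%N).
Local Notation Psi := (psi_coef Nc Rg Rgc S k).

Let bL : forall i, bounded_linear (L i) := hL.1.
Let linL i : linear (L i) := bounded_linear_lin (bL i).
Let bS i (i0 : (0 < i)%N) : bounded_linear (S i) :=
  bounded_S archiK hrec bL hstab clNc clR clRc i0.
Let bT i (i0 : (0 < i)%N) : bounded_linear (T i) :=
  bounded_T archiK hrec bL hstab clNc clR clRc i0.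
Let bp i (ik : (1 <= i < k.+2)%N) : bounded_linear (p i) :=
  bounded_p archiK hrec bL clNc clN ik.
Let bq i : bounded_linear (q i) := bounded_q archiK hrec bL hstab clR clRc i.

Lemma geo_coef_finite (F G : normedModType K) (a : nat -> F -> G) m :
  (forall i, (i < m)%N -> bounded_linear (a i)) ->
  (forall i x, (m <= i)%N -> a i x = 0) -> exists C, geo_coef a C 1.
Proof.
move=> ba a0; have [C C0 hC] := @bounded_linear_common _ _ _ _ (iota 0 m) a
  (fun i => ltac:(rewrite mem_iota; exact: ba)).
exists C; split=> // [i|i x].
  have [im|mi] := ltnP i m; first exact: bounded_linear_lin (ba i im).
  by apply: (eq_linear linear_cst0) => x; rewrite a0.
have [im|mi] := ltnP i m; last by rewrite a0// normr0 !mulr_ge0 ?exprn_ge0.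
by rewrite expr1n mulr1 hC// mem_iota.
Qed.

Lemma geo_coef_Phi : exists C r, geo_coef Phi C r.
Proof.
have [CL [rL [[CL0 rL0 _ hLx] _]]] := op_power_series_expansion oD D0 hL.
have [|C [r [C0 r0 hC]]] := M_growth archiK hrec bL hstab clNc clR clRc.
  by exists CL, rL.
by exists C, r; split=> // i; exact: (linear_M hrec linL).
Qed.

Lemma Phi0 : Phi 0%N =1 id.
Proof. by move=> x /=; rewrite addn0 (M_diag hrec). Qed.

Lemma geo_coef_Psi C r : geo_coef (fun i => S i.+1) C r ->
  exists C' r', geo_coef Psi C' r'.
Proof.
move=> [C0 r0 _ hS].
have [CT CT0 hT] := @bounded_linear_common _ _ _ _ (index_iota 1 k.+2) T
  (fun i => ltac:(rewrite mem_index_iota => /andP[i0 _]; exact: bT)).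
pose rho := r + 1.
have rho1 : 1 <= rho by rewrite lerDr ltW.
have rho0 : 0 <= rho by rewrite (le_trans _ rho1).
exists (1 + k.+1%:R * (C * rho ^+ k * CT)), rho; split.
- by rewrite addr_ge0// !mulr_ge0// exprn_ge0.
- by rewrite (lt_le_trans ltr01).
- case=> [|i]; first exact: linear_id.
  apply: linear_sumf => j; rewrite mem_index_iota => jk.
  apply: (eq_linear (f := fun y => S (i.+1 + j)%N (T j y))) => [|y].
    by apply: linear_compf; apply: bounded_linear_lin; [exact: bS|apply: bT; case/andP: jk].
  by rewrite (Sinv_projR hrec linL).
- case=> [|i] y.
    rewrite /psi_coef mulr1 ler_peMl// lerDl !mulr_ge0// exprn_ge0//.
  rewrite /psi_coef (le_trans (ler_norm_sum _ _ _))//.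
  rewrite !mulrDl ler_wpDl ?mulr_ge0 ?exprn_ge0// -!mulrA big_add1 /=.
  apply: sum_le_const => j jk; rewrite (Sinv_projR hrec linL)//.
  rewrite addnS (le_trans (hS _ _))// -mulrA ler_wpM2l//.
  have -> : rho ^+ k * (CT * (rho ^+ i.+1 * `|y|)) = rho ^+ (k + i.+1) * (CT * `|y|).
    by rewrite exprD; ring.
  rewrite ler_pM ?exprn_ge0 ?(ltW r0)//; last by apply: hT; rewrite mem_index_iota.
  apply: (@le_trans _ _ (rho ^+ (i.+1 + j))).
    by rewrite lerXn2r ?nnegrE ?(ltW r0)// lerDl.
  by rewrite ler_weXn2l// addnC leq_add2r -ltnS.
Qed.

Lemma geo_coef_diag : exists C, geo_coef (fun j x => S j.+1 (p j.+1 x)) C 1.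
Proof.
apply: (geo_coef_finite (m := k.+1)) => [i ik|i x ki].
  by apply: bounded_linear_comp; [exact: bS|exact: bp].
have Np : Nc i.+1 (p i.+1 x) by apply: (Nc_p hrec).
by rewrite (Nc_stab hrec hstab _ Np)// linf0//; exact: bounded_linear_lin (bS _).
Qed.

(** The coefficients of the polynomial [z^k Delta^{-1}(z)]. *)
Definition dinv_coef j y := if (j <= k)%N then T (k.+1 - j)%N y else 0.

Lemma geo_coef_dinv : exists C, geo_coef dinv_coef C 1.
Proof.
apply: (geo_coef_finite (m := k.+1)) => [i ik|i x ki].
  apply: (bounded_linear_ext (f := T (k.+1 - i)%N)) => [|y].
    by apply: bT; rewrite subn_gt0.
  by rewrite /dinv_coef -ltnS ik.
by rewrite /dinv_coef leqNgt ki.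
Qed.

Lemma psum_dinv z y : z != 0 -> psum dinv_coef z k.+1 y = z ^+ k *: DelInv z y.
Proof.
move=> z0; rewrite (DeltaInvE hrec linL) big_add1 /= scaler_sumr /psum.
rewrite big_nat_rev /=; apply: eq_big_nat => i /andP[_ ik].
rewrite add0n subSS /dinv_coef leq_subr scalerA.
have -> : z ^+ k = z ^+ (k - i) * z ^+ i by rewrite -exprD subnK.
rewrite mulfK ?expf_neq0//.
by congr (_ *: T _ _); rewrite subSn ?subKn// leq_subr.
Qed.

Lemma expansion_center (F G : normedModType K) z (a : nat -> F -> G) C r W x :
  expansion z a C r W -> W z x = a 0%N x.
Proof.
move=> aW; have [[C0 r0 _ _] _] := aW.
apply: (geo_cvg_unique archiK _ _ (expansion_geo_cvg x aW _) (C' := `|a 0%N x|));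
  rewrite ?mulr_ge0// subrr ?normr0 ?mul0r ?invr_ge0//.
move=> [|n]; first by rewrite /psum big_geq// subr0 expr0 mulr1.
rewrite /psum big_ltn// big1_seq => [|[|i]].
- by rewrite addr0 expr0 scale1r subrr normr0 mulr_ge0// half_ge0.
- by rewrite mem_index_iota.
- by rewrite exprS mul0r scale0r.
Qed.

(** The families come with their inverses, so that analyticity of products with
    [phi^{-1}] and [psi^{-1}] can be stated without choosing inverses pointwise. *)
Record normal_form (U : set K) (phi phi' : K -> B -> B) (psi psi' : K -> Bbar -> Bbar) :
    Prop := {
  nf_open : open U;
  nf_0 : U 0;
  nf_sub : U `<=` D;
  nf_phi : op_power_series U Phi phi;
  nf_psi : op_power_series U Psi psi;
  nf_Lphi : op_power_series U (fun i => S i.+1) (fun z x => Lf z (phi z x));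
  nf_phiK : forall z, U z -> cancel (phi z) (phi' z) /\ cancel (phi' z) (phi z);
  nf_psiK : forall z, U z -> cancel (psi z) (psi' z) /\ cancel (psi' z) (psi z);
  nf_bounded : forall z, U z -> [/\ bounded_linear (phi z), bounded_linear (phi' z),
    bounded_linear (psi z) & bounded_linear (psi' z)];
  nf_analytic : [/\ analytic_on U phi, analytic_on U psi,
    analytic_on U (fun z x => Lf z (phi z x)),
    analytic_on U (fun z x => phi z (sum_p (phi' z x)))
    & analytic_on U (fun z y => psi z (sum_q (psi' z y)))];
  nf_center : [/\ phi 0 =1 id, phi' 0 =1 id, psi 0 =1 id & psi' 0 =1 id];
  nf_diag : forall z x, U z -> Lf z (phi z x) = psi z (Del z x);
  nf_inv_analytic : analytic_on (U `\ 0) (fun z y => phi z (DelInv z (psi' z y)));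
  nf_inv_pole : pole_of_order k (fun z y => phi z (DelInv z (psi' z y))) }.

Lemma le_sum_seq (s : seq K) r : (forall t, t \in s -> 0 <= t) -> r \in s ->
  r <= \sum_(t <- s) t.
Proof.
move=> s0 rs; rewrite (big_rem r)//= lerDl big_seq sumr_ge0// => t ts.
exact/s0/(mem_rem ts).
Qed.

Lemma common_disc (s : seq K) : (forall t, t \in s -> 0 < t) ->
  exists U : set K, [/\ open U, U 0, U `<=` D &
    forall r z, r \in s -> U z -> `|z| * r <= 8^-1].
Proof.
move=> s0; have /nbhs_ballP[e /= e0 eD] : nbhs (0 : K) D by apply: open_nbhs_nbhs.
pose Q := \sum_(t <- s) t.
have Q0 : 0 <= Q by rewrite /Q big_seq sumr_ge0// => t /s0/ltW.
pose d := (8 * Q + e^-1)^-1.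
have ei : 0 < e^-1 by rewrite invr_gt0.
have d0 : 0 < d by rewrite invr_gt0 ltr_wpDl// mulr_ge0.
have de : d <= e by rewrite -[e]invrK lef_pV2 ?posrE ?lerDr ?mulr_ge0// ltr_wpDl ?mulr_ge0.
exists (ball (0 : K) d); split.
- exact: ball_open.
- exact: ballxx.
- by apply: subset_trans eD; exact: le_ball.
- move=> r z rs; rewrite -ball_normE /= sub0r normrN => zd.
  have rQ : r <= Q by apply: le_sum_seq rs => t /s0/ltW.
  have r0 := s0 r rs.
  rewrite (le_trans (ler_pM _ (ltW r0) (ltW zd) rQ))// /d mulrC.
  rewrite ler_pdivrMr ?ltr_wpDl ?mulr_ge0// mulrDr mulrA mulVf ?mul1r// lerDl.
  by rewrite mulr_ge0 ?invr_ge0// ltW.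
Qed.

(** Every family in question is a power series at [0], obtained from [phi] and [psi]
    by inversion and composition; on a disc that suits all of them at once they can
    be recentered at each point. *)
Lemma normal_form_exists : exists U phi phi' psi psi', normal_form U phi phi' psi psi'.
Proof.
have [CL [rL eL]] := op_power_series_expansion oD D0 hL.
have [Cf [rf gPhi]] := geo_coef_Phi.
have [phi ephi] := expansion_exists archiK 0 gPhi.
have [phic [Cf' [rf' [phi' [ephi' phic0 phiK]]]]] := expansion_inverse archiK ephi Phi0.
have [CS [rS eS]] : exists C r, expansion 0 (fun i => S i.+1) C r (fun z x => Lf z (phi z x)).
  do 2! eexists; apply: expansion_ext_coef (expansion_comp eL ephi) => i x.
  exact: (sum_L_phi hrec bL hstab).
have [Cp [rp gPsi]] := geo_coef_Psi eS.1.
have [psi epsi] := expansion_exists archiK 0 gPsi.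
have [psic [Cp' [rp' [psi' [epsi' psic0 psiK]]]]] :=
  expansion_inverse archiK epsi (fun y => erefl).
have [Cd gd] := geo_coef_diag.
have eD : expansion 0 (fun j x => S j.+1 (p j.+1 x)) Cd 1 Del.
  have d0 i x : (k.+1 <= i)%N -> S i.+1 (p i.+1 x) = 0.
    move=> ki; have Np : Nc i.+1 (p i.+1 x) by apply: (Nc_p hrec).
    by rewrite (Nc_stab hrec hstab _ Np)// linf0//; exact: bounded_linear_lin (bS _).
  apply: expansion_ext (expansion_finite gd d0) => z x.
  by rewrite (DeltaE hrec linL) big_add1.
have [CpD [rpD epD]] : exists C r, expansion 0 (fun i => S i.+1) C r
    (fun z x => psi z (Del z x)).
  do 2! eexists; apply: expansion_ext_coef (expansion_comp epsi eD) => i x.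
  exact: (psi_Delta_coef hrec linL hstab).
have bsump : bounded_linear sum_p.
  by apply: bounded_linear_sum => i; rewrite mem_index_iota; exact: bp.
have bsumq : bounded_linear sum_q by apply: bounded_linear_sum => i _; exact: bq.
have [C1 e1] := expansion_const bsump; have [C2 e2] := expansion_const bsumq.
have eG1 := expansion_comp ephi (expansion_comp (e1 0 1 ltr01) ephi').
have eG2 := expansion_comp epsi (expansion_comp (e2 0 1 ltr01) epsi').
have [Ci gi] := geo_coef_dinv.
have ei : expansion 0 dinv_coef Ci 1 (fun z y => psum dinv_coef z k.+1 y).
  by apply: expansion_finite gi _ => i y ki; rewrite /dinv_coef leqNgt ki.
have eH := expansion_comp ephi (expansion_comp ei epsi').
set rG1 := (X in expansion 0 _ _ X) in eG1; set rG2 := (X in expansion 0 _ _ X) in eG2.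
set rH := (X in expansion 0 _ _ X) in eH.
have r_gt0 (F G : normedModType K) z (a : nat -> F -> G) C r W : expansion z a C r W -> 0 < r.
  by case=> -[].
have [U [oU U0 UD Ur]] : exists U : set K, [/\ open U, U 0, U `<=` D &
    forall r z, r \in [:: rf; rf'; rS; rp; rp'; rpD; rG1; rG2; rH] -> U z ->
      `|z| * r <= 8^-1].
  apply: common_disc => t; rewrite !inE.
  by do ![case/orP=> [/eqP->|]; first by apply: r_gt0; eassumption];
    move=> /eqP->; apply: r_gt0; eassumption.
have inU r z : r \in [:: rf; rf'; rS; rp; rp'; rpD; rG1; rG2; rH] -> U z ->
    `|z - 0| * r <= 4^-1.
  by move=> rin Uz; rewrite subr0 (le_trans (Ur r z rin Uz))// quarter_ge_eighth.
have linphi w : U w -> linear (phi w).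
  move=> Uw; apply: bounded_linear_lin; apply: (expansion_bounded archiK ephi).
  by apply: inU Uw; rewrite !inE eqxx ?orbT.
exists U, phi, phi', psi, psi'; split=> //.
- by apply: expansion_op_power_series ephi _ => // z; apply: Ur; rewrite !inE eqxx ?orbT.
- by apply: expansion_op_power_series epsi _ => // z; apply: Ur; rewrite !inE eqxx ?orbT.
- by apply: expansion_op_power_series eS _ => // z; apply: Ur; rewrite !inE eqxx ?orbT.
- by move=> z Uz; apply: phiK; apply: Ur Uz; rewrite !inE eqxx ?orbT.
- by move=> z Uz; apply: psiK; apply: Ur Uz; rewrite !inE eqxx ?orbT.
- move=> z Uz; split.
  + by apply: (expansion_bounded archiK ephi); apply: inU Uz; rewrite !inE eqxx ?orbT.
  + by apply: (expansion_bounded archiK ephi'); apply: inU Uz; rewrite !inE eqxx ?orbT.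
  + by apply: (expansion_bounded archiK epsi); apply: inU Uz; rewrite !inE eqxx ?orbT.
  + by apply: (expansion_bounded archiK epsi'); apply: inU Uz; rewrite !inE eqxx ?orbT.
- have an (F G : completeNormedModType K) (a : nat -> F -> G) C r W :
      expansion 0 a C r W -> r \in [:: rf; rf'; rS; rp; rp'; rpD; rG1; rG2; rH] ->
      analytic_on U W.
    move=> eW rin; apply: (expansion_analytic_on archiK eW) => z Uz; first exact: Ur.
    by apply: filterE.
  split.
  + by apply: an ephi _; rewrite !inE eqxx ?orbT.
  + by apply: an epsi _; rewrite !inE eqxx ?orbT.
  + by apply: an eS _; rewrite !inE eqxx ?orbT.
  + by apply: an eG1 _; rewrite !inE eqxx ?orbT.
  + by apply: an eG2 _; rewrite !inE eqxx ?orbT.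
- split=> x.
  + by rewrite (expansion_center _ ephi) Phi0.
  + by rewrite (expansion_center _ ephi') phic0.
  + by rewrite (expansion_center _ epsi).
  + by rewrite (expansion_center _ epsi') psic0.
- move=> z x Uz; apply: (expansion_eq archiK x eS epD) => //.
  + by apply: inU Uz; rewrite !inE eqxx ?orbT.
  + by apply: inU Uz; rewrite !inE eqxx ?orbT.
- move=> z [Uz /eqP z0].
  have zH : `|z| * rH <= 8^-1 by apply: Ur Uz; rewrite !inE eqxx ?orbT.
  have [b eb] := expansion_recenter archiK eH zH.
  have [c [C' [r' ec]]] := expansion_negpower k z0 eb.
  apply: (expansion_analytic_at archiK ec).
  have nU : \forall w \near z, U w by apply: open_nbhs_nbhs.
  apply: filterS2 nU (near_neq0 z0) => w Uw w0 y.
  by rewrite psum_dinv// (linfZ (linphi w Uw)) scalerA mulVf ?scale1r// expf_neq0.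
- exists (cauchy_prod Phi (cauchy_prod dinv_coef psic)); split.
  + by move=> i; exact: geo_coef_bounded eH.1.
  + move=> _; have [v Nv Sv] := exists_Nc_neq0 hrec linL hstab.
    exists (S k.+1 v); rewrite /cauchy_prod !big_nat1 Phi0 psic0 /dinv_coef /=.
    rewrite (T_S hrec linL)// eqxx => v0; apply: Sv.
    by rewrite v0 linf0//; exact: bounded_linear_lin (bS _).
  + have nU : \forall z \near 0^', U z by apply: nbhs_dnbhs; apply: open_nbhs_nbhs.
    have n0 : \forall z \near (0 : K)^', z != 0 by exact: nbhs_dnbhs_neq.
    apply: filterS2 nU n0 => z Uz z0.
    have zH : `|z - 0| * rH <= 4^-1 by apply: inU Uz; rewrite !inE eqxx ?orbT.
    have := expansion_op_series archiK eH zH; rewrite subr0; apply: op_series_ext => y.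
    by rewrite psum_dinv// (linfZ (linphi z Uz)).
Qed.

Lemma DeltaInv_pole : pole_of_order k DelInv.
Proof.
have [Ci gi] := geo_coef_dinv.
have ei : expansion 0 dinv_coef Ci 1 (fun z y => psum dinv_coef z k.+1 y).
  by apply: expansion_finite gi _ => i y ki; rewrite /dinv_coef leqNgt ki.
exists dinv_coef; split.
- by move=> i; exact: geo_coef_bounded gi.
- move=> _; have [v Nv Sv] := exists_Nc_neq0 hrec linL hstab.
  exists (S k.+1 v); rewrite /dinv_coef /= (T_S hrec linL)// eqxx => v0; apply: Sv.
  by rewrite v0 linf0//; exact: bounded_linear_lin (bS _).
- have n0 : \forall z \near (0 : K)^', z != 0 by exact: nbhs_dnbhs_neq.
  have n1 : \forall z \near (0 : K)^', `|z - 0| * 1 <= 8^-1.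
    by apply: nbhs_dnbhs; exact: near_scaled_dist.
  apply: filterS2 n0 n1 => z z0 z1.
  have := expansion_op_series archiK ei (le_trans z1 quarter_ge_eighth).
  by rewrite subr0; apply: op_series_ext => y; rewrite psum_dinv.
Qed.

Lemma bounded_DeltaInv z : bounded_linear (DelInv z).
Proof.
apply: (bounded_linear_ext _ (fun y => esym (DeltaInvE hrec linL k z y))).
apply: bounded_linear_sum => i; rewrite mem_index_iota => /andP[i1 _].
by apply: bounded_linear_scale; exact: bT.
Qed.

Lemma DeltaInv_smooth : smooth_on [set z : K | z <> 0] DelInv.
Proof.
(* The [n]-th derivative of [z ^- m] is [c n m * z ^- (m + n)]. *)
pose c n m : K := \prod_(0 <= j < n) - (m + j)%:R.
exists (fun n z y => \sum_(1 <= i < k.+2) (c n i.-1 * z ^- (i.-1 + n)) *: T i y); split.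
- move=> z _ y; rewrite (DeltaInvE hrec linL); apply: eq_bigr => i _.
  by rewrite /c big_geq// mul1r addn0.
- move=> n z _; apply: bounded_linear_sum => i; rewrite mem_index_iota => /andP[i1 _].
  by apply: bounded_linear_scale; exact: bT.
- move=> n z /eqP z0; apply: has_op_derivative_sum => i; rewrite mem_index_iota => /andP[i1 _].
  apply: (has_op_derivative_scale (f := fun w => c n i.-1 * w ^- (i.-1 + n))); first exact: bT.
  have -> : c n.+1 i.-1 * z ^- (i.-1 + n.+1) =
      c n i.-1 * (- (i.-1 + n)%:R * z ^- (i.-1 + n).+1).
    by rewrite /c big_nat_recr//= addnS mulrA.
  rewrite (_ : (fun w => _) = (fun w => c n i.-1 *
      (w^-1 * ((z + w) ^- (i.-1 + n) - z ^- (i.-1 + n))))); last first.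
    by apply/funext => w; rewrite -mulrBr mulrCA.
  by apply: cvgM; [exact: cvg_cst|exact: derivative_negpower].
Qed.

End Families.

(** * The normal form theorem *)

Lemma scalar_archimedean (R : realType) s : archimedean (scalar_field R s).
Proof.
case: s => /= x x0; first by exists (Num.bound x); exact: archi_boundP.
case: x x0 => a b; rewrite lecE /= => /andP[/eqP b0 a0].
exists (Num.bound a); rewrite -(rmorph_nat (@real_complex R)) ltcE /= b0 eqxx /=.
exact: archi_boundP.
Qed.

Lemma op_inv_cancel (K : numFieldType) (E F : normedModType K) (f : E -> F) g :
  cancel f g -> cancel g f -> op_inv f =1 g.
Proof.
move=> fg gf y; rewrite /op_inv -{1}(gf y) pinvKV ?inE//.
by move=> u v _ _; exact: (can_inj fg).
Qed.

Theorem theorem3 (R : realType) (s : scalar_kind)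
  (B Bbar : completeNormedModType (scalar_field R s))
  (D : set (scalar_field R s)) (L : nat -> B -> Bbar)
  (Lf : scalar_field R s -> B -> Bbar)
  (hD : open D) (hD0 : D 0)
  (hL : op_power_series D L Lf)
  (N Nc : nat -> set B) (Rg Rgc : nat -> set Bbar)
  (Sbar S : nat -> B -> Bbar) (M E : nat -> nat -> B -> B)
  (hrec : recursion L N Nc Rg Rgc Sbar S M E)
  (k : nat) (hstab : stabilizes_at Rg k)
  (hNc : forall i, (1 <= i <= k.+1)%N -> closed (Nc i))
  (hN : closed (N k.+1))
  (hR : forall i, (1 <= i <= k.+1)%N -> closed (Rg i))
  (hRc : closed (Rgc k.+1)) :
  exists (U : set (scalar_field R s))
         (phi : scalar_field R s -> B -> B)
         (psi : scalar_field R s -> Bbar -> Bbar),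
  let P := projN N Nc k in
  let calP := projR Rg Rgc k in
  let Del := Delta N Nc S k in
  let DelInv := DeltaInv Nc Rg Rgc S k in
  let LInv := fun z => phi z \o DelInv z \o op_inv (psi z) in
  let sumP := fun x => \sum_(1 <= i < k.+2) P i x in
  let sumcalP := fun y => \sum_(1 <= i < k.+2) calP i y in
  let NcSum := sum_spaces Nc 1 k.+2 in
  let RSum := sum_spaces Rg 1 k.+2 in
  [/\ [/\ open U, U 0 & U `<=` D],
      [/\ op_power_series U (fun i => M k.+1 (k.+1 + i)%N) phi,
          op_power_series U (psi_coef Nc Rg Rgc S k) psi,
          analytic_bijections U phi
        & analytic_bijections U psi],
      (* (i) *)
      [/\ op_power_series U (fun i => S i.+1) (fun z => Lf z \o phi z)
            /\ analytic_on U (fun z => Lf z \o phi z),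
          forall l, (1 <= l <= k.+1)%N ->
            [/\ S l @` sum_spaces Nc 0 l `<=` Rgc l.-1,
                S l @` Nc l = Rg l
              & S l @` N l = [set 0]],
          forall l, (2 <= l)%N ->
            range (S (k + l)%N) `<=` Rgc k.+1
            /\ S (k + l)%N @` N k.+1 = [set 0]
        & forall l, S l.+1 @` N k.+1 = [set 0]],
      (* (ii) *)
      [/\ forall z, U z -> op_inv (psi z) \o Lf z \o phi z =1 Del z,
          forall i, (1 <= i <= k.+1)%N -> bounded_linear (S i \o P i),
          exists x, S k.+1 (P k.+1 x) <> 0
        & analytically_equivalent U Lf Del]
    & [/\
      (* (iii) *)
      [/\ forall z, U z -> z <> 0 -> [set x | Lf z x = 0] = phi z @` N k.+1,
          forall z, U z -> z <> 0 -> range (Lf z) = psi z @` RSum,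
          analytically_embedded U (fun z => [set x | Lf z x = 0]) phi (N k.+1)
        & analytically_embedded U (fun z => range (Lf z)) psi RSum],
      (* (iv) *)
      [/\ forall z : scalar_field R s, z <> 0 ->
            generalized_inverse (Del z) (DelInv z),
          smooth_on [set z : scalar_field R s | z <> 0] DelInv
        & pole_of_order k DelInv],
      [/\ forall z, U z -> z <> 0 -> generalized_inverse (Lf z) (LInv z),
          analytic_on (U `\ 0) LInv
        & pole_of_order k LInv],
      [/\ forall z, U z -> z <> 0 ->
            LInv z \o Lf z =1 phi z \o sumP \o op_inv (phi z),
          forall z, U z -> z <> 0 ->
            is_projection_onto (LInv z \o Lf z) (phi z @` NcSum),
          analytic_on (U `\ 0) (fun z => LInv z \o Lf z)
        & exists G : scalar_field R s -> B -> B,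
            [/\ analytic_on U G,
                forall z, U z -> z <> 0 -> G z =1 LInv z \o Lf z
              & G 0 =1 sumP]]
    & [/\ forall z, U z -> z <> 0 ->
            Lf z \o LInv z =1 psi z \o sumcalP \o op_inv (psi z),
          forall z, U z -> z <> 0 ->
            is_projection_onto (Lf z \o LInv z) (psi z @` RSum)
            /\ psi z @` RSum = range (Lf z),
          analytic_on (U `\ 0) (fun z => Lf z \o LInv z)
        & exists G : scalar_field R s -> Bbar -> Bbar,
            [/\ analytic_on U G,
                forall z, U z -> z <> 0 -> G z =1 Lf z \o LInv z
              & G 0 =1 sumcalP]]]].
Proof.
have archiK := @scalar_archimedean R s.
have bL := hL.1; have linL i : linear (L i) := bounded_linear_lin (bL i).
have [U [phi [phi' [psi [psi' nf]]]]] :=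
  normal_form_exists archiK hD hD0 hL hrec hstab hNc hN hR hRc.
exists U, phi, psi => P calP Del DelInv LInv sumP sumcalP NcSum RSum.
have bS i (i0 : (0 < i)%N) : bounded_linear (S i) :=
  bounded_S archiK hrec bL hstab hNc hR hRc i0.
have PE i x : (1 <= i <= k.+1)%N -> P i x = chain_part N Nc i x.
  exact: (projN_part hrec linL).
have sumPE x : sumP x = sum_p N Nc k x by exact: (sum_projN hrec linL).
have sumcalPE y : sumcalP y = sum_q Rg Rgc k y by exact: (sum_projR hrec linL).
have [anphi anpsi anLphi anG1 anG2] := nf_analytic nf.
have [phi0 phi'0 psi0 psi'0] := nf_center nf.
have phiK z Uz : cancel (phi z) (phi' z) := (nf_phiK nf Uz).1.
have phiK' z Uz : cancel (phi' z) (phi z) := (nf_phiK nf Uz).2.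
have psiK z Uz : cancel (psi z) (psi' z) := (nf_psiK nf Uz).1.
have psiK' z Uz : cancel (psi' z) (psi z) := (nf_psiK nf Uz).2.
have phiV z Uz : op_inv (phi z) =1 phi' z := op_inv_cancel (phiK z Uz) (phiK' z Uz).
have psiV z Uz : op_inv (psi z) =1 psi' z := op_inv_cancel (psiK z Uz) (psiK' z Uz).
have LphiE z x : U z -> Lf z (phi z x) = psi z (Del z x) by exact: (nf_diag nf).
have LE z x : U z -> Lf z x = psi z (Del z (phi' z x)).
  by move=> Uz; rewrite -LphiE// phiK'.
have LInvE z y : U z -> LInv z y = phi z (DelInv z (psi' z y)).
  by move=> Uz; rewrite /LInv /= psiV.
have DI z x : z <> 0 -> DelInv z (Del z x) = sumP x.
  by move=> /eqP z0; rewrite sumPE; exact: (DeltaInv_Delta hrec linL).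
have ID z y : z <> 0 -> Del z (DelInv z y) = sumcalP y.
  by move=> /eqP z0; rewrite sumcalPE; exact: (Delta_DeltaInv hrec linL).
have PD z x : sumcalP (Del z x) = Del z x.
  by rewrite sumcalPE; exact: (sum_q_Delta hrec linL).
have DP z y : sumP (DelInv z y) = DelInv z y.
  by rewrite sumPE; exact: (sum_p_DeltaInv hrec linL).
have LInvL z x : U z -> z <> 0 -> LInv z (Lf z x) = phi z (sumP (phi' z x)).
  by move=> Uz z0; rewrite LInvE// LE// psiK// DI.
have LLInv z y : U z -> z <> 0 -> Lf z (LInv z y) = psi z (sumcalP (psi' z y)).
  by move=> Uz z0; rewrite LE// LInvE// phiK// ID.
have an_phi : analytic_bijections U phi.
  split=> // z Uz; have [bphi _ _ _] := nf_bounded nf Uz; split=> //.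
  by exists (phi' z); [exact: phiK|exact: phiK'].
have an_psi : analytic_bijections U psi.
  split=> // z Uz; have [_ _ bpsi _] := nf_bounded nf Uz; split=> //.
  by exists (psi' z); [exact: psiK|exact: psiK'].
have diag z (Uz : U z) : op_inv (psi z) \o Lf z \o phi z =1 Del z.
  by move=> x /=; rewrite psiV// LphiE// psiK.
have kerL z : U z -> z <> 0 -> [set x | Lf z x = 0] = phi z @` N k.+1.
  move=> Uz /eqP z0; have [_ _ bpsi _] := nf_bounded nf Uz.
  have Del0 x : Del z x = 0 <-> N k.+1 x by exact: (Delta_eq0 hrec linL).
  apply/seteqP; split=> [x /= Lx|_ [u Nu <-] /=].
    exists (phi' z x); last exact: phiK'.
    apply/Del0; apply: (can_inj (psiK z Uz)).
    by rewrite -LE// Lx linf0//; exact: bounded_linear_lin.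
  rewrite LphiE// (Del0 u).2//.
  by rewrite linf0//; exact: bounded_linear_lin.
have rangeL z : U z -> z <> 0 -> range (Lf z) = psi z @` RSum.
  move=> Uz /eqP z0; rewrite /RSum -(range_Delta hrec linL k z0).
  apply/seteqP; split=> [_ [x _ <-]|_ [_ [u _ <-] <-]].
    by rewrite LE//; exists (Del z (phi' z x)) => //; exists (phi' z x).
  by exists (phi z u) => //; rewrite LphiE.
have gi z (z0 : z <> 0) : generalized_inverse (Del z) (DelInv z).
  split.
  - exact: (bounded_DeltaInv archiK hL hrec hstab).
  - by move=> x /=; rewrite ID.
  - by move=> y /=; rewrite DI.
have sub_near z : (U `\ 0) z -> \forall w \near z, U w /\ w <> 0.
  move=> [Uz /eqP z0]; have nU : \forall w \near z, U w.
    by apply: open_nbhs_nbhs; split => //; exact: nf_open nf.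
  by apply: filterS2 nU (near_neq0 z0) => w Uw /eqP.
have an_restrict (F G : normedModType (scalar_field R s)) (T T' : scalar_field R s -> F -> G) :
    analytic_on U T -> (forall w x, U w -> w <> 0 -> T w x = T' w x) ->
    analytic_on (U `\ 0) T'.
  move=> anT TT z Uz; have [a [ba na]] := anT z Uz.1; exists a; split=> //.
  apply: filterS2 (sub_near z Uz) na => w [Uw w0]; apply: op_series_ext => x.
  exact: TT.
split.
- by split; [exact: nf_open nf|exact: nf_0 nf|exact: nf_sub nf].
- by split=> //; [exact: nf_phi nf|exact: nf_psi nf].
- split.
  + by split; [exact: nf_Lphi nf|exact: anLphi].
  + move=> l /andP[l1 lk]; split.
    * move=> _ [x _ <-]; case: l l1 lk => // l _ _; exact: (S_codomain hrec linL).
    * exact: (S_image_Nc hrec linL).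
    * by apply: (S_image_N hrec linL hstab) => //; rewrite leqnn.
  + move=> l l2; split; last first.
      by apply: (S_image_N hrec linL hstab); [lia|rewrite leqnn orbT].
    move=> _ [x _ <-]; case: l l2 => // l l1; rewrite addnS.
    by apply: (Rgc_stab hrec (l := (k + l)%N)); [lia|exact: (S_codomain hrec linL)].
  + by move=> l; apply: (S_image_N hrec linL hstab) => //; rewrite leqnn orbT.
- split.
  + exact: diag.
  + move=> i ik; apply: (bounded_linear_ext (f := fun x => S i (chain_part N Nc i x))).
      apply: bounded_linear_comp; first by apply: bS; case/andP: ik.
      exact: (bounded_p archiK hrec bL hNc hN).
    by move=> x /=; rewrite PE.
  + have [v Nv Sv] := exists_Nc_neq0 hrec linL hstab; exists v.
    rewrite PE ?leqnn//; have -> : chain_part N Nc k.+1 v = v; last exact: Sv.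
    rewrite (chain_part_V (chain_kernels hrec) (subspace_Nc hrec)
      (subspace_N hrec linL) _ _ Nv)// ?eqxx//.
  + by exists phi, psi.
split.
- split.
  + exact: kerL.
  + exact: rangeL.
  + by split=> //; exact: (subspace_N hrec linL).
  + split=> //; apply: subspace_sum_spaces => j _; exact: (subspace_Rg hrec linL).
- split.
  + exact: gi.
  + exact: (DeltaInv_smooth archiK hL hrec hstab).
  + exact: (DeltaInv_pole archiK hL hrec hstab).
- split.
  + move=> z Uz z0; have [bphi _ _ bpsi'] := nf_bounded nf Uz; split.
    * apply: (bounded_linear_ext (f := fun y => phi z (DelInv z (psi' z y)))).
        apply: bounded_linear_comp => //; apply: bounded_linear_comp => //.
        by case: (gi z z0).
      by move=> y; rewrite LInvE.
    * by move=> x /=; rewrite LLInv// LE// psiK// PD.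
    * by move=> y /=; rewrite LInvL// LInvE// phiK// DP.
  + move=> z Uz; have [a [ba na]] := nf_inv_analytic nf Uz; exists a; split=> //.
    apply: filterS2 (sub_near z Uz) na => w [Uw w0]; apply: op_series_ext => y.
    by rewrite LInvE.
  + have [a [ba a0 na]] := nf_inv_pole nf; exists a; split=> //.
    have nU : \forall z \near 0^', U z.
      by apply: nbhs_dnbhs; apply: open_nbhs_nbhs; split; [exact: nf_open nf|exact: nf_0 nf].
    apply: filterS2 nU na => z Uz; apply: op_series_ext => y.
    by rewrite LInvE.
- split.
  + by move=> z Uz z0 x /=; rewrite phiV// LInvL.
  + move=> z Uz z0; have [bphi bphi' _ _] := nf_bounded nf Uz; split.
    * apply: (bounded_linear_ext (f := fun x => phi z (sum_p N Nc k (phi' z x)))).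
        apply: bounded_linear_comp => //; apply: bounded_linear_comp => //.
        apply: bounded_linear_sum => i; rewrite mem_index_iota => ik.
        exact: (bounded_p archiK hrec bL hNc hN).
      by move=> x /=; rewrite LInvL// sumPE.
    * by move=> x /=; rewrite !LInvL// phiK// !sumPE (sum_p_id hrec linL)//; exact: (sum_p_in hrec).
    * apply/seteqP; split=> [_ [x _ <-]|_ [u Nu <-]] /=.
        by rewrite LInvL// sumPE; exists (sum_p N Nc k (phi' z x)) => //; exact: (sum_p_in hrec).
      by exists (phi z u) => //; rewrite LInvL// phiK// sumPE (sum_p_id hrec linL).
  + by apply: an_restrict anG1 _ => z x Uz z0 /=; rewrite LInvL// sumPE.
  + exists (fun z x => phi z (sum_p N Nc k (phi' z x))); split=> //.
    * by move=> z Uz z0 x /=; rewrite LInvL// sumPE.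
    * by move=> x; rewrite phi0 phi'0 sumPE.
- split.
  + by move=> z Uz z0 y /=; rewrite psiV// LLInv.
  + move=> z Uz z0; have [_ _ bpsi bpsi'] := nf_bounded nf Uz; split; last first.
      by rewrite rangeL.
    split.
    * apply: (bounded_linear_ext (f := fun y => psi z (sum_q Rg Rgc k (psi' z y)))).
        apply: bounded_linear_comp => //; apply: bounded_linear_comp => //.
        by apply: bounded_linear_sum => i _; exact: (bounded_q archiK hrec bL hstab hR hRc).
      by move=> y /=; rewrite LLInv// sumcalPE.
    * by move=> y /=; rewrite !LLInv// psiK// !sumcalPE (sum_q_id hrec linL)//; exact: (sum_q_in hrec).
    * apply/seteqP; split=> [_ [y _ <-]|_ [u Ru <-]] /=.
        by rewrite LLInv// sumcalPE; exists (sum_q Rg Rgc k (psi' z y)) => //; exact: (sum_q_in hrec).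
      by exists (psi z u) => //; rewrite LLInv// psiK// sumcalPE (sum_q_id hrec linL).
  + by apply: an_restrict anG2 _ => z y Uz z0 /=; rewrite LLInv// sumcalPE.
  + exists (fun z y => psi z (sum_q Rg Rgc k (psi' z y))); split=> //.
    * by move=> z Uz z0 y /=; rewrite LLInv// sumcalPE.
    * by move=> y; rewrite psi0 psi'0 sumcalPE.
Qed.
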